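(* Consider the fully discrete method, discrete characteristics and slopes described in the context, with $u_0\in H_0^3(\mathbb T_L)$. Let $\tau$ be sufficiently small so that the locally unique stages described in the context exist. Assume further that $b_i\ge0$ for $i=1,\dots,s$, $\tau N^{1/2}\le1$, and $\Lambda\Phi\in\mathcal L_2(\mathcal U;H_0^3(\mathbb T_L))$. Suppose that the uniform regularity estimate $$\sup_{0\le k\le N_t}\mathbb E\|U_N^k\|_{H^3}^4+\sup_{0\le k<N_t}\sup_{1\le i\le s}\mathbb E\|U_{N,i}^k\|_{H^3}^4\le M_T \tag{R}$$ holds on $[0,T]$ for some $M_T>0$ independent of $N$ and $\tau$. Set $$C_{2,\mathrm{st}}(T):=2C_0^2\sup_{0\le k<N_t}\sum_{i=1}^sb_i\,\mathbb E\|U_{N,i}^k\|_{H^1}^2,$$ where $C_0$ is the norm of the embedding $H^1(\mathbb T_L)\hookrightarrow L^\infty(\mathbb T_L)$. Then there exists $C_T>0$, depending on $T$, $M_T$ and the Runge--Kutta coefficients but independent of $N$ and $\tau$, such that $$\frac{y_N^{k+1}-y_N^k}{\tau}\le-\frac12(y_N^k)^2+\frac12C_{N,\tau}(T),\qquad k=0,\dots,N_t-1,$$ where $C_{N,\tau}(T):=C_{2,\mathrm{st}}(T)+C_T\bigl(2N^{-1/2}+\tau+2\tau N^{1/2}\bigr)$. Let $y_{N,\tau}$ be the continuous piecewise linear interpolation $y_{N,\tau}(t)=y_N^k+\frac{t-t_k}{\tau}(y_N^{k+1}-y_N^k)$ for $t\in[t_k,t_{k+1}]$, and define $\widehat C_{N,\tau}(T):=C_{N,\tau}(T)+C_T\tau$.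 Then, for almost every $t\in(0,T)$, $$y_{N,\tau}'(t)\le-\frac12y_{N,\tau}(t)^2+\frac12\widehat C_{N,\tau}(T).$$ If $y_N^0<-\sqrt{\widehat C_{N,\tau}(T)}$, define $$T_{N,\tau}^*=\frac1{\sqrt{\widehat C_{N,\tau}(T)}}\log\left(\frac{\sqrt{\widehat C_{N,\tau}(T)}-y_N^0}{-y_N^0-\sqrt{\widehat C_{N,\tau}(T)}}\right).$$ Then the uniform regularity estimate (R) can hold on $[0,T]$ only if $T_{N,\tau}^*>T$.
   Context: $\mathbb T_L=\mathbb R/L\mathbb Z$ is identified with $[a,b)$, $L=b-a$, $\mu=2\pi/L$. Fourier coefficients: $\widehat f(k)=\frac1L\int_a^bf(x)e^{-\mathrm ik\mu(x-a)}dx$; $\|f\|_{H^r}^2=\sum_k(1+|k\mu|^2)^r|\widehat f(k)|^2$; $H_0^r$ is the zero-mean subspace of $H^r(\mathbb T_L)$. $\Lambda=(1-\partial_x^2)^{-1}$. $W$ is a cylindrical Wiener process on $\mathcal U=L_0^2(\mathbb T_L)$ (zero-mean $L^2$), adapted to a filtration $(\mathcal F_t)$; $\mathcal L_2$ denotes Hilbert--Schmidt operators; $u_0$ is deterministic. For $N\ge1$, $S_N$ is the space of real-valued zero-mean trigonometric polynomials $\sum_{0<|k|\le N}\widehat v(k)e^{\mathrm ik\mu(x-a)}$, and $P_Nf=\sum_{0<|k|\le N}\widehat f(k)e^{\mathrm ik\mu(x-a)}$. Time grid: $\tau=T/N_t$, $t_k=k\tau$, $\Delta W_k=W(t_{k+1})-W(t_k)$;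 $G_N=P_N\Lambda\Phi$. Method (velocity component): $\mathbf A=(a_{ij})_{i,j=1}^s$ is invertible and the Runge--Kutta coefficients satisfy $b_ia_{ij}+b_ja_{ji}=b_ib_j$ and $\sum_ib_i=1$. Set $U_N^0=P_Nu_0$, $F_N(U)=-P_N[\frac12\partial_x(U^2)+\partial_x\Lambda(U^2+\frac12(\partial_xU)^2)]$, and $$U_{N,i}^k=U_N^k+\tau\sum_{j=1}^sa_{ij}F_N(U_{N,j}^k),\quad \bar U_N^{k+1}=U_N^k+\tau\sum_{i=1}^sb_iF_N(U_{N,i}^k),\quad U_N^{k+1}=\bar U_N^{k+1}+G_N\Delta W_k.$$ Discrete characteristics: fix $x_0\in\mathbb T_L$, $X_N^0=x_0$, and $$X_{N,i}^k=X_N^k+\tau\sum_{j=1}^sa_{ij}U_{N,j}^k(X_{N,j}^k),\qquad X_N^{k+1}=X_N^k+\tau\sum_{i=1}^sb_iU_{N,i}^k(X_{N,i}^k).$$ For $\tau$ small, the stage systems for $(U_{N,i}^k)_i$ and $(X_{N,i}^k)_i$ have locally unique solutions near $(U_N^k,\dots,U_N^k)$ and $(X_N^k,\dots,X_N^k)$ (these are the solutions used); $U_{N,i}^k$, $X_{N,i}^k$, $X_N^{k+1}$ are $\mathcal F_{t_k}$-measurable. Slopes: $Y_N^k:=\partial_xU_N^k(X_N^k)$ and $y_N^k:=\mathbb E[Y_N^k]$, so $y_N^0=\partial_xP_Nu_0(x_0)$. *)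

(* Defs.v *)
From HB Require Import structures.
From mathcomp Require Import all_boot all_order all_algebra.
From mathcomp Require Import all_classical all_reals all_analysis.
From mathcomp Require Import complex.
Set Implicit Arguments.
Unset Strict Implicit.
Unset Printing Implicit Defensive.
Import Order.TTheory GRing.Theory Num.Theory.
Import numFieldNormedType.Exports.
Local Open Scope classical_set_scope.
Local Open Scope ring_scope.
Local Open Scope complex_scope.

(* Functions on the torus R/LZ, L = b - a, are L-periodic functions R -> R;
   points of the torus are represented by real lifts. *)
Section Torus.
Context {R : realType}.
Variables (a b : R).

Local Notation leb := (@lebesgue_measure R).

Definition period : R := b - a.
Definition wavenumber : R := 2 * pi / period.

Definition expi (t : R) : R[i] := cos t +i* sin t.

(* e^{i k mu (x - a)} *)
Definition mode (k : int) (x : R) : R[i] :=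
  expi (k%:~R * wavenumber * (x - a)).

Definition cintegral (g : R -> R[i]) : R[i] :=
  (\int[leb]_(x in `[a, b]) complex.Re (g x))%R
  +i* (\int[leb]_(x in `[a, b]) complex.Im (g x))%R.

Definition fourier (f : R -> R) (k : int) : R[i] :=
  (period^-1)%:C * cintegral (fun x => (f x)%:C * mode (- k) x).

Definition L2 (f : R -> R) : Prop :=
  [/\ periodic f period, measurable_fun [set: R] f &
      leb.-integrable `[a, b] (EFin \o (fun x => f x ^+ 2))].

Definition zero_mean (f : R -> R) : Prop := fourier f 0 = 0.

Definition L2_0 (f : R -> R) : Prop := L2 f /\ zero_mean f.

(* Normalised by 1/L, so that inner f f is the squared H^0 norm below. *)
Definition inner (f g : R -> R) : R :=
  period^-1 * (\int[leb]_(x in `[a, b]) (f x * g x))%R.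

Definition sobolev_sq (r : nat) (f : R -> R) : \bar R :=
  \esum_(k in [set: int])
    ((1 + `|k%:~R * wavenumber| ^+ 2) ^+ r
     * ComplexField.Normc.normc (fourier f k) ^+ 2)%:E.

Definition sobolev (r : nat) (f : R -> R) : Prop :=
  L2 f /\ (sobolev_sq r f < +oo)%E.

Definition sobolev0 (r : nat) (f : R -> R) : Prop :=
  sobolev r f /\ zero_mean f.

(* Meaningful only on H^r: fine sends +oo to 0. *)
Definition sobolev_norm (r : nat) (f : R -> R) : R :=
  Num.sqrt (fine (sobolev_sq r f)).

Definition Linfty_norm (f : R -> R) : \bar R :=
  'N[mrestr leb (measurable_itv `[a, b])]_+oo [EFin \o f]%E.

(* C is the (finite) operator norm of the embedding H^1 -> L^infty. *)
Definition is_embedding_norm (C : R) : Prop :=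
  C%:E = ereal_sup [set Linfty_norm f |
                     f in [set f | sobolev 1 f /\ sobolev_norm 1 f <= 1]].

(* The integers k with |k| <= n. *)
Definition zrange (n : nat) : seq int := [seq i%:Z - n%:Z | i <- iota 0 n.*2.+1].

(* For real-valued f the complex sums below are real, since fourier f (- k) is
   the conjugate of fourier f k. *)
Definition proj (N : nat) (f : R -> R) : R -> R := fun x =>
  complex.Re (\sum_(k <- zrange N | k != 0) fourier f k * mode k x).

(* (1 - d^2/dx^2)^{-1}: the operator 1 - d^2/dx^2 multiplies the k-th Fourier
   coefficient by 1 + (k mu)^2. The series converges absolutely for integrable
   f, and its sum depends only on the a.e. class of f. *)
Definition Lambda (f : R -> R) : R -> R := fun x =>
  limn (fun n : nat => complex.Re
    (\sum_(k <- zrange n)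
       ((1 + (k%:~R * wavenumber) ^+ 2)^-1)%:C * fourier f k * mode k x)).

Definition trig_space (N : nat) (v : R -> R) : Prop :=
  exists c : int -> R[i],
    forall x, (v x)%:C = \sum_(k <- zrange N | k != 0) c k * mode k x.

Definition drift (N : nat) (U : R -> R) : R -> R := fun x =>
  - proj N (fun z =>
      2^-1 * derive1 (fun y => U y ^+ 2) z
      + derive1 (Lambda (fun y => U y ^+ 2 + 2^-1 * (derive1 U y) ^+ 2)) z) x.

Definition orthonormal_basis (e : nat -> R -> R) : Prop :=
  [/\ forall j, L2_0 (e j),
      forall i j, inner (e i) (e j) = (i == j)%:R &
      forall f, L2_0 f -> (forall j, inner f (e j) = 0) ->
        {ae leb, forall x, f x = 0}].

(* S is a Hilbert-Schmidt operator from L^2_0 to H^r_0; equality of functions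
   is a.e. equality. *)
Definition hilbert_schmidt (r : nat) (S : (R -> R) -> R -> R) : Prop :=
  [/\ forall h, L2_0 h -> sobolev0 r (S h),
      forall (c : R) h h', L2_0 h -> L2_0 h' ->
        {ae leb, forall x, S (fun z => c * h z + h' z) x = c * S h x + S h' x},
      exists K : R, forall h, L2_0 h ->
        sobolev_norm r (S h) <= K * sobolev_norm 0 h &
      exists2 e, orthonormal_basis e &
        (\sum_(0 <= j <oo) sobolev_sq r (S (e j)) < +oo)%E].

End Torus.

Section RungeKutta.
Context {R : realType}.
Variables (a b : R) (N s : nat) (A : 'M[R]_s) (w : 'I_s -> R) (tau : R).

Definition symplectic : Prop :=
  forall i j, w i * A i j + w j * A j i = w i * w j.

Definition velocity_stages (u : R -> R) (v : 'I_s -> R -> R) : Prop :=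
  (forall i, trig_space a b N (v i)) /\
  forall i x, v i x = u x + tau * \sum_(j < s) A i j * drift a b N (v j) x.

(* v is the only solution of the stage system in some ball around (u,...,u). *)
Definition local_velocity_stages (u : R -> R) (v : 'I_s -> R -> R) : Prop :=
  velocity_stages u v /\
  exists r : R,
    let near_u (z : 'I_s -> R -> R) :=
      forall i, sobolev_norm a b 0 (fun x => z i x - u x) < r in
    [/\ 0 < r, near_u v &
        forall v', velocity_stages u v' -> near_u v' -> forall i, v' i =1 v i].

(* z is the noise increment added to the Runge-Kutta update. *)
Definition velocity_step (u : R -> R) (v : 'I_s -> R -> R) (z u' : R -> R) :
    Prop :=
  local_velocity_stages u v /\
  forall x, u' x = u x + tau * (\sum_(i < s) w i * drift a b N (v i) x) + z x.

Definition char_stages (v : 'I_s -> R -> R) (X : R) (Y : 'I_s -> R) : Prop :=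
  forall i, Y i = X + tau * \sum_(j < s) A i j * v j (Y j).

Definition local_char_stages (v : 'I_s -> R -> R) (X : R) (Y : 'I_s -> R) :
    Prop :=
  char_stages v X Y /\
  exists r : R,
    let near_X (Z : 'I_s -> R) := forall i, `|Z i - X| < r in
    [/\ 0 < r, near_X Y &
        forall Y', char_stages v X Y' -> near_X Y' -> Y' =1 Y].

Definition char_step (v : 'I_s -> R -> R) (X : R) (Y : 'I_s -> R) (X' : R) :
    Prop :=
  local_char_stages v X Y /\ X' = X + tau * \sum_(i < s) w i * v i (Y i).

End RungeKutta.

Section Stochastic.
Context {R : realType} {d : measure_display} {Om : measurableType d}.
Variables (P : probability Om R) (T : R) (F : R -> set (set Om)).

Definition filtration : Prop :=
  [/\ forall t, 0 <= t <= T -> sigma_algebra [set: Om] (F t),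
      forall t, 0 <= t <= T -> F t `<=` measurable &
      forall s t, 0 <= s -> s <= t -> t <= T -> F s `<=` F t].

Definition F_measurable (t : R) (X : Om -> R) : Prop :=
  forall B, measurable B -> F t (X @^-1` B).

(* Measurability of a random trigonometric polynomial, i.e. of its (finitely
   many) Fourier coefficients. *)
Definition F_measurable_fun (a b t : R) (V : Om -> R -> R) : Prop :=
  forall k, F_measurable t (fun om => complex.Re (fourier a b (V om) k)) /\
            F_measurable t (fun om => complex.Im (fourier a b (V om) k)).

(* W(t) = sum_j beta_j(t) e_j with (e_j) an orthonormal basis of L^2_0 and
   independent F-Brownian motions beta_j: the last clause says that the
   increments over [t, t'] are independent N(0, t' - t) variables, jointly
   independent of F_t. *)
Definition cylindrical_wiener (a b : R) (e : nat -> R -> R)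
    (beta : nat -> R -> Om -> R) : Prop :=
  [/\ orthonormal_basis a b e,
      forall j, {ae P, forall om, beta j 0 om = 0},
      forall j, {ae P, forall om, {within `[0, T], continuous (beta j ^~ om)}},
      forall j t, 0 <= t <= T -> F_measurable t (beta j t) &
      forall t t' (E : set Om) n (B : nat -> set R),
        0 <= t -> t < t' -> t' <= T -> F t E -> (forall j, measurable (B j)) ->
        P (E `&` [set om | forall j, (j < n)%N ->
                             B j (beta j t' om - beta j t om)])
        = (P E * \prod_(j < n) normal_prob 0 (Num.sqrt (t' - t)) (B j))%E].

(* Z is (a version of) G(W(t') - W(t)), the limit in mean square of
   sum_{j < n} (beta_j(t') - beta_j(t)) G e_j in the space S_N. *)
Definition noise_increment (a b : R) (N : nat) (e : nat -> R -> R)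
    (beta : nat -> R -> Om -> R) (G : (R -> R) -> R -> R) (t t' : R)
    (Z : Om -> R -> R) : Prop :=
  [/\ forall om, trig_space a b N (Z om),
      F_measurable_fun a b t' Z &
      (fun n : nat => 'E_P[fun om => (sobolev_norm a b 0 (fun x =>
         (\sum_(j < n) (beta j t' om - beta j t om) * G (e j) x) - Z om x)
         ^+ 2)%R]%E) @ \oo --> 0%E].

(* The fully discrete method with time step tau = T / Nt, its stages, and the
   discrete characteristic issued from x0. Equalities between random variables
   are almost sure. *)
Record discrete_method (a b : R) (N Nt s : nat) (A : 'M[R]_s) (w : 'I_s -> R)
    (e : nat -> R -> R) (beta : nat -> R -> Om -> R) (Phi : (R -> R) -> R -> R)
    (u0 : R -> R) (x0 : R)
    (U : nat -> Om -> R -> R) (Ust : nat -> 'I_s -> Om -> R -> R)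
    (dM : nat -> Om -> R -> R)
    (X : nat -> Om -> R) (Xst : nat -> 'I_s -> Om -> R) : Prop := {
  dm_space : forall k om, (k <= Nt)%N -> trig_space a b N (U k om) ;
  dm_meas_U : forall k, (k <= Nt)%N ->
    F_measurable_fun a b (k%:R * (T / Nt%:R)) (U k) ;
  dm_meas_Ust : forall k i, (k < Nt)%N ->
    F_measurable_fun a b (k%:R * (T / Nt%:R)) (Ust k i) ;
  dm_meas_Xst : forall k i, (k < Nt)%N ->
    F_measurable (k%:R * (T / Nt%:R)) (Xst k i) ;
  dm_meas_X : forall k, (k < Nt)%N ->
    F_measurable (k%:R * (T / Nt%:R)) (X k.+1) ;
  dm_noise : forall k, (k < Nt)%N ->
    noise_increment a b N e beta (fun h => proj a b N (Lambda a b (Phi h)))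
      (k%:R * (T / Nt%:R)) (k.+1%:R * (T / Nt%:R)) (dM k) ;
  dm_init_X : forall om, X 0%N om = x0 ;
  dm_init_U : {ae P, forall om, U 0%N om =1 proj a b N u0} ;
  dm_velocity : forall k, (k < Nt)%N ->
    {ae P, forall om, velocity_step a b N A w (T / Nt%:R)
             (U k om) (fun i => Ust k i om) (dM k om) (U k.+1 om)} ;
  dm_char : forall k, (k < Nt)%N ->
    {ae P, forall om, char_step A w (T / Nt%:R)
             (fun i => Ust k i om) (X k om) (fun i => Xst k i om) (X k.+1 om)}
}.

Definition uniform_regularity (a b : R) (Nt s : nat)
    (U : nat -> Om -> R -> R) (Ust : nat -> 'I_s -> Om -> R -> R) (M : R) :
    Prop :=
  (ereal_sup [set 'E_P[fun om => (sobolev_norm a b 3 (U k om) ^+ 4)%R]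
              | k in [set k | (k <= Nt)%N]]
   + ereal_sup [set ereal_sup
       [set 'E_P[fun om => (sobolev_norm a b 3 (Ust k i om) ^+ 4)%R]
        | i in [set: 'I_s]] | k in [set k | (k < Nt)%N]]
   <= M%:E)%E.

Definition stage_constant (a b C0 : R) (Nt s : nat) (w : 'I_s -> R)
    (Ust : nat -> 'I_s -> Om -> R -> R) : R :=
  2 * C0 ^+ 2 *
  sup [set \sum_(i < s) w i *
         fine 'E_P[fun om => (sobolev_norm a b 1 (Ust k i om) ^+ 2)%R]%E
       | k in [set k | (k < Nt)%N]].

Definition mean_slope (U : nat -> Om -> R -> R) (X : nat -> Om -> R)
    (k : nat) : R :=
  fine 'E_P[fun om => derive1 (U k om) (X k om)]%E.

End Stochastic.

(* Piecewise linear interpolation of the values y k at the times k * tau. *)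
Definition interpolation (R : realType) (tau : R) (y : nat -> R) (t : R) : R :=
  let k := Num.truncn (t / tau) in
  y k + (t - k%:R * tau) / tau * (y k.+1 - y k).

Definition blowup_time (R : realType) (c y0 : R) : R :=
  (Num.sqrt c)^-1 * ln ((Num.sqrt c - y0) / (- y0 - Num.sqrt c)).

(* Main.v *)
(** Along a characteristic the slope Y of a Camassa-Holm type flow satisfies
    Y' = - Y^2/2 + u^2 - Lambda (u^2 + u_x^2/2) <= - Y^2/2 + u^2, because Lambda
    preserves nonnegativity.  All iterates are trigonometric polynomials, so one
    step of the scheme is expanded pathwise to first order in tau, using bounds
    on sums of weighted Fourier amplitudes: the H^3 norm controls two derivatives
    uniformly, a third derivative at the price N^(1/2), and the part cut off by
    P_N with the gain N^(-1/2).  This gives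
    Y(k+1) - noise - Y(k) <= tau (- Y(k)^2/2 + sum_i b_i U_i^2 + error), where the
    error is at most cubic in the H^3 norms.  The noise contribution has mean
    zero since X(k+1) is known at time t_k, and Jensen's inequality replaces
    E[Y^2] by y^2.  The resulting discrete Riccati inequality decreases the
    blow-up time of y by at least tau in each step. *)

Require Import Defs.
From mathcomp Require Import all_boot all_order all_algebra.
From mathcomp Require Import all_classical all_reals all_analysis.
From mathcomp Require Import measurable_realfun ess_sup_inf complex zify ring lra.
Import Order.TTheory GRing.Theory Num.Theory.
Import numFieldNormedType.Exports.
Set Implicit Arguments.
Unset Strict Implicit.
Unset Printing Implicit Defensive.
Local Open Scope classical_set_scope.
Local Open Scope ring_scope.

(** * Finite trigonometric sums *)

(** Sums of amplitudes replace Sobolev norms because they dominate the sup norm and are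
    submultiplicative, so the quadratic drift is estimated by triangle inequalities on frequencies.
    Cauchy-Schwarz is the only passage from H^3: for the weight (1 + |k mu|)^2 the quotient of
    squared weights decays like k^(-2), hence is summable with tail of order 1/N beyond N/2; for the
    exponent 3 it is only bounded, and the 2N frequencies give order N. The square roots are the
    three scales of the one-step estimate: [al] of order 1, [be] of order N^(1/2), [de] of order
    N^(-1/2). The term U U_xx, which no Riccati inequality tolerates, cancels against transport
    along the characteristic. The two copies of U_xx belong to different points and to different
    functions (U at t_k and a stage), and comparing them costs a third derivative: hence tau
    N^(1/2). Errors are at most cubic, so x^n <= 1 + x^4 reduces them to the fourth moments of (R).
    The comparison with the blow-up time needs the Riccati inequality at the new value y(k+1), not
    at y(k); the estimate made for the interpolation covers that endpoint as well. *)

Section TrigLists.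
Context {R : realType}.
Context (a b : R).

Local Notation mu := (wavenumber a b).

(* The list entry (c, k, phi) encodes the function
   c cos (k mu (x - a) + phi); lists encode finite sums. *)
Definition wave := (R * int * R)%type.
Implicit Types (m : wave) (p q : seq wave).

Definition mode_angle (k : int) (x : R) : R := k%:~R * mu * (x - a).

Definition wave_eval m (x : R) : R := m.1.1 * cos (mode_angle m.1.2 x + m.2).

Definition trig_eval p (x : R) : R := \sum_(m <- p) wave_eval m x.

(** Differentiating a cosine shifts its phase by pi/2, so the encoding is closed under derivatives
    and frequencies are kept. *)
Definition hD m : wave := (m.1.1 * (m.1.2%:~R * mu), m.1.2, m.2 + pi / 2).

Definition trig_deriv p := [seq hD m | m <- p].

Definition hmult (sg : int -> R) m : wave := (sg m.1.2 * m.1.1, m.1.2, m.2).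

Definition tmult sg p := [seq hmult sg m | m <- p].

(** With [hmulm], the product-to-sum formula for cosines: a product of two waves is one wave at the
    sum and one at the difference of the frequencies. *)
Definition hmulp m m' : wave :=
  (2^-1 * (m.1.1 * m'.1.1), m.1.2 + m'.1.2, m.2 + m'.2).

Definition hmulm m m' : wave :=
  (2^-1 * (m.1.1 * m'.1.1), m.1.2 - m'.1.2, m.2 - m'.2).

Definition tmul p q := allpairs hmulp p q ++ allpairs hmulm p q.

(* A norm of the list, not of the function it represents: harmonics of equal
   frequency are not merged, so all estimates reduce to termwise ones. *)
Definition wn (om : int -> R) p : R := \sum_(m <- p) om m.1.2 * `|m.1.1|.

Lemma angleD k l x : mode_angle (k + l) x = mode_angle k x + mode_angle l x.
Proof. by rewrite /mode_angle rmorphD /= !mulrDl. Qed.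

Lemma angleN k x : mode_angle (- k) x = - mode_angle k x.
Proof. by rewrite /mode_angle rmorphN /= !mulNr. Qed.

Lemma tev_nil x : trig_eval [::] x = 0. Proof. by rewrite /trig_eval big_nil. Qed.

Lemma tev_cons m p x : trig_eval (m :: p) x = wave_eval m x + trig_eval p x.
Proof. by rewrite /trig_eval big_cons. Qed.

Lemma tev_cat p q x : trig_eval (p ++ q) x = trig_eval p x + trig_eval q x.
Proof. by rewrite /trig_eval big_cat. Qed.

Lemma tev_mult_cst (c : R) p x : trig_eval (tmult (fun=> c) p) x = c * trig_eval p x.
Proof.
by rewrite /trig_eval big_map mulr_sumr; apply: eq_bigr => m _; rewrite /wave_eval /= mulrA.
Qed.

Lemma harm_mul m m' x :
  wave_eval m x * wave_eval m' x = wave_eval (hmulp m m') x + wave_eval (hmulm m m') x.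
Proof.
rewrite /wave_eval /hmulp /hmulm /= !angleD angleN.
set u := mode_angle _ _; set v := mode_angle _ _.
have -> : u + v + (m.2 + m'.2) = (u + m.2) + (v + m'.2) by ring.
have -> : u - v + (m.2 - m'.2) = (u + m.2) - (v + m'.2) by ring.
set U := u + m.2; set V := v + m'.2.
by rewrite cosB cosD; field.
Qed.

Lemma tev_mul p q x : trig_eval (tmul p q) x = trig_eval p x * trig_eval q x.
Proof.
rewrite tev_cat /trig_eval !big_allpairs_dep -big_split /= mulr_suml.
apply: eq_bigr => m _; rewrite -big_split /= mulr_sumr.
by apply: eq_bigr => m' _; rewrite -harm_mul.
Qed.

Lemma is_derive_harm m x : is_derive x (1 : R) (wave_eval m) (wave_eval (hD m) x).
Proof.
rewrite /wave_eval /hD /=.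
have -> : (fun x0 => m.1.1 * cos (mode_angle m.1.2 x0 + m.2)) =
   (fun x0 => m.1.1 * (cos \o (fun z => mode_angle m.1.2 z + m.2)) x0) by [].
apply: is_derive_eq.
rewrite addrA cosDpihalf /mode_angle /GRing.scale /=; ring.
Qed.

Lemma is_derive_tev p x : is_derive x (1 : R) (trig_eval p) (trig_eval (trig_deriv p) x).
Proof.
elim: p => [|m p IH].
  rewrite /trig_deriv /= tev_nil.
  have -> : trig_eval [::] = cst 0 by apply/funext => z; rewrite tev_nil.
  exact: is_derive_cst.
have -> : trig_eval (m :: p) = wave_eval m \+ trig_eval p.
  by apply/funext => z; rewrite tev_cons.
rewrite /trig_deriv /= tev_cons; apply: is_deriveD; exact: is_derive_harm.
Qed.

Lemma derivable_tev p x : derivable (trig_eval p) x 1.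
Proof. by have [] := is_derive_tev p x. Qed.

Lemma derive1_tev p x : derive1 (trig_eval p) x = trig_eval (trig_deriv p) x.
Proof. by rewrite derive1E; have [_] := is_derive_tev p x. Qed.

Lemma continuous_tev p : continuous (trig_eval p).
Proof.
by move=> x; apply/differentiable_continuous/derivable1_diffP/derivable_tev.
Qed.

Lemma wn_ge0 om p : (forall k, 0 <= om k) -> 0 <= wn om p.
Proof. by move=> h; apply: sumr_ge0 => m _; rewrite mulr_ge0. Qed.

Lemma wn_cat om p q : wn om (p ++ q) = wn om p + wn om q.
Proof. by rewrite /wn big_cat. Qed.

Lemma wn_le om om' p : (forall k, om k <= om' k) -> wn om p <= wn om' p.
Proof. by move=> h; apply: ler_sum => m _; rewrite ler_wpM2r. Qed.

Lemma wn_mult om om' c sg p : (forall k, om k * `|sg k| <= c * om' k) ->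
  wn om (tmult sg p) <= c * wn om' p.
Proof.
move=> h; rewrite /wn big_map mulr_sumr; apply: ler_sum => m _ /=.
by rewrite normrM !mulrA ler_wpM2r.
Qed.

Lemma wn_mult_cst om c p : wn om (tmult (fun=> c) p) = `|c| * wn om p.
Proof.
rewrite /wn big_map mulr_sumr; apply: eq_bigr => m _ /=.
by rewrite normrM; ring.
Qed.

Lemma wn_D om om' p : (forall k, om k * `|k%:~R * mu| <= om' k) ->
  wn om (trig_deriv p) <= wn om' p.
Proof.
move=> h; rewrite /wn big_map; apply: ler_sum => m _ /=.
by rewrite normrM mulrCA mulrC ler_wpM2r.
Qed.

(** The two-term right-hand side serves three purposes: submultiplicativity (second pair zero), a
    Leibniz rule for one extra derivative, and the splitting of a tail. Sum and difference
    frequencies each carry half the amplitude, so the two bounds average. *)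
Lemma wn_mul om om1 om2 om3 om4 p q :
  (forall j k, om (j + k) <= om1 j * om2 k + om3 j * om4 k) ->
  (forall j k, om (j - k) <= om1 j * om2 k + om3 j * om4 k) ->
  wn om (tmul p q) <= wn om1 p * wn om2 q + wn om3 p * wn om4 q.
Proof.
move=> hp hm; rewrite wn_cat /wn !big_allpairs_dep -big_split /=.
rewrite !mulr_suml -big_split /=; apply: ler_sum => m _.
rewrite -big_split /= !mulr_sumr -big_split /=; apply: ler_sum => m' _.
rewrite !normrM ger0_norm ?invr_ge0//.
have := hp m.1.2 m'.1.2; have := hm m.1.2 m'.1.2.
have : 0 <= `|m.1.1| * `|m'.1.1| by rewrite mulr_ge0.
set u := om (_ - _); set v := om (_ + _); set z := `|m.1.1| * _.
set e1 := om1 _; set e2 := om2 _; set e3 := om3 _; set e4 := om4 _ => z0 h1 h2.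
have -> : e1 * `|m.1.1| * (e2 * `|m'.1.1|) + e3 * `|m.1.1| * (e4 * `|m'.1.1|)
   = (e1 * e2 + e3 * e4) * z by rewrite /z; ring.
have -> : v * (2^-1 * z) + u * (2^-1 * z) = (2^-1 * (v + u)) * z by ring.
by apply: ler_wpM2r => //; lra.
Qed.

Lemma harm_le m x : `|wave_eval m x| <= `|m.1.1|.
Proof.
rewrite normrM ler_piMr// ler_norml; apply/andP; split.
  exact: cos_geN1.
exact: cos_le1.
Qed.

Lemma tev_le p x : `|trig_eval p x| <= wn (fun=> 1) p.
Proof.
rewrite /trig_eval /wn; apply: (le_trans (ler_norm_sum _ _ _)).
by apply: ler_sum => m _; rewrite mul1r harm_le.
Qed.

Lemma tev_MVT p x y : exists2 z, `|z - x| <= `|y - x| &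
  trig_eval p y - trig_eval p x = trig_eval (trig_deriv p) z * (y - x).
Proof.
have Dp z : is_derive z (1 : R) (trig_eval p) (trig_eval (trig_deriv p) z).
  exact: is_derive_tev.
have C u v : {within `[u, v], continuous (trig_eval p)}.
  by apply: continuous_subspaceT; exact: continuous_tev.
have [xy|yx|->] := ltgtP x y; last by exists y; rewrite // !subrr mulr0.
- have [z] := MVT xy (fun z _ => Dp z) (C x y).
  rewrite in_itv /= => /andP[xz zy] e; exists z => //.
  by rewrite !ger0_norm; lra.
- have [z] := MVT yx (fun z _ => Dp z) (C y x).
  rewrite in_itv /= => /andP[xz zy] e; exists z; last by lra.
  by rewrite !ltr0_norm; lra.
Qed.

Lemma tev_lip p x y :
  `|trig_eval p y - trig_eval p x| <= wn (fun=> 1) (trig_deriv p) * `|y - x|.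
Proof.
by have [z _ ->] := tev_MVT p x y; rewrite normrM ler_wpM2r// tev_le.
Qed.

(** Mean value theorem, then the Lipschitz bound of the derivative up to the intermediate point.
    This loses the factor 1/2 of Taylor's formula, which is harmless. *)
Lemma tev_taylor2 p x y :
  `|trig_eval p y - trig_eval p x - trig_eval (trig_deriv p) x * (y - x)| <=
    wn (fun=> 1) (trig_deriv (trig_deriv p)) * `|y - x| ^+ 2.
Proof.
have [z zx ->] := tev_MVT p x y.
rewrite -mulrBl normrM expr2 mulrA ler_wpM2r//.
apply: (le_trans (tev_lip _ _ _)); rewrite ler_wpM2l//.
by rewrite wn_ge0.
Qed.

End TrigLists.

(** * Maximum principle *)

Lemma cosDint {R : realType} (x : R) (k : int) : cos (x + k%:~R * (2 * pi)) = cos x.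
Proof.
have H (n : nat) (y : R) : cos (y + n%:R * (2 * pi)) = cos y.
  have := periodicn (@cosD2pi R) n y; congr (_ = _); congr cos.
  by rewrite -[pi *+ 2]mulr_natl -[_ *+ n]mulr_natl.
case: k => n; first by rewrite H.
rewrite NegzE mulrNz mulNr -[LHS](H n.+1); congr cos; ring.
Qed.

Section MaxPrinciple.
Context {R : realType}.
Context (a b : R) (ab : a < b).
Local Notation mu := (wavenumber a b).
Local Notation tev := (trig_eval a b).
Local Notation tD := (trig_deriv a b).

Lemma wavenumber_period : mu * (b - a) = 2 * pi.
Proof. by rewrite /wavenumber /period divfK// subr_eq0 gt_eqF. Qed.

Lemma wavenumber_gt0 : 0 < mu.
Proof. by rewrite divr_gt0 ?mulr_gt0 ?pi_gt0// subr_gt0. Qed.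

Lemma tev_periodz p x (k : int) : tev p (x + k%:~R * (b - a)) = tev p x.
Proof.
apply: eq_bigr => m _; rewrite /wave_eval /mode_angle; congr (_ * _).
rewrite -[RHS](cosDint _ (m.1.2 * k)) -wavenumber_period; congr cos.
by rewrite rmorphM /=; ring.
Qed.

(** Carries statements on one period over to the whole line. The interval is open at [b], so there
    is always room to the right of [y]. *)
Lemma tev_reduce x : exists2 y, y \in `[a, b[ & forall p, tev p x = tev p y.
Proof.
pose k := Num.floor ((x - a) / (b - a)).
have L0 : 0 < b - a by rewrite subr_gt0.
exists (x + (- k)%:~R * (b - a)); last by move=> p; rewrite tev_periodz.
rewrite in_itv /= rmorphN /= mulNr.
have /andP[h1 h2] := floor_itv ((x - a) / (b - a)).
move: h1 h2; rewrite ler_pdivlMr// ltr_pdivrMr// -/k rmorphD /= mulrDl mul1r.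
set z := k%:~R * _; move=> h1 h2; apply/andP; split; lra.
Qed.

Definition resolvent_symbol (k : int) : R := (1 + (k%:~R * mu) ^+ 2)^-1.

Lemma lam_gt0 k : 0 < resolvent_symbol k.
Proof. by rewrite invr_gt0 ltr_wpDr// sqr_ge0. Qed.

Lemma tmult_tD sg p : tmult sg (tD p) = tD (tmult sg p).
Proof.
rewrite /tmult /trig_deriv -!map_comp; apply: eq_map => -[[c k] f].
by rewrite /hmult /hD /= mulrA.
Qed.

(** The resolvent identity: two derivatives multiply a wave by - (k mu)^2, and (k mu)^2 times the
    symbol is 1 minus the symbol. *)
Lemma tev_DDlam p x :
  tev (tD (tD (tmult resolvent_symbol p))) x = tev (tmult resolvent_symbol p) x - tev p x.
Proof.
rewrite /trig_eval !big_map -sumrB; apply: eq_bigr => m _.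
rewrite /wave_eval /= !addrA !cosDpihalf sinDpihalf.
have h : resolvent_symbol m.1.2 * (1 + (m.1.2%:~R * mu) ^+ 2) = 1.
  by rewrite mulVf// gt_eqF// ltr_wpDr// sqr_ge0.
rewrite -[in X in _ = _ - X](mul1r m.1.1) -[in X in _ = _ - X]h; ring.
Qed.

(* Maximum principle for g - g'' = f: at a minimum g'' >= 0, so g >= f there. *)
Lemma tev_lam_ge0 p : (forall x, 0 <= tev p x) ->
  forall x, 0 <= tev (tmult resolvent_symbol p) x.
Proof.
move=> p0; set q := tmult resolvent_symbol p.
have [c cab cmin] : exists2 c, c \in `[a, b] & forall t, t \in `[a, b] -> tev q c <= tev q t.
  by apply: EVT_min; [exact: ltW|apply: continuous_subspaceT; exact: continuous_tev].
have gmin t : tev q c <= tev q t.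
  have [y /andP[]] := tev_reduce t; rewrite bnd_simp => ay yb ->.
  by apply: cmin; rewrite in_itv /=; rewrite bnd_simp in yb; rewrite ay ltW.
move=> x; apply: le_trans (gmin x); rewrite leNgt; apply/negP => qc0.
have q'c : tev (tD q) c = 0.
  rewrite -derive1_tev derive1E.
  have cc : c \in `]c - 1, c + 1[ by rewrite in_itv /=; apply/andP; split; lra.
  have d : is_derive c (1:R) (tev q) 0.
    apply: (@derive1_at_min _ _ (c - 1) (c + 1)) => //; first lra.
    by move=> t _; exact: derivable_tev.
  by have [_] := d.
have q''c : tev (tD (tD q)) c < 0 by rewrite tev_DDlam; have := p0 c; lra.
(* Second-derivative test by hand: q'' is K-Lipschitz, so with K h < - q''(c) it stays negative on
   [c, c + h]. Two mean value steps turn q(c + h) >= q(c) into q''(y) >= 0 for some y there, a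
   contradiction. The denominator K + 1 keeps the inequality strict and covers K = 0. *)
set K := wn (fun=> 1) (tD (tD (tD q))).
have K0 : 0 <= K by apply: wn_ge0.
pose h := - tev (tD (tD q)) c / (K + 1).
have h0 : 0 < h by rewrite divr_gt0; lra.
have Kh : K * h < - tev (tD (tD q)) c.
  rewrite /h mulrA ltr_pdivrMr; last lra.
  by set t := tev _ c in q''c *; nra.
have mv r u v : u < v -> exists2 z, u < z < v & tev r v - tev r u = tev (tD r) z * (v - u).
  move=> uv; have [z] := MVT uv (fun z _ => is_derive_tev a b r z)
    (continuous_subspaceT (@continuous_tev _ a b r)).
  by rewrite in_itv /= => ?; exists z.
have [z /andP[cz zh] e1] := mv q c (c + h) ltac:(lra).
have [y /andP[cy yz] e2] := mv (tD q) c z cz.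
have := gmin (c + h); rewrite -subr_ge0 e1 pmulr_lge0; last lra.
move: e2; rewrite q'c subr0 => ->; rewrite pmulr_lge0; last lra.
move=> y0; have := tev_lip a b (tD (tD q)) c y.
rewrite -/K ger0_norm; last lra.
rewrite ger0_norm; last lra.
have : K * (y - c) <= K * h by apply: ler_wpM2l => //; lra.
by lra.
Qed.

End MaxPrinciple.

(** * Fourier coefficients of trigonometric sums *)

Section FourierTrig.
Context {R : realType}.
Context (a b : R) (ab : a < b).
Local Open Scope complex_scope.
Local Notation mu := (wavenumber a b).
Local Notation tev := (trig_eval a b).
Local Notation tD := (trig_deriv a b).

(** The mean over a period: waves of nonzero frequency integrate to zero, and a wave of frequency 0
    is a constant. *)
Definition tmean (p : seq (@wave R)) : R :=
  \sum_(m <- p | m.1.2 == 0) m.1.1 * cos m.2.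

Definition hprim (m : @wave R) : @wave R :=
  (m.1.1 / (m.1.2%:~R * mu), m.1.2, m.2 - pi / 2).

Lemma tev_hprim p x :
  tev (tD [seq hprim m | m <- p & m.1.2 != 0]) x + tmean p = tev p x.
Proof.
rewrite /trig_deriv /trig_eval /tmean -map_comp big_map big_filter.
rewrite [RHS](bigID (fun m => m.1.2 == 0)) /= [LHS]addrC; congr (_ + _).
  apply: eq_bigr => m /eqP E.
  by rewrite /wave_eval /mode_angle E !mul0r add0r.
apply: eq_bigr => m m0; rewrite /wave_eval /= subrK divfK//.
by rewrite mulf_neq0 ?intr_eq0 ?m0// gt_eqF// wavenumber_gt0.
Qed.

Lemma tev_per p : tev p b = tev p a.
Proof.
by rewrite -[RHS](tev_periodz ab p a 1) mul1r addrCA subrr addr0.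
Qed.

Lemma Rintegral_tev p :
  (\int[@lebesgue_measure R]_(x in `[a, b]) tev p x)%R = (b - a) * tmean p.
Proof.
set q := [seq hprim m | m <- p & m.1.2 != 0].
pose F x := tev q x + x * tmean p.
have dF x : is_derive x (1 : R) F (tev p x).
  rewrite /F -tev_hprim; apply: is_derive_eq.
    apply: is_deriveD; exact: is_derive_tev.
  by rewrite /GRing.scale /= mulr1 mulr0 add0r.
have cF x : {for x, continuous F}.
  by apply/differentiable_continuous/derivable1_diffP; have [] := dF x.
rewrite /Rintegral (continuous_FTC2 (F := F) ab).
- rewrite -EFinB /= /F /q tev_per; ring.
- by apply: continuous_subspaceT; exact: continuous_tev.
- split => [x _||]; first by have [] := dF x.
  + exact/cvg_at_right_filter/cF.
  + exact/cvg_at_left_filter/cF.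
- by move=> x _; rewrite derive1E; have [_] := dF x.
Qed.

(** A wave c cos(j theta + phi) puts c/2 e^(i phi) on the mode j and the conjugate on - j. For j = k
    = 0 both indicators fire: the real parts add up and the imaginary parts cancel. *)
Lemma fourier_tev p k :
  fourier a b (tev p) k =
    (\sum_(m <- p) ((m.1.2 == k)%:R + (m.1.2 == - k)%:R) * (m.1.1 / 2 * cos m.2))
    +i* (\sum_(m <- p) ((m.1.2 == k)%:R - (m.1.2 == - k)%:R) * (m.1.1 / 2 * sin m.2)).
Proof.
have ReE : (fun x => complex.Re ((tev p x)%:C * mode a b (- k) x)) =
    tev (tmul p [:: (1, - k, 0)]).
  apply/funext => x; rewrite tev_mul tev_cons tev_nil /wave_eval /mode /expi /mode_angle /=.
  by rewrite mul0r subr0 !addr0 mul1r.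
have ImE : (fun x => complex.Im ((tev p x)%:C * mode a b (- k) x)) =
    tev (tmul p [:: (1, - k, - (pi / 2))]).
  apply/funext => x; rewrite tev_mul tev_cons tev_nil /wave_eval /mode /expi /mode_angle /=.
  rewrite mul0r !addr0 mul1r; congr (_ * _).
  by rewrite -[RHS]sinDpihalf subrK.
rewrite /fourier /cintegral ReE ImE !Rintegral_tev /period.
have ba0 : b - a != 0 by rewrite subr_eq0 gt_eqF.
have E (u v : R) : ((b - a)^-1)%:C * (((b - a) * u) +i* ((b - a) * v)) = u +i* v.
  by simpc; congr (_ +i* _); rewrite mulKf.
rewrite E /tmean.
have eqk (j : int) : (j - k == 0) = (j == k) by rewrite subr_eq0.
have eqk' (j : int) : (j + k == 0) = (j == - k) by rewrite addr_eq0.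
congr (_ +i* _); rewrite !big_cat /= !allpairs1r !big_map /=
  [X in X + _ = _]big_mkcond [X in _ + X = _]big_mkcond -big_split /=;
  apply: eq_bigr => -[[c j] f] _ /=; rewrite opprK eqk eqk' ?addr0 ?subr0 ?opprK
   ?cosBpihalf ?cosDpihalf;
  by case: (j == k); case: (j == - k); rewrite /= ?mulr1n ?mulr0n; field.
Qed.
End FourierTrig.

Lemma mem_zrange n (k : int) : (k \in zrange n) = (`|k| <= n)%N.
Proof.
apply/mapP/idP => [[i + ->]|kn].
  by rewrite mem_iota add0n -addnn => /andP[_ h]; lia.
exists `|(k + n%:Z)%R|%N; last by lia.
by rewrite mem_iota add0n -addnn; lia.
Qed.

Lemma zrange_uniq n : uniq (zrange n).
Proof. by rewrite map_inj_uniq ?iota_uniq// => i j; lia. Qed.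

Section FourierOperators.
Context {R : realType}.
Context (a b : R) (ab : a < b).
Local Open Scope complex_scope.
Local Notation tev := (trig_eval a b).
Local Notation angle := (mode_angle a b).
Local Notation harm := (wave_eval a b).

Lemma Re_sum I (r : seq I) (Q : pred I) (G : I -> R[i]) :
  complex.Re (\sum_(i <- r | Q i) G i) = \sum_(i <- r | Q i) complex.Re (G i).
Proof. by apply: (big_morph (@complex.Re R)) => // -[? ?] [? ?]. Qed.

Lemma Im_sum I (r : seq I) (Q : pred I) (G : I -> R[i]) :
  complex.Im (\sum_(i <- r | Q i) G i) = \sum_(i <- r | Q i) complex.Im (G i).
Proof. by apply: (big_morph (@complex.Im R)) => // -[? ?] [? ?]. Qed.

Lemma Re_mul_mode (z : R[i]) k x : complex.Re (z * mode a b k x) =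
  complex.Re z * cos (angle k x) - complex.Im z * sin (angle k x).
Proof. by case: z. Qed.

Lemma Re_fourier_mode p k x :
  complex.Re (fourier a b (tev p) k * mode a b k x) =
  \sum_(m <- p) 2^-1 * ((k == m.1.2)%:R + (k == - m.1.2)%:R) * harm m x.
Proof.
rewrite Re_mul_mode fourier_tev//= !mulr_suml -sumrB; apply: eq_bigr => -[[c j] f] _ /=.
rewrite /wave_eval /= cosD.
rewrite (eq_sym k j) -(eqr_oppLR k j) (eq_sym _ j).
have [jk|jk] := eqVneq j k; have [jk'|jk'] := eqVneq j (- k).
- rewrite jk; have -> : k = 0 by lia.
  by rewrite /mode_angle !mul0r sin0 cos0 /= ?mulr1n; field.
- by rewrite jk /= ?mulr1n ?mulr0n; field.
- by rewrite jk' angleN cosN sinN /= ?mulr1n ?mulr0n; field.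
- by rewrite /= ?mulr0n; field.
Qed.

(** A real wave lies half on the mode j and half on - j, so an even multiplier scales it as a whole.
    This evenness lets projection and resolvent act wave by wave. *)
Lemma fourier_multiplier (sg : int -> R) (Q : pred int) n p x :
  (forall k, sg (- k) = sg k) -> (forall k, Q (- k) = Q k) ->
  \sum_(k <- zrange n | Q k)
     sg k * complex.Re (fourier a b (tev p) k * mode a b k x) =
  tev (tmult (fun k => if Q k && (`|k| <= n)%N then sg k else 0) p) x.
Proof.
move=> sgN QN; under eq_bigr do rewrite Re_fourier_mode mulr_sumr.
rewrite exchange_big /trig_eval big_map /=; apply: eq_bigr => -[[c j] f] _ /=.
rewrite /wave_eval /=.
under eq_bigr do rewrite mulrA.
rewrite -mulr_suml mulrA; congr (_ * _); last first.
have E i : \sum_(k <- zrange n | Q k) sg k * (k == i)%:R =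
    if Q i && (`|i| <= n)%N then sg i else 0.
  rewrite big_mkcond /= (bigID (fun k => k == i)) /= addrC big1 ?add0r; last first.
    by move=> k /negPf ->; rewrite mulr0 if_same.
  rewrite -big_filter; have [ni|ni] := boolP (i \in zrange n); last first.
    rewrite -mem_zrange (negPf ni) andbF big_seq big1// => k.
    by rewrite mem_filter => /andP[/eqP-> ]; rewrite (negPf ni).
  rewrite filter_pred1_uniq ?zrange_uniq// big_seq1 eqxx mulr1 -mem_zrange ni andbT//.
under eq_bigr do rewrite mulrCA mulrDr.
rewrite -mulr_sumr big_split /= !E QN abszN sgN.
by rewrite -mulr2n -[X in _ * X * _]mulr_natl mulKf.
Qed.

Definition band N (k : int) : R := ((k != 0) && (`|k| <= N)%N)%:R.

Lemma proj_tev N p : Defs.proj a b N (tev p) = tev (tmult (band N) p).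
Proof.
apply/funext => x; rewrite /Defs.proj Re_sum.
have := @fourier_multiplier (fun=> 1) (fun k => k != 0) N p x.
rewrite (eq_bigr _ (fun k _ => mul1r _)) => -> //; last by move=> k; rewrite oppr_eq0.
by congr (tev (tmult _ _) x); apply/funext => k; rewrite /band; case: ifP.
Qed.

Lemma Lambda_tev p : Lambda a b (tev p) = tev (tmult (resolvent_symbol a b) p).
Proof.
apply/funext => x; rewrite /Lambda; apply/cvg_lim => //.
pose n0 := (\max_(m <- p) `|m.1.2|)%N.
apply: cvg_near_cst; exists n0 => // n /= n0n.
rewrite Re_sum.
have lamN k : resolvent_symbol a b (- k) = resolvent_symbol a b k.
  by rewrite /resolvent_symbol rmorphN /= mulNr sqrrN.
have := @fourier_multiplier (resolvent_symbol a b) xpredT n p x lamN (fun=> erefl).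
under [in X in _ -> X]eq_bigr do rewrite -mulrA -[_%:C]complexr0.
move=> H; transitivity (\sum_(k <- zrange n)
   resolvent_symbol a b k * complex.Re (fourier a b (tev p) k * mode a b k x)).
  by apply: eq_bigr => k _; case: (_ * mode _ _ _ _) => u v /=; rewrite mul0r subr0.
rewrite H /trig_eval !big_map; apply: eq_big_seq => m mp.
rewrite /wave_eval /=; congr (_ * _ * _).
suff -> : (`|m.1.2| <= n)%N by [].
by apply: leq_trans n0n; exact: (leq_bigmax_seq (F := fun m => `|m.1.2|%N)).
Qed.

End FourierOperators.

(** Lagrange's identity: the double sum of the squares (u_i v_j - u_j v_i)^2 is twice the difference
    of the two sides. *)
Lemma cauchy_schwarz_sum {R : realDomainType} I (r : seq I) (Q : pred I) (u v : I -> R) :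
  (\sum_(i <- r | Q i) u i * v i) ^+ 2 <=
  (\sum_(i <- r | Q i) u i ^+ 2) * (\sum_(i <- r | Q i) v i ^+ 2).
Proof.
rewrite -subr_ge0 -(pmulr_rge0 _ (ltr0Sn R 1)).
have : 0 <= \sum_(i <- r | Q i) \sum_(j <- r | Q j) (u i * v j - u j * v i) ^+ 2.
  by apply: sumr_ge0 => i _; apply: sumr_ge0 => j _; rewrite sqr_ge0.
congr (0 <= _).
set U := \sum_(i <- r | Q i) u i ^+ 2; set V := \sum_(i <- r | Q i) v i ^+ 2.
set S := \sum_(i <- r | Q i) u i * v i.
have E i : \sum_(j <- r | Q j) (u i * v j - u j * v i) ^+ 2 =
    u i ^+ 2 * V + v i ^+ 2 * U - 2 * (u i * v i) * S.
  rewrite /U /V /S !mulr_sumr -big_split /= -sumrB; apply: eq_bigr => j _; ring.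
rewrite (eq_bigr _ (fun i _ => E i)) sumrB big_split /= -!mulr_suml -mulr_sumr.
rewrite -/U -/V -/S; ring.
Qed.

Lemma sum_zrange_norm (V : nmodType) (g : nat -> V) n :
  \sum_(k <- zrange n | k != 0) g `|k|%N = \sum_(i < n) (g i.+1 + g i.+1).
Proof.
rewrite big_split /= -big_filter.
have <- : \sum_(k <- map (fun i => i.+1%:Z) (iota 0 n) ++ map Negz (iota 0 n)) g `|k|%N =
   \sum_(i < n) g i.+1 + \sum_(i < n) g i.+1.
  have E : \sum_(i <- iota 0 n) g i.+1 = \sum_(i < n) g i.+1.
    by rewrite -(big_mkord xpredT (fun i => g i.+1)) /index_iota subn0.
  by rewrite big_cat !big_map /= E.
apply: perm_big; apply: uniq_perm.
- by rewrite filter_uniq// zrange_uniq.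
- rewrite cat_uniq !map_inj_uniq ?iota_uniq// => [|i j|i j]; [|by lia|by lia].
  rewrite andbT; apply/hasP => -[k h1 h2].
  by have [i _ e1] := mapP h1; have [j _ e2] := mapP h2; lia.
move=> k; rewrite mem_filter mem_zrange mem_cat; apply/idP/idP.
  case: k => [[|k]|k] //= kn; apply/orP; [left|right]; apply/mapP; exists k => //;
    by rewrite mem_iota /= add0n; lia.
by case/orP => h; have [i + ->] := mapP h; rewrite mem_iota add0n => /andP[_]; lia.
Qed.

(** * Functions of S_N as lists of waves *)

Section TrigSpace.
Context {R : realType}.
Context (a b : R) (ab : a < b).
Local Open Scope complex_scope.
Local Notation mu := (wavenumber a b).
Local Notation tev := (trig_eval a b).
Local Notation normc := (@ComplexField.Normc.normc R).

(** Two waves per frequency because Re(c e^(i t)) = Re c cos t + Im c cos(t + pi/2). *)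
Definition waves N (c : int -> R[i]) : seq (@wave R) :=
  flatten [seq [:: (complex.Re (c k), k, 0); (complex.Im (c k), k, pi / 2)]
          | k <- zrange N & k != 0].

Lemma tev_waves N c x : tev (waves N c) x =
  \sum_(k <- zrange N | k != 0) complex.Re (c k * mode a b k x).
Proof.
rewrite /waves /trig_eval big_flatten big_map big_filter.
apply: eq_bigr => k _; rewrite Re_mul_mode -/(tev _ x) !tev_cons tev_nil.
by rewrite /wave_eval /= !addr0 cosDpihalf mulrN.
Qed.

Lemma wn_waves om N c : wn om (waves N c) =
  \sum_(k <- zrange N | k != 0) om k * (`|complex.Re (c k)| + `|complex.Im (c k)|).
Proof.
rewrite /wn /waves big_flatten big_map big_filter.
by apply: eq_bigr => k _; rewrite mulrDr 2!big_cons big_nil /= Monoid.mulm1.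
Qed.

Definition trig_coefs N (v : R -> R) := waves N (fourier a b v).

(** The coefficients [c] witnessing membership are arbitrary complex numbers, with no symmetry
    imposed. The Fourier coefficients represent the same function, since a function of S_N equals
    its own projection, and only they are tied to the Sobolev norm. *)
Lemma trig_space_tevE N v : trig_space a b N v ->
  exists2 c, v = tev (waves N c) & v = tev (trig_coefs N v).
Proof.
move=> [c vc]; have E : v = tev (waves N c).
  by apply/funext => x; rewrite tev_waves -Re_sum -vc.
exists c => //; rewrite {1}E.
have -> : tev (waves N c) = Defs.proj a b N v.
  rewrite E proj_tev//; apply/funext => x.
  rewrite /trig_eval big_map; apply: eq_big_seq => m.
  move=> /flatten_mapP[k]; rewrite mem_filter mem_zrange => /andP[k0 kN].
  by rewrite !inE => /orP[]/eqP-> ; rewrite /wave_eval /= /band k0 kN /= mul1r.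
by apply/funext => x; rewrite /Defs.proj Re_sum tev_waves.
Qed.

Lemma trig_space_tev N v : trig_space a b N v -> v = tev (trig_coefs N v).
Proof. by case/trig_space_tevE. Qed.

Lemma fourier_trig_space N v k : trig_space a b N v ->
  ~~ ((k != 0) && (`|k| <= N)%N) -> fourier a b v k = 0.
Proof.
move=> /trig_space_tevE[c -> _] hk; rewrite fourier_tev//.
have E m : m \in waves N c -> (m.1.2 == k = false) /\ (m.1.2 == - k = false).
  move=> /flatten_mapP[j]; rewrite mem_filter mem_zrange => /andP[j0 jN] mj.
  have -> : m.1.2 = j by move: mj; rewrite !inE => /orP[]/eqP->.
  by move: hk; split; lia.
by rewrite !big_seq !big1// => m /E[-> ->]; rewrite ?addr0 ?subrr mul0r.
Qed.

Lemma normc_sq (z : R[i]) : normc z ^+ 2 = complex.Re z ^+ 2 + complex.Im z ^+ 2.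
Proof. by case: z => x y /=; rewrite sqr_sqrtr// addr_ge0 ?sqr_ge0. Qed.

Lemma normc_ge0 (z : R[i]) : 0 <= normc z.
Proof. by case: z => x y /=; rewrite sqrtr_ge0. Qed.

Lemma normc_Re (z : R[i]) : `|complex.Re z| <= normc z.
Proof.
rewrite -ler_sqr ?nnegrE ?normc_ge0// normc_sq -normrX ger0_norm ?sqr_ge0//.
by rewrite lerDl sqr_ge0.
Qed.

Lemma normc_Im (z : R[i]) : `|complex.Im z| <= normc z.
Proof.
rewrite -ler_sqr ?nnegrE ?normc_ge0// normc_sq -normrX ger0_norm ?sqr_ge0//.
by rewrite lerDr sqr_ge0.
Qed.

Definition sobolev_weight r (k : int) : R := (1 + `|k%:~R * mu| ^+ 2) ^+ r.

Lemma sob_weight_gt0 r k : 0 < sobolev_weight r k.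
Proof. by rewrite exprn_gt0// ltr_wpDr ?exprn_ge0. Qed.

Definition sob_sum r N v : R :=
  \sum_(k <- zrange N | k != 0) sobolev_weight r k * normc (fourier a b v k) ^+ 2.

Lemma sob_sum_ge0 r N v : 0 <= sob_sum r N v.
Proof.
by apply: sumr_ge0 => k _; rewrite mulr_ge0 ?sqr_ge0// ltW// sob_weight_gt0.
Qed.

Lemma sobolev_sq_trig r N v : trig_space a b N v ->
  sobolev_sq a b r v = (sob_sum r N v)%:E.
Proof.
move=> hv; rewrite /sobolev_sq.
rewrite (_ : (fun k : int => _) = fun k => if k \in [set` zrange N] then
   (sobolev_weight r k * normc (fourier a b v k) ^+ 2)%:E else 0%E); last first.
  apply/funext => k; case: ifP => // kF.
  have -> : fourier a b v k = 0.
    apply: (fourier_trig_space hv); rewrite -mem_zrange; apply/negP => /andP[_ kN].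
    by move/negP: kF; apply; rewrite inE.
  by rewrite /= !expr0n /= addr0 sqrtr0 expr0n mulr0.
rewrite -esum_mkcond esum_fset; last 2 first.
- exact: finite_seq.
- by move=> k _; rewrite lee_fin mulr_ge0 ?sqr_ge0// ltW// sob_weight_gt0.
rewrite -fsbig_seq ?zrange_uniq// /sob_sum -sumEFin [RHS]big_mkcond.
apply: eq_bigr => k _; case: ifP => // /negbFE/eqP ->.
have -> : fourier a b v 0 = 0 by exact: (fourier_trig_space hv).
by rewrite /= !expr0n /= addr0 sqrtr0 expr0n mulr0.
Qed.

Lemma sobolev_norm_trig r N v : trig_space a b N v ->
  sobolev_norm a b r v = Num.sqrt (sob_sum r N v).
Proof. by move=> hv; rewrite /sobolev_norm (@sobolev_sq_trig r N). Qed.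

Lemma sobolev_norm_ge0 r v : 0 <= sobolev_norm a b r v.
Proof. exact: sqrtr_ge0. Qed.

Lemma sobolev_norm_sq r N v : trig_space a b N v ->
  sobolev_norm a b r v ^+ 2 = sob_sum r N v.
Proof.
by move=> hv; rewrite (@sobolev_norm_trig r N)// sqr_sqrtr ?sob_sum_ge0.
Qed.

(** Cauchy-Schwarz between the weight quotients and the H^3 norm; the factor 2 comes from |Re z| +
    |Im z| <= 2 |z|. *)
Lemma wn_trig om N v kap : trig_space a b N v -> 0 <= kap ->
  (forall k, 0 <= om k) ->
  \sum_(k <- zrange N | k != 0) om k ^+ 2 / sobolev_weight 3 k <= kap ^+ 2 ->
  wn om (trig_coefs N v) <= 2 * kap * sobolev_norm a b 3 v.
Proof.
move=> hv kap0 om0 hk; rewrite /trig_coefs wn_waves.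
set c := fourier a b v.
apply: (@le_trans _ _ (2 * \sum_(k <- zrange N | k != 0)
   (om k / Num.sqrt (sobolev_weight 3 k)) * (Num.sqrt (sobolev_weight 3 k) * normc (c k)))).
  rewrite mulr_sumr; apply: ler_sum => k _.
  rewrite [X in _ <= 2 * X]mulrA divfK ?gt_eqF ?sqrtr_gt0 ?sob_weight_gt0//.
  rewrite mulrCA ler_wpM2l//.
  have := normc_Re (c k); have := normc_Im (c k); lra.
rewrite -mulrA ler_wpM2l//.
set S := \sum_(k <- _ | _) _.
have S0 : 0 <= S.
  by apply: sumr_ge0 => k _; rewrite !mulr_ge0 ?invr_ge0 ?sqrtr_ge0 ?normc_ge0.
rewrite -ler_sqr ?nnegrE ?mulr_ge0 ?sobolev_norm_ge0//.
apply: (le_trans (cauchy_schwarz_sum _ _ _ _)).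
rewrite exprMn (@sobolev_norm_sq 3 N)//; apply: ler_pM.
- by apply: sumr_ge0 => k _; rewrite sqr_ge0.
- by apply: sumr_ge0 => k _; rewrite sqr_ge0.
- apply: le_trans hk; apply: ler_sum => k _.
  by rewrite exprMn exprVn sqr_sqrtr// ltW// sob_weight_gt0.
- apply: ler_sum => k _.
  by rewrite exprMn sqr_sqrtr// ltW// sob_weight_gt0.
Qed.

End TrigSpace.

(** * Sobolev norms and weighted coefficient norms *)

Lemma sqr_1D_le {R : realDomainType} (x : R) : (1 + x) ^+ 2 <= 2 * (1 + x ^+ 2).
Proof.
by rewrite -subr_ge0 (_ : _ - _ = (1 - x) ^+ 2) ?sqr_ge0//; ring.
Qed.

Section SobolevBounds.
Context {R : realType}.
Context (a b : R) (ab : a < b).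
Local Notation mu := (wavenumber a b).
Local Notation twaves := (trig_coefs a b).
Local Notation sob_weight := (sobolev_weight a b).

(** Here [r] counts derivatives of amplitudes. Unlike [sobolev_weight], this weight is
    submultiplicative in the frequency with constant 1. *)
Definition freq_weight r (k : int) : R := (1 + `|k%:~R * mu|) ^+ r.

(* Products are cut at |k| > N (c = 1) and their factors at |k| > N/2 (c = 2):
   if |j + k| > N then |j| > N/2 or |k| > N/2. *)
Definition tail_weight c N r (k : int) : R := if (N < c * `|k|)%N then freq_weight r k else 0.

Lemma wgt_gt0 r k : 0 < freq_weight r k.
Proof. by rewrite exprn_gt0// ltr_pwDl. Qed.

Lemma wgt_ge0 r k : 0 <= freq_weight r k.
Proof. exact/ltW/wgt_gt0. Qed.

Lemma wcut_ge0 c N r k : 0 <= tail_weight c N r k.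
Proof. by rewrite /tail_weight; case: ifP => // _; exact: wgt_ge0. Qed.

(** With x = |k mu|, (1 + x)^4 <= 4 (1 + x^2)^2, which leaves 4 / (1 + x^2) <= 4 / x^2. *)
Lemma wgt2_sob k : k != 0 -> freq_weight 2 k ^+ 2 / sob_weight 3 k <= 4 / (`|k|%:R * mu) ^+ 2.
Proof.
move=> k0; have mu0 := wavenumber_gt0 ab.
have -> : (`|k|%:R * mu) ^+ 2 = `|k%:~R * mu| ^+ 2.
  by rewrite normrM (gtr0_norm mu0) -intr_norm natr_absz.
rewrite /freq_weight /sob_weight.
have : 0 < `|k%:~R * mu| by rewrite normr_gt0 mulf_neq0 ?intr_eq0// gt_eqF.
set x := `|_| => x0.
have h := sqr_1D_le x.
have y0 : 0 < 1 + x ^+ 2 by rewrite ltr_wpDr ?sqr_ge0.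
rewrite ler_pdivrMr ?exprn_gt0//.
apply: (@le_trans _ _ ((2 * (1 + x ^+ 2)) ^+ 2)).
  by apply: lerXn2r => //; rewrite nnegrE ?mulr_ge0 ?exprn_ge0//; lra.
rewrite mulrAC ler_pdivlMr ?exprn_gt0// -subr_ge0.
have -> : 4 * (1 + x ^+ 2) ^+ 3 - (2 * (1 + x ^+ 2)) ^+ 2 * x ^+ 2 =
  4 * (1 + x ^+ 2) ^+ 2 by ring.
by rewrite mulr_ge0 ?sqr_ge0.
Qed.

Lemma count_zrange (c : R) N : \sum_(k <- zrange N | k != 0) c = 2 * N%:R * c.
Proof.
rewrite (sum_zrange_norm (fun=> c)) sumr_const card_ord -[_ *+ N]mulr_natl; ring.
Qed.

Lemma sum_wgt2 N :
  \sum_(k <- zrange N | k != 0) freq_weight 2 k ^+ 2 / sob_weight 3 k <= (4 / mu) ^+ 2.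
Proof.
have mu0 := wavenumber_gt0 ab.
apply: (@le_trans _ _ (\sum_(k <- zrange N | k != 0) 4 / (`|k|%N%:R * mu) ^+ 2)).
  by apply: ler_sum => k k0; exact: wgt2_sob.
rewrite (sum_zrange_norm (fun n => 4 / (n%:R * mu) ^+ 2)).
(* Telescoping bound for the sum of inverse squares: 8 / z^2 <= 16 (1/z - 1/(z + 1)) as soon as z >=
   1. *)
have E n : \sum_(i < n) (4 / (i.+1%:R * mu) ^+ 2 + 4 / (i.+1%:R * mu) ^+ 2) <=
   16 / mu ^+ 2 * (1 - n.+1%:R^-1).
  elim: n => [|n IH]; first by rewrite big_ord0 invr1 subrr mulr0.
  rewrite big_ord_recr /=.
  apply: (le_trans (lerD IH (lexx _))).
  rewrite -subr_ge0.
  have n0 : 0 < n.+1%:R :> R by [].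
  rewrite -[n.+2]addn1 natrD; move: n0; set z : R := n.+1%:R => n0.
  have z1 : 1 <= z by rewrite /z ler1n.
  clearbody z; have zn : z != 0 by rewrite gt_eqF.
  have zn1 : z + 1 != 0 by rewrite gt_eqF// ltr_wpDr.
  have mun : mu != 0 by rewrite gt_eqF.
  have -> : 16 / mu ^+ 2 * (1 - (z + 1)^-1) -
    (16 / mu ^+ 2 * (1 - z^-1) + (4 / (z * mu) ^+ 2 + 4 / (z * mu) ^+ 2)) =
    8 * (z - 1) / (mu ^+ 2 * z ^+ 2 * (z + 1)) by field; rewrite ?zn ?zn1 ?mun.
  apply: divr_ge0; first by rewrite mulr_ge0 ?subr_ge0.
  by apply: mulr_ge0; [rewrite mulr_ge0 ?sqr_ge0|lra].
apply: (le_trans (E N)).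
have -> : (4 / mu) ^+ 2 = 16 / mu ^+ 2 by field; rewrite gt_eqF.
by rewrite ler_piMr ?divr_ge0 ?sqr_ge0// gerBl.
Qed.

(** Each quotient is at most 8 and there are 2N of them; 16 N is rounded up to 25 N to have a
    square. *)
Lemma sum_wgt3 N : \sum_(k <- zrange N | k != 0) freq_weight 3 k ^+ 2 / sob_weight 3 k
  <= (5 * Num.sqrt N%:R) ^+ 2.
Proof.
apply: (@le_trans _ _ (\sum_(k <- zrange N | k != 0) 8)).
  apply: ler_sum => k k0; rewrite ler_pdivrMr ?sob_weight_gt0//.
  rewrite /freq_weight /sobolev_weight -exprM mulnC exprM.
  have x0 : 0 <= `|k%:~R * mu| by []; move: x0; set x := `|_| => x0.
  have h := sqr_1D_le x.
  apply: (@le_trans _ _ ((2 * (1 + x ^+ 2)) ^+ 3)).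
    by apply: lerXn2r => //; rewrite nnegrE ?mulr_ge0 ?exprn_ge0//; lra.
  rewrite exprMn; have -> : (2 : R) ^+ 3 = 8 by rewrite !exprS expr0; lra.
  exact: lexx.
rewrite count_zrange exprMn sqr_sqrtr ?ler0n//.
have : 0 <= N%:R :> R by rewrite ler0n.
lra.
Qed.

(** For |k| > N/2 each quotient is at most 16 / (N mu)^2. There are at most 2N frequencies, so the
    total is 32 / (N mu^2), rounded up to 36 / (N mu^2). *)
Lemma sum_wcut N : (0 < N)%N ->
  \sum_(k <- zrange N | k != 0) tail_weight 2 N 2 k ^+ 2 / sob_weight 3 k
  <= (6 / mu / Num.sqrt N%:R) ^+ 2.
Proof.
move=> N0; have mu0 := wavenumber_gt0 ab.
have NR : 0 < N%:R :> R by rewrite ltr0n.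
apply: (@le_trans _ _ (\sum_(k <- zrange N | k != 0) (16 / (N%:R * mu) ^+ 2))).
  apply: ler_sum => k k0; rewrite /tail_weight; case: ifPn => [Nk|_]; last first.
    by rewrite expr0n mul0r divr_ge0 ?sqr_ge0.
  apply: (le_trans (wgt2_sob k0)).
  have kR : N%:R <= 2 * `|k|%N%:R :> R by rewrite -natrM ler_nat ltnW.
  have k1 : 0 < `|k|%N%:R :> R by rewrite ltr0n absz_gt0.
  have -> : 16 / (N%:R * mu) ^+ 2 = 4 / (N%:R / 2 * mu) ^+ 2.
    by field; rewrite !gt_eqF.
  have Nm : 0 < N%:R / 2 * mu by apply: mulr_gt0; [lra|].
  have km : 0 < `|k|%N%:R * mu by apply: mulr_gt0.
  apply: ler_pM => //; first by rewrite invr_ge0 sqr_ge0.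
  rewrite lef_pV2 ?posrE ?exprn_gt0//.
  apply: lerXn2r; [exact: ltW|exact: ltW|].
  by rewrite ler_pM2r//; lra.
rewrite count_zrange; move: (wavenumber a b) mu0 => m m0.
rewrite !exprMn !exprVn sqr_sqrtr ?ler0n//.
rewrite -subr_ge0.
rewrite [X in 0 <= X](_ : _ = 4 / (N%:R * m ^+ 2)); last first.
  by field; rewrite !gt_eqF.
by rewrite divr_ge0// mulr_ge0 ?sqr_ge0 ?ler0n.
Qed.

(** One constant above 8/mu, 10 and 12/mu: the roots 4/mu, 5 and 6/mu of the three sums, doubled by
    [wn_trig]. *)
Definition cbound : R := 10 + 12 / mu.

Lemma cbound_ge1 : 1 <= cbound.
Proof.
have mu0 := wavenumber_gt0 ab; rewrite /cbound.
have : 0 <= 12 / mu by rewrite divr_ge0// ltW.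
lra.
Qed.

Section Bounds.
Context N v (hN : (0 < N)%N) (hv : trig_space a b N v).
Local Notation S3 := (sobolev_norm a b 3 v).

Lemma wn_wgt2 : wn (freq_weight 2) (twaves N v) <= cbound * S3.
Proof.
have mu0 := wavenumber_gt0 ab.
apply: le_trans (wn_trig ab hv _ (wgt_ge0 2) (sum_wgt2 N)) _.
  by rewrite divr_ge0// ltW.
rewrite ler_wpM2r ?sobolev_norm_ge0// /cbound.
have : 0 <= mu^-1 by rewrite invr_ge0 ltW.
lra.
Qed.

Lemma wn_wgt3 : wn (freq_weight 3) (twaves N v) <= cbound * Num.sqrt N%:R * S3.
Proof.
have mu0 := wavenumber_gt0 ab.
apply: le_trans (wn_trig ab hv _ (wgt_ge0 3) (sum_wgt3 N)) _.
  by rewrite mulr_ge0 ?sqrtr_ge0.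
rewrite ler_wpM2r ?sobolev_norm_ge0// /cbound mulrA ler_wpM2r ?sqrtr_ge0//.
have : 0 <= mu^-1 by rewrite invr_ge0 ltW.
lra.
Qed.

Lemma wn_wcut : wn (tail_weight 2 N 2) (twaves N v) <= cbound / Num.sqrt N%:R * S3.
Proof.
have mu0 := wavenumber_gt0 ab.
apply: le_trans (wn_trig ab hv _ (wcut_ge0 2 N 2) (sum_wcut hN)) _.
  by apply: divr_ge0; [apply: divr_ge0 => //; exact: ltW|exact: sqrtr_ge0].
rewrite ler_wpM2r ?sobolev_norm_ge0// mulrA ler_wpM2r ?invr_ge0 ?sqrtr_ge0// /cbound.
have : 0 <= mu^-1 by rewrite invr_ge0 ltW.
lra.
Qed.

End Bounds.
End SobolevBounds.

(** * The embedding constant as a pointwise bound *)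

Section Embedding.
Context {R : realType}.
Context (a b : R) (ab : a < b).
Local Open Scope complex_scope.
Local Notation tev := (trig_eval a b).
Local Notation leb := (@lebesgue_measure R).

(** An essential bound holds everywhere by continuity: a point exceeding [C] would make a
    nondegenerate interval to its right, inside [a, b], a null set. *)
Lemma Linfty_norm_tev p (C : R) : (Linfty_norm a b (tev p) <= C%:E)%E ->
  forall x, `|tev p x| <= C.
Proof.
move=> + x; have [y + ->] := tev_reduce ab x; rewrite in_itv /= => /andP[ay yb].
rewrite /Linfty_norm unlock.
have -> : (0 < mrestr leb (measurable_itv `[a, b]) [set: R])%E.
  by rewrite /mrestr setTI lebesgue_measure_itv /= lte_fin ab -EFinD lte_fin subr_gt0.
move=> /ess_supP[A [mA A0 sA]]; rewrite leNgt; apply/negP => hy.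
have : \forall z \near y, C < `|tev p z|.
  have c : `|tev p z| @[z --> y] --> `|tev p y| := cvg_norm (@continuous_tev _ a b p y).
  exact: (cvgr_gt _ (c _) _ hy).
move=> /nbhs_ballP[e /= e0 he].
pose d := Num.min (e / 2) (b - y).
have d0 : 0 < d by rewrite lt_min divr_gt0// subr_gt0.
have sub : `[y, y + d] `<=` A `&` `[a, b].
  move=> z /=; rewrite !in_itv /= => /andP[yz zd].
  have de : d <= e / 2 by rewrite ge_min lexx.
  have db : d <= b - y by rewrite ge_min lexx orbT.
  split; last by apply/andP; split; lra.
  apply: sA => /=; apply/negP; rewrite -ltNge lte_fin; apply: he.
  rewrite /ball /= ler0_norm ?subr_le0//; lra.
have : (leb `[y, (y + d)%R]%classic <= leb (A `&` `[a, b]%classic))%E.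
  by apply: le_measure => //; rewrite inE//; exact: measurableI.
rewrite (A0 : leb (A `&` _) = 0%E).
rewrite lebesgue_measure_itv /= lte_fin ltrDl d0 -EFinD lee_fin addrAC subrr add0r.
by rewrite leNgt d0.
Qed.

Lemma L2_tev p : L2 a b (tev p).
Proof.
split.
- by move=> x; have := tev_periodz ab p x 1; rewrite mul1r.
- by apply: continuous_measurable_fun; exact: continuous_tev.
- apply: continuous_compact_integrable; first exact: segment_compact.
  apply: continuous_subspaceT => x.
  have -> : (fun x => tev p x ^+ 2) = tev (tmul p p).
    by apply/funext => z; rewrite tev_mul expr2.
  exact: continuous_tev.
Qed.

Lemma trig_spaceZ N v (c : R) : trig_space a b N v ->
  trig_space a b N (fun x => c * v x).
Proof.
move=> [e he]; exists (fun k => c%:C * e k) => x.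
rewrite rmorphM /= he mulr_sumr; apply: eq_bigr => k _; by rewrite mulrA.
Qed.

Lemma fourierZ p (c : R) k :
  fourier a b (fun x => c * tev p x) k = c%:C * fourier a b (tev p) k.
Proof.
have -> : (fun x => c * tev p x) = tev (tmult (fun=> c) p).
  by apply/funext => x; rewrite tev_mult_cst.
rewrite !fourier_tev// !big_map; simpc; congr (_ +i* _); rewrite mulr_sumr;
  apply: eq_bigr => m _ /=; ring.
Qed.

Lemma sob_sumZ r N v c : trig_space a b N v ->
  sob_sum a b r N (fun x => c * v x) = c ^+ 2 * sob_sum a b r N v.
Proof.
move=> hv; rewrite mulr_sumr; apply: eq_bigr => k _.
rewrite (trig_space_tev ab hv) fourierZ !normc_sq.
by case: (fourier _ _ _ _) => u w /=; ring.
Qed.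

(** Rescaling by the H^1 norm puts [v] in the unit ball over which the embedding norm is a supremum.
    If the norm is 0, all coefficients vanish and so does [v]. *)
Lemma trig_le_H1 N v C0 x : is_embedding_norm a b C0 -> trig_space a b N v ->
  `|v x| <= C0 * sobolev_norm a b 1 v.
Proof.
move=> hC hv; set s := sobolev_norm a b 1 v.
have s0 : 0 <= s by exact: sobolev_norm_ge0.
have [E|sn0] := eqVneq s 0.
  have : sob_sum a b 1 N v = 0 by rewrite -(sobolev_norm_sq ab 1 hv) -/s E expr0n.
  move/eqP; rewrite psumr_eq0; last first.
    by move=> k _; rewrite mulr_ge0 ?sqr_ge0// ltW// sob_weight_gt0.
  move=> /allP h; rewrite (trig_space_tev ab hv) tev_waves big_seq_cond big1.
    by rewrite normr0 E mulr0.
  move=> k /andP[kN k0]; have /implyP/(_ k0) := h k kN.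
  rewrite mulf_eq0 gt_eqF ?sob_weight_gt0// orFb sqrf_eq0 => /eqP e.
  suff -> : fourier a b v k = 0 by rewrite mul0r.
  move: e; case: (fourier a b v k) => u w /= /eqP.
  rewrite sqrtr_eq0 => h'.
  have : u ^+ 2 = 0 /\ w ^+ 2 = 0.
    by have := sqr_ge0 u; have := sqr_ge0 w; split; lra.
  by move=> [/eqP + /eqP]; rewrite !sqrf_eq0 => /eqP-> /eqP->.
have sp : 0 < s by rewrite lt_neqAle eq_sym sn0.
pose f z := s^-1 * v z.
have hf : trig_space a b N f by exact: trig_spaceZ.
have : `|f x| <= C0.
  have -> : f = tev (trig_coefs a b N f) by exact: (trig_space_tev ab hf).
  apply: Linfty_norm_tev; rewrite -(trig_space_tev ab hf) hC.
  apply: ereal_sup_ubound; exists f => //=; split; [split|].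
  - by rewrite (trig_space_tev ab hf); exact: L2_tev.
  - by rewrite (sobolev_sq_trig ab 1 hf) ltry.
  - rewrite (sobolev_norm_trig ab 1 hf) sob_sumZ// -(sobolev_norm_sq ab 1 hv) -/s.
    by rewrite -exprMn mulVf// expr1n sqrtr1.
by rewrite /f normrM normfV (ger0_norm s0) mulrC ler_pdivrMr.
Qed.

End Embedding.

(** * Calculus of weighted amplitude norms *)

Section WeightedNorms.
Context {R : realType}.
Context (a b : R).
Local Notation mu := (wavenumber a b).
Local Notation tev := (trig_eval a b).
Local Notation tD := (trig_deriv a b).
Local Notation wgt := (freq_weight a b).
Local Notation wcut := (tail_weight a b).
Local Notation lam := (resolvent_symbol a b).
Implicit Types (p q : seq (@wave R)).

Lemma wgt_le r r' k : (r <= r')%N -> wgt r k <= wgt r' k.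
Proof. by move=> rr; rewrite ler_weXn2l// lerDl. Qed.

Lemma wn1_le r p : wn (fun=> 1) p <= wn (wgt r) p.
Proof. by apply: wn_le => k; exact: (@wgt_le 0). Qed.

Lemma wn_wgt_le r r' p : (r <= r')%N -> wn (wgt r) p <= wn (wgt r') p.
Proof. by move=> rr; apply: wn_le => k; exact: wgt_le. Qed.

Lemma wn_wgt_ge0 r p : 0 <= wn (wgt r) p.
Proof. by apply: wn_ge0 => k; exact: wgt_ge0. Qed.

Lemma wn_wcut_ge0 c N r p : 0 <= wn (wcut c N r) p.
Proof. by apply: wn_ge0 => k; exact: wcut_ge0. Qed.

Lemma tev_le_wgt r p x : `|tev p x| <= wn (wgt r) p.
Proof. exact: le_trans (tev_le _ _ _ _) (wn1_le r p). Qed.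

Lemma wgt_freq r k : wgt r k * `|k%:~R * mu| <= wgt r.+1 k.
Proof.
by rewrite /freq_weight exprSr ler_wpM2l ?wgt_ge0// lerDr.
Qed.

Lemma wn_wgt_D r p : wn (wgt r) (tD p) <= wn (wgt r.+1) p.
Proof. by apply: wn_D => k; exact: wgt_freq. Qed.

Lemma wn_wcut_D c N r p : wn (wcut c N r) (tD p) <= wn (wcut c N r.+1) p.
Proof.
apply: wn_D => k; rewrite /tail_weight; case: ifP => _; first exact: wgt_freq.
by rewrite mul0r.
Qed.

(** The resolvent gains two derivatives; the factor 2 is that of (1 + x)^2 <= 2 (1 + x^2). *)
Lemma wgt_lam r k : wgt r.+2 k * `|lam k| <= 2 * wgt r k.
Proof.
rewrite (ger0_norm (ltW (lam_gt0 _ _ _))) /lam ler_pdivrMr ?ltr_wpDr ?sqr_ge0//.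
rewrite -(real_normK (num_real (k%:~R * mu))) /freq_weight -addn2 exprD.
set x := `|_|; rewrite [leRHS](_ : _ = (1 + x) ^+ r * (2 * (1 + x ^+ 2))); last by ring.
by rewrite ler_wpM2l ?exprn_ge0 ?addr_ge0 ?sqr_1D_le// /x.
Qed.

Lemma wn_wgt_lam r p : wn (wgt r.+2) (tmult lam p) <= 2 * wn (wgt r) p.
Proof. by apply: wn_mult => k; exact: wgt_lam. Qed.

Lemma wn_wcut_lam c N r p :
  wn (wcut c N r.+2) (tmult lam p) <= 2 * wn (wcut c N r) p.
Proof.
apply: wn_mult => k; rewrite /tail_weight; case: ifP => _; first exact: wgt_lam.
by rewrite mul0r mulr0.
Qed.

Lemma freqD j k : `|(j + k)%:~R * mu| <= `|j%:~R * mu| + `|k%:~R * mu|.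
Proof. by rewrite rmorphD /= mulrDl ler_normD. Qed.

Lemma freqB j k : `|(j - k)%:~R * mu| <= `|j%:~R * mu| + `|k%:~R * mu|.
Proof. by rewrite rmorphB /= mulrBl ler_normB. Qed.

Lemma wgt_submul_freq r j k l :
  `|l%:~R * mu| <= `|j%:~R * mu| + `|k%:~R * mu| -> wgt r l <= wgt r j * wgt r k.
Proof.
rewrite /freq_weight -exprMn; set u := `|_|; set v := `|_|; set w := `|_| => h.
have u0 : 0 <= u by exact: normr_ge0. have v0 : 0 <= v by exact: normr_ge0.
have w0 : 0 <= w by exact: normr_ge0.
have vw : 0 <= v * w by exact: mulr_ge0.
apply: lerXn2r; rewrite ?nnegrE; first by lra.
  by apply: mulr_ge0; lra.
by rewrite mulrDl mulrDr; lra.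
Qed.

Lemma wn_wgt_mul r p q : wn (wgt r) (tmul p q) <= wn (wgt r) p * wn (wgt r) q.
Proof.
have -> : wn (wgt r) p * wn (wgt r) q =
    wn (wgt r) p * wn (wgt r) q + wn (fun=> 0) p * wn (fun=> 0) q.
  have -> : wn (fun=> 0) p = 0 by rewrite /wn big1// => m _; rewrite mul0r.
  by rewrite mul0r addr0.
by apply: wn_mul => j k; rewrite mul0r addr0 wgt_submul_freq ?freqD ?freqB.
Qed.

(** Only one factor at a time receives the extra power. This keeps product bounds linear in the norm
    with three derivatives, the one that costs N^(1/2). *)
Lemma wgtS_leibniz r j k l : `|l%:~R * mu| <= `|j%:~R * mu| + `|k%:~R * mu| ->
  wgt r.+1 l <= wgt r.+1 j * wgt r k + wgt r j * wgt r.+1 k.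
Proof.
move=> h; have := wgt_submul_freq r h; rewrite /freq_weight !exprS.
move: h; set u := `|_|; set v := `|_|; set w := `|_| => h.
have u0 : 0 <= u by exact: normr_ge0. have v0 : 0 <= v by exact: normr_ge0.
have w0 : 0 <= w by exact: normr_ge0.
set z := _ ^+ r; set x := (1 + v) ^+ r; set y := (1 + w) ^+ r => zxy.
have z0 : 0 <= z by rewrite exprn_ge0// addr_ge0.
apply: (@le_trans _ _ ((1 + v + (1 + w)) * z)); first by rewrite ler_wpM2r//; lra.
apply: (@le_trans _ _ ((1 + v + (1 + w)) * (x * y))); first by rewrite ler_wpM2l//; lra.
by rewrite le_eqVlt; apply/orP; left; apply/eqP; ring.
Qed.

Lemma wn_wgtS_mul r p q : wn (wgt r.+1) (tmul p q) <=
  wn (wgt r.+1) p * wn (wgt r) q + wn (wgt r) p * wn (wgt r.+1) q.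
Proof. by apply: wn_mul => j k; rewrite wgtS_leibniz ?freqD ?freqB. Qed.

Lemma wcut_leibniz N r j k l : `|l%:~R * mu| <= `|j%:~R * mu| + `|k%:~R * mu| ->
  (`|l| <= `|j| + `|k|)%N ->
  wcut 1 N r l <= wcut 2 N r j * wgt r k + wgt r j * wcut 2 N r k.
Proof.
move=> h hl; have hw := wgt_submul_freq r h; rewrite /tail_weight.
have hjk : 0 <= wgt r j * wgt r k by rewrite mulr_ge0 ?wgt_ge0.
case: ifP => h1; last by case: ifP => _; case: ifP => _; rewrite ?mul0r ?mulr0; lra.
case: ifP => h2; case: ifP => h3; rewrite ?mul0r ?mulr0; [lra|lra|lra|].
by exfalso; lia.
Qed.

Lemma wn_wcut_mul N r p q : wn (wcut 1 N r) (tmul p q) <=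
  wn (wcut 2 N r) p * wn (wgt r) q + wn (wgt r) p * wn (wcut 2 N r) q.
Proof.
by apply: wn_mul => j k; apply: wcut_leibniz; rewrite ?freqD ?freqB//; lia.
Qed.

(** [band] also removes the frequency 0, but a derivative has no component there, so only the
    frequencies above N are lost. *)
Lemma tev_band N p x :
  `|tev (tD p) x - tev (tmult (band N) (tD p)) x| <= wn (wcut 1 N 1) p.
Proof.
have -> : tev (tD p) x - tev (tmult (band N) (tD p)) x =
    tev (tmult (fun k => 1 - band N k) (tD p)) x.
  by rewrite /trig_eval !big_map -sumrB; apply: eq_bigr => m _; rewrite /wave_eval /=; ring.
apply: (le_trans (tev_le _ _ _ _)); rewrite tmult_tD.
apply: (@le_trans _ _ (wn (fun k => `|k%:~R * mu|) (tmult (fun k => 1 - band N k) p))).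
  by apply: wn_D => k; rewrite mul1r.
rewrite -[leRHS]mul1r; apply: wn_mult => k; rewrite mul1r /band.
have [->|k0] := eqVneq k 0.
  by rewrite mul0r normr0 mul0r; exact: wcut_ge0.
rewrite /tail_weight mul1n ltnNge; case: leqP => _; first by rewrite /= subrr normr0 mulr0.
rewrite /= subr0 normr1 mulr1 /freq_weight expr1 lerDr //.
Qed.

Lemma wn_band om N p : (forall k, 0 <= om k) -> wn om (tmult (band N) p) <= wn om p.
Proof.
move=> om0; rewrite -[leRHS]mul1r; apply: wn_mult => k; rewrite mul1r ler_piMr//.
by rewrite /band; case: (_ && _); rewrite /= ?normr1 ?normr0.
Qed.

End WeightedNorms.

(** * Drift and one-step expansion *)

Section Drift.
Context {R : realType}.
Context (a b : R) (ab : a < b).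
Local Notation tev := (trig_eval a b).
Local Notation tD := (trig_deriv a b).
Local Notation wgt := (freq_weight a b).
Local Notation wcut := (tail_weight a b).
Local Notation lam := (resolvent_symbol a b).
Implicit Types (p q : seq (@wave R)).

(** The argument U^2 + U_x^2 / 2 of the resolvent in F_N; [gterm] is the whole bracket of F_N before
    projection, and [trig_drift] is F_N itself. *)
Definition fterm q := tmul q q ++ tmult (fun=> 2^-1) (tmul (tD q) (tD q)).

Definition gterm q := tmult (fun=> 2^-1) (tD (tmul q q)) ++ tD (tmult lam (fterm q)).

Definition trig_drift N q := tmult (fun=> -1) (tmult (band N) (gterm q)).

Lemma tev_fterm q x : tev (fterm q) x = tev q x ^+ 2 + 2^-1 * tev (tD q) x ^+ 2.
Proof. by rewrite tev_cat tev_mult_cst !tev_mul !expr2. Qed.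

Lemma tev_D_mul p q x :
  tev (tD (tmul p q)) x = tev (tD p) x * tev q x + tev p x * tev (tD q) x.
Proof.
rewrite -derive1_tev.
have -> : tev (tmul p q) = (fun z => tev p z * tev q z).
  by apply/funext => z; rewrite tev_mul.
rewrite derive1E deriveM; [|exact: derivable_tev|exact: derivable_tev].
rewrite -!derive1E !derive1_tev /GRing.scale /= addrC mulrC; congr (_ + _).
Qed.

Lemma drift_tev N q : drift a b N (tev q) = tev (trig_drift N q).
Proof.
have sqE r : (fun y => tev r y ^+ 2) = tev (tmul r r).
  by apply/funext => y; rewrite tev_mul expr2.
have dE r : derive1 (tev r) = tev (tD r) by apply/funext => y; exact: derive1_tev.
have fE : (fun y => tev q y ^+ 2 + 2^-1 * tev (tD q) y ^+ 2) = tev (fterm q).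
  by apply/funext => y; rewrite tev_fterm.
apply/funext => x; rewrite /drift dE fE sqE Lambda_tev// !dE.
have -> : (fun z => 2^-1 * tev (tD (tmul q q)) z + tev (tD (tmult lam (fterm q))) z) =
    tev (gterm q) by apply/funext => z; rewrite tev_cat tev_mult_cst.
by rewrite proj_tev// /trig_drift tev_mult_cst mulN1r.
Qed.

Lemma tD_cat p q : tD (p ++ q) = tD p ++ tD q.
Proof. by rewrite /trig_deriv map_cat. Qed.

(** The resolvent identity removes the second derivative of the nonlocal term, and its - U_x^2 / 2
    reduces U_x^2 to U_x^2 / 2. This is where the Riccati coefficient 1/2 originates. *)
Lemma tev_D_gterm q x : tev (tD (gterm q)) x =
  tev q x * tev (tD (tD q)) x + 2^-1 * tev (tD q) x ^+ 2 - tev q x ^+ 2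
  + tev (tmult lam (fterm q)) x.
Proof.
rewrite /gterm tD_cat tev_cat tev_DDlam -tmult_tD tev_mult_cst tev_fterm.
have -> : tev (tD (tD (tmul q q))) x =
    2 * (tev (tD q) x ^+ 2 + tev q x * tev (tD (tD q)) x).
  have E r s z : (forall y, tev r y = tev s y) -> tev (tD r) z = tev (tD s) z.
    by move=> h; rewrite -!derive1_tev; congr (derive1 _ z); apply/funext.
  rewrite (E _ (tmult (fun=> 2) (tmul q (tD q)))).
    by rewrite -tmult_tD tev_mult_cst tev_D_mul; ring.
  by move=> y; rewrite tev_D_mul tev_mult_cst tev_mul; ring.
by field.
Qed.

Section DriftBounds.
Context (N : nat) (q : seq (@wave R)) (al be de : R).
Context (hal : wn (wgt 2) q <= al) (hbe : wn (wgt 3) q <= be) (ab' : al <= be).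

Let al0 : 0 <= al. Proof. exact: le_trans (wn_wgt_ge0 _ _ 2 q) hal. Qed.
Let be0 : 0 <= be. Proof. exact: le_trans al0 ab'. Qed.

Let n1 r : (r <= 2)%N -> wn (wgt r) q <= al.
Proof. by move=> r2; apply: le_trans hal; exact: wn_wgt_le. Qed.

Let nD r : (r <= 1)%N -> wn (wgt r) (tD q) <= al.
Proof. by move=> r2; apply: le_trans (wn_wgt_D _ _ _ _) _; exact: n1. Qed.

Lemma wn_sqr r : (r <= 2)%N -> wn (wgt r) (tmul q q) <= al ^+ 2.
Proof.
move=> r2; apply: le_trans (wn_wgt_mul _ _ _ _ _) _.
by rewrite expr2; apply: ler_pM; rewrite ?wn_wgt_ge0 ?n1.
Qed.

Lemma wn_fterm r : (r <= 1)%N -> wn (wgt r) (fterm q) <= 2 * al ^+ 2.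
Proof.
move=> r1; rewrite wn_cat wn_mult_cst ger0_norm ?invr_ge0//.
have h1 : wn (wgt r) (tmul q q) <= al ^+ 2 by apply: wn_sqr; exact: leq_trans r1 _.
have h2 : wn (wgt r) (tmul (tD q) (tD q)) <= al ^+ 2.
  apply: le_trans (wn_wgt_mul _ _ _ _ _) _.
  by rewrite expr2; apply: ler_pM; rewrite ?wn_wgt_ge0 ?nD.
have := sqr_ge0 al; lra.
Qed.

Lemma wn_tdrift r : wn (wgt r) (trig_drift N q) <=
   2^-1 * wn (wgt r.+1) (tmul q q) + wn (wgt r.+1) (tmult lam (fterm q)).
Proof.
rewrite /trig_drift wn_mult_cst normrN1 mul1r.
apply: le_trans (wn_band _ _ _) _; first by move=> k; exact: wgt_ge0.
rewrite wn_cat wn_mult_cst ger0_norm ?invr_ge0//.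
by apply: lerD; [rewrite ler_wpM2l ?invr_ge0//|]; exact: wn_wgt_D.
Qed.

Lemma wn_tdrift1 : wn (wgt 1) (trig_drift N q) <= 5 * al ^+ 2.
Proof.
apply: le_trans (wn_tdrift 1) _.
have h1 := wn_sqr (leqnn 2).
have h2 : wn (wgt 2) (tmult lam (fterm q)) <= 2 * (2 * al ^+ 2).
  by apply: le_trans (wn_wgt_lam _ _ _ _) _; rewrite ler_wpM2l// wn_fterm.
have := sqr_ge0 al; lra.
Qed.

(** Three derivatives fall on q^2, but only one on the argument of the resolvent. So [be] enters
    linearly and through q^2 alone; 5 is 1/2 * 2 + 4. *)
Lemma wn_tdrift2 : wn (wgt 2) (trig_drift N q) <= 5 * (al * be).
Proof.
apply: le_trans (wn_tdrift 2) _.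
have h1 : wn (wgt 3) (tmul q q) <= be * al + al * be.
  apply: le_trans (wn_wgtS_mul _ _ _ _ _) _.
  by apply: lerD; apply: ler_pM; rewrite ?wn_wgt_ge0.
have h2 : wn (wgt 3) (tmult lam (fterm q)) <= 2 * (2 * al ^+ 2).
  by apply: le_trans (wn_wgt_lam _ _ _ _) _; rewrite ler_wpM2l// wn_fterm.
have h3 : al ^+ 2 <= al * be by rewrite expr2 ler_wpM2l.
have h4 : 0 <= al * be by rewrite mulr_ge0.
rewrite (mulrC be) in h1; lra.
Qed.

Hypothesis hde : wn (wcut 2 N 2) q <= de.

(** The constant is 1/2 * 2 from the local term plus 2 * 3 from the nonlocal one, where the
    resolvent pays for both derivatives. *)
Lemma gterm_tail x :
  `|tev (tD (gterm q)) x - tev (tmult (band N) (tD (gterm q))) x| <= 7 * (al * de).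
Proof.
have de0 : 0 <= de by exact: le_trans (wn_wcut_ge0 _ _ _ _ _ _) hde.
apply: le_trans (tev_band _ _ _ _ _) _.
rewrite /gterm wn_cat wn_mult_cst ger0_norm ?invr_ge0//.
have cut r : (r <= 2)%N -> wn (wcut 2 N r) q <= de.
  move=> r2; apply: le_trans hde; apply: wn_le => k; rewrite /tail_weight.
  by case: ifP => // _; exact: wgt_le.
have cutD r : (r <= 1)%N -> wn (wcut 2 N r) (tD q) <= de.
  by move=> r1; apply: le_trans (wn_wcut_D _ _ _ _ _ _) _; exact: cut.
have h1 r : (r <= 2)%N -> wn (wcut 1 N r) (tmul q q) <= 2 * (al * de).
  move=> r2; apply: le_trans (wn_wcut_mul _ _ _ _ _ _) _.
  have -> : 2 * (al * de) = de * al + al * de by ring.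
  by apply: lerD; apply: ler_pM; rewrite ?wn_wgt_ge0 ?wn_wcut_ge0 ?n1 ?cut.
have h2 : wn (wcut 1 N 0) (tmul (tD q) (tD q)) <= 2 * (al * de).
  apply: le_trans (wn_wcut_mul _ _ _ _ _ _) _.
  have -> : 2 * (al * de) = de * al + al * de by ring.
  by apply: lerD; apply: ler_pM; rewrite ?wn_wgt_ge0 ?wn_wcut_ge0 ?nD ?cutD.
have h3 : wn (wcut 1 N 1) (tD (tmul q q)) <= 2 * (al * de).
  by apply: le_trans (wn_wcut_D _ _ _ _ _ _) _; exact: h1.
have h4 : wn (wcut 1 N 1) (tD (tmult lam (fterm q))) <= 2 * wn (wcut 1 N 0) (fterm q).
  apply: le_trans (wn_wcut_D _ _ _ _ _ _) _; exact: wn_wcut_lam.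
have h5 : wn (wcut 1 N 0) (fterm q) <= 3 * (al * de).
  rewrite /fterm wn_cat wn_mult_cst ger0_norm ?invr_ge0//.
  have := h1 0%N isT; lra.
lra.
Qed.

End DriftBounds.

End Drift.

(** * First-order expansion of one time step *)

Section OneStep.
Context {R : realType}.
Context (a b : R) (ab : a < b).
Local Notation tev := (trig_eval a b).
Local Notation tD := (trig_deriv a b).
Local Notation wgt := (freq_weight a b).
Local Notation wcut := (tail_weight a b).
Local Notation lam := (resolvent_symbol a b).
Local Notation tdrift := (trig_drift a b).
Implicit Types (p q : seq (@wave R)).

Lemma tev_big I (r : seq I) (g : I -> seq (@wave R)) x :
  tev (\big[cat/[::]]_(i <- r) g i) x = \sum_(i <- r) tev (g i) x.
Proof.
by apply: (big_morph (fun p => tev p x)) => [p q|]; [exact: tev_cat|exact: tev_nil].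
Qed.

Lemma tD_big I (r : seq I) (g : I -> seq (@wave R)) :
  tD (\big[cat/[::]]_(i <- r) g i) = \big[cat/[::]]_(i <- r) tD (g i).
Proof. by apply: (big_morph tD) => // p q; exact: tD_cat. Qed.

(** The stage equations identify functions, whereas [trig_deriv] acts on lists; different lists for
    one function still have the same derivative. *)
Lemma eq_tev_D p q : tev p =1 tev q -> tev (tD p) =1 tev (tD q).
Proof. by move=> /funext h x; rewrite -!derive1_tev h. Qed.

Lemma tev_D_lincomb s q p (g : 'I_s -> seq (@wave R)) (c : 'I_s -> R) :
  (forall x, tev q x = tev p x + \sum_i c i * tev (g i) x) ->
  forall x, tev (tD q) x = tev (tD p) x + \sum_i c i * tev (tD (g i)) x.
Proof.
move=> h x.
rewrite (@eq_tev_D q (p ++ \big[cat/[::]]_(i < s) tmult (fun=> c i) (g i))).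
  rewrite tD_cat tev_cat tD_big tev_big; congr (_ + _); apply: eq_bigr => i _.
  by rewrite -tmult_tD tev_mult_cst.
move=> y; rewrite tev_cat tev_big h; congr (_ + _); apply: eq_bigr => i _.
by rewrite tev_mult_cst.
Qed.

Context (N s : nat) (A : 'M[R]_s) (w : 'I_s -> R) (tau : R).
Context (p : seq (@wave R)) (q : 'I_s -> seq (@wave R)) (al be de : R).
Context (X X' : R) (Xs : 'I_s -> R).
Hypotheses (tau0 : 0 <= tau) (w0 : forall i, 0 <= w i) (w1 : \sum_i w i = 1).
Hypotheses (pal : wn (wgt 2) p <= al) (pbe : wn (wgt 3) p <= be) (albe : al <= be).
Hypotheses (qal : forall i, wn (wgt 2) (q i) <= al)
  (qbe : forall i, wn (wgt 3) (q i) <= be) (qde : forall i, wn (wcut 2 N 2) (q i) <= de).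
Hypothesis stages : forall i x,
  tev (q i) x = tev p x + tau * \sum_(j < s) A i j * tev (tdrift N (q j)) x.
Hypothesis charst : forall i, Xs i = X + tau * \sum_(j < s) A i j * tev (q j) (Xs j).
Hypothesis charstep : X' = X + tau * \sum_(i < s) w i * tev (q i) (Xs i).

Definition mxabs : R := \sum_i \sum_j `|A i j|.

Let al0 : 0 <= al. Proof. exact: le_trans (wn_wgt_ge0 _ _ 2 p) pal. Qed.
Let be0 : 0 <= be. Proof. exact: le_trans al0 albe. Qed.

Lemma mxabs_ge0 : 0 <= mxabs.
Proof. by apply: sumr_ge0 => i _; apply: sumr_ge0. Qed.

Let row_le i (c : R) (f : 'I_s -> R) : (forall j, `|f j| <= c) -> 0 <= c ->
  `|tau * \sum_j A i j * f j| <= tau * (mxabs * c).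
Proof.
move=> hf c0; rewrite normrM (ger0_norm tau0) ler_wpM2l//.
apply: (le_trans (ler_norm_sum _ _ _)).
apply: (@le_trans _ _ (\sum_j `|A i j| * c)).
  by apply: ler_sum => j _; rewrite normrM ler_wpM2l.
rewrite -mulr_suml ler_wpM2r// /mxabs [leRHS](bigD1 i)//= lerDl.
by apply: sumr_ge0 => k _; apply: sumr_ge0.
Qed.

Let avg_le (c : R) (f : 'I_s -> R) : (forall j, `|f j| <= c) ->
  `|\sum_j w j * f j| <= c.
Proof.
move=> hf; apply: (le_trans (ler_norm_sum _ _ _)).
apply: (@le_trans _ _ (\sum_j w j * c)).
  by apply: ler_sum => j _; rewrite normrM (ger0_norm (w0 j)) ler_wpM2l.
by rewrite -mulr_suml w1 mul1r.
Qed.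

Let der1 i x : tev (tD (q i)) x =
  tev (tD p) x + tau * \sum_(j < s) A i j * tev (tD (tdrift N (q j))) x.
Proof.
have := @tev_D_lincomb s (q i) p (fun j => tdrift N (q j)) (fun j => tau * A i j).
move=> ->; first by rewrite mulr_sumr; congr (_ + _); apply: eq_bigr => j _; rewrite mulrA.
by move=> y; rewrite stages mulr_sumr; congr (_ + _); apply: eq_bigr => j _; rewrite mulrA.
Qed.

Let der2 i x : tev (tD (tD (q i))) x =
  tev (tD (tD p)) x + tau * \sum_(j < s) A i j * tev (tD (tD (tdrift N (q j)))) x.
Proof.
have := @tev_D_lincomb s (tD (q i)) (tD p) (fun j => tD (tdrift N (q j)))
  (fun j => tau * A i j).
move=> ->; first by rewrite mulr_sumr; congr (_ + _); apply: eq_bigr => j _; rewrite mulrA.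
by move=> y; rewrite der1 mulr_sumr; congr (_ + _); apply: eq_bigr => j _; rewrite mulrA.
Qed.

Let le0 r x : wn (wgt 2) r <= al -> `|tev r x| <= al.
Proof. by apply: le_trans; exact: tev_le_wgt. Qed.

Let le1 r x : wn (wgt 2) r <= al -> `|tev (tD r) x| <= al.
Proof.
apply: le_trans; apply: le_trans (tev_le_wgt _ _ 1 _ _) _.
exact: wn_wgt_D.
Qed.

Let le2 r x : wn (wgt 2) r <= al -> `|tev (tD (tD r)) x| <= al.
Proof.
apply: le_trans; apply: le_trans (tev_le_wgt _ _ 0 _ _) _.
by apply: le_trans (wn_wgt_D _ _ _ _) _; exact: wn_wgt_D.
Qed.

Let drift1 i x : `|tev (tD (tdrift N (q i))) x| <= 5 * al ^+ 2.
Proof.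
apply: le_trans (tev_le_wgt _ _ 0 _ _) _; apply: le_trans (wn_wgt_D _ _ _ _) _.
exact: wn_tdrift1.
Qed.

Let drift2 i x : `|tev (tD (tD (tdrift N (q i)))) x| <= 5 * (al * be).
Proof.
apply: le_trans (tev_le_wgt _ _ 0 _ _) _; apply: le_trans (wn_wgt_D _ _ _ _) _.
by apply: le_trans (wn_wgt_D _ _ _ _) _; exact: wn_tdrift2.
Qed.

Let dX : `|X' - X| <= tau * al.
Proof.
rewrite charstep addrAC subrr add0r normrM (ger0_norm tau0) ler_wpM2l//.
by apply: avg_le => j; exact: le0.
Qed.

Let dXs i : `|Xs i - X'| <= tau * ((1 + mxabs) * al).
Proof.
have h : `|Xs i - X| <= tau * (mxabs * al).
  by rewrite charst addrAC subrr add0r; apply: row_le => // j; exact: le0.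
have -> : Xs i - X' = (Xs i - X) - (X' - X) by ring.
apply: le_trans (ler_normB _ _) _.
rewrite mulrDl mul1r mulrDr addrC; exact: lerD.
Qed.

Let lip r x y : wn (wgt 2) r <= al -> `|tev r x - tev r y| <= al * `|x - y|.
Proof.
move=> h; apply: (le_trans (tev_lip _ _ _ _ _)); rewrite ler_wpM2r//.
apply: le_trans (wn1_le _ _ 1 _) _; apply: le_trans h; exact: wn_wgt_D.
Qed.

Let lip1 r x y : wn (wgt 2) r <= al -> `|tev (tD r) x - tev (tD r) y| <= al * `|x - y|.
Proof.
move=> h; apply: (le_trans (tev_lip _ _ _ _ _)); rewrite ler_wpM2r//.
apply: le_trans (wn1_le _ _ 0 _) _; apply: le_trans (wn_wgt_D _ _ _ _) _.
by apply: le_trans h; exact: wn_wgt_D.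
Qed.

Let lip2 r x y : wn (wgt 3) r <= be ->
  `|tev (tD (tD r)) x - tev (tD (tD r)) y| <= be * `|x - y|.
Proof.
move=> h; apply: (le_trans (tev_lip _ _ _ _ _)); rewrite ler_wpM2r//.
apply: le_trans (wn1_le _ _ 0 _) _; apply: le_trans (wn_wgt_D _ _ _ _) _.
apply: le_trans (wn_wgt_D _ _ _ _) _.
by apply: le_trans h; exact: wn_wgt_D.
Qed.

Let Y := tev (tD p) X.
(** The slope, at the new point, of the update before the noise is added. *)
Let D := tev (tD p) X' + tau * \sum_i w i * tev (tD (tdrift N (q i))) X'.

(** A crude two-sided bound: 1 for the motion of the point and 5 for the drift. It later controls
    how far the mean slope moves during one step. *)
Lemma one_step_abs : `|D - Y| <= 6 * tau * al ^+ 2.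
Proof.
rewrite /D /Y addrAC; apply: le_trans (ler_normD _ _) _.
rewrite [leRHS](_ : _ = al * (tau * al) + tau * (5 * al ^+ 2)); last by ring.
apply: lerD; first by apply: le_trans (lip1 _ _ pal) _; rewrite ler_wpM2l.
rewrite normrM (ger0_norm tau0) ler_wpM2l//; apply: avg_le => i; exact: drift1.
Qed.

Let eps := tau * (al ^+ 2 * be) * (3 + 11 * mxabs) + 7 * (al * de).

(** The first product comes from the motion of the point, and the drift contains - U U_xx of the
    stage at X'. Their difference is small although neither term is. The nonlocal term is dropped by
    the maximum principle. The constants are 2 + 6 [mxabs] for this cancellation and 1 + 5 [mxabs]
    for replacing the stage slope by [Y]. *)
Let stage_bound i :
  tev (tD (tD p)) X * tev (q i) (Xs i) + tev (tD (tdrift N (q i))) X' <=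
  - 2^-1 * Y ^+ 2 + tev (q i) X' ^+ 2 + eps.
Proof.
have tail := gterm_tail (qal i) (qde i) X'.
have -> : tev (tD (tdrift N (q i))) X' = - tev (tmult (band N) (tD (gterm a b (q i)))) X'.
  by rewrite /trig_drift -!tmult_tD tev_mult_cst mulN1r.
have := tev_D_gterm a b (q i) X'.
have : 0 <= tev (tmult lam (fterm a b (q i))) X'.
  apply: tev_lam_ge0 => // x; rewrite tev_fterm addr_ge0 ?sqr_ge0//.
  by rewrite mulr_ge0 ?sqr_ge0.
move: tail; set G := tev (tD (gterm a b (q i))) X'; set PG := tev (tmult (band N) _) X'.
set La := tev (tmult lam _) X'.
set Us := tev (q i) (Xs i); set U2 := tev (tD (tD p)) X.
set V := tev (q i) X'; set V1 := tev (tD (q i)) X'; set V2 := tev (tD (tD (q i))) X'.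
move=> tail La0 GE.
have B0 := mxabs_ge0.
have a2b : al ^+ 3 <= al ^+ 2 * be by rewrite exprSr ler_wpM2l ?sqr_ge0.
have hV2 : `|U2 - V2| <= tau * (al * be) * (1 + 5 * mxabs).
  have -> : U2 - V2 = (U2 - tev (tD (tD p)) X') - (V2 - tev (tD (tD p)) X') by ring.
  apply: le_trans (ler_normB _ _) _.
  rewrite [leRHS](_ : _ = be * (tau * al) + tau * (mxabs * (5 * (al * be)))); last by ring.
  apply: lerD.
    by apply: le_trans (lip2 _ _ pbe) _; rewrite ler_wpM2l// distrC.
  rewrite /V2 der2 addrAC subrr add0r; apply: row_le; first by move=> j; exact: drift2.
  by rewrite !mulr_ge0.
have hU : `|Us - V| <= tau * (1 + mxabs) * al ^+ 2.
  apply: le_trans (lip _ _ (qal i)) _.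
  rewrite [leRHS](_ : _ = al * (tau * ((1 + mxabs) * al))); last by ring.
  by rewrite ler_wpM2l.
have hV1 : `|V1 - Y| <= tau * al ^+ 2 * (1 + 5 * mxabs).
  have -> : V1 - Y = (V1 - tev (tD p) X') + (tev (tD p) X' - Y) by ring.
  apply: le_trans (ler_normD _ _) _.
  rewrite [leRHS](_ : _ = tau * (mxabs * (5 * al ^+ 2)) + al * (tau * al)); last by ring.
  apply: lerD; last by apply: le_trans (lip1 _ _ pal) _; rewrite ler_wpM2l.
  rewrite /V1 der1 addrAC subrr add0r; apply: row_le; first by move=> j; exact: drift1.
  by rewrite mulr_ge0 ?sqr_ge0.
have U2al : `|U2| <= al by exact: le2.
have Val : `|V| <= al by exact: le0.
have V1al : `|V1| <= al by exact: le1.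
have Yal : `|Y| <= al by exact: le1.
have e1 : `|U2 * Us - V2 * V| <= tau * (al ^+ 2 * be) * (2 + 6 * mxabs).
  have -> : U2 * Us - V2 * V = U2 * (Us - V) + (U2 - V2) * V by ring.
  apply: le_trans (ler_normD _ _) _; rewrite !normrM.
  apply: (@le_trans _ _ (al * (tau * (1 + mxabs) * al ^+ 2) +
     tau * (al * be) * (1 + 5 * mxabs) * al)).
    by apply: lerD; apply: ler_pM.
  rewrite -subr_ge0 [leRHS](_ : _ = tau * (1 + mxabs) * (al ^+ 2 * be - al ^+ 3));
    last by ring.
  by rewrite mulr_ge0 ?subr_ge0// mulr_ge0// addr_ge0.
have e2 : `|V1 ^+ 2 - Y ^+ 2| <= 2 * (tau * (al ^+ 2 * be) * (1 + 5 * mxabs)).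
  have -> : V1 ^+ 2 - Y ^+ 2 = (V1 - Y) * (V1 + Y) by ring.
  rewrite normrM; apply: (@le_trans _ _ (tau * al ^+ 2 * (1 + 5 * mxabs) * (2 * al))).
    apply: ler_pM => //; apply: le_trans (ler_normD _ _) _; lra.
  rewrite -subr_ge0 [leRHS](_ : _ = 2 * (tau * (1 + 5 * mxabs) * (al ^+ 2 * be - al ^+ 3)));
    last by ring.
  by rewrite mulr_ge0// mulr_ge0 ?subr_ge0// mulr_ge0// addr_ge0// mulr_ge0.
move: tail e1 e2; rewrite !ler_norml => /andP[t1 t2] /andP[f1 f2] /andP[g1 g2].
rewrite /eps; move: t1 t2 f1 f2 g1 g2.
set c := tau * _; set d := al * de => t1 t2 f1 f2 g1 g2.
rewrite GE in t1 t2.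
have -> : c * (3 + 11 * mxabs) = c * (2 + 6 * mxabs) + c * (1 + 5 * mxabs) by ring.
lra.
Qed.

(** The weights sum to 1, so the stage bounds average. The Taylor remainder of U_x between X and X'
    raises the constant from 3 to 4. *)
Lemma one_step_bound : D - Y <=
  tau * (- 2^-1 * Y ^+ 2 + \sum_i w i * tev (q i) X' ^+ 2
         + (tau * (al ^+ 2 * be) * (4 + 11 * mxabs) + 7 * (al * de))).
Proof.
have tay := tev_taylor2 a b (tD p) X X'.
have n3 : wn (fun=> 1) (tD (tD (tD p))) <= be.
  apply: le_trans (wn1_le _ _ 0 _) _; apply: le_trans (wn_wgt_D _ _ _ _) _.
  apply: le_trans (wn_wgt_D _ _ _ _) _.
  by apply: le_trans pbe; exact: wn_wgt_D.
have {n3}tay :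
    tev (tD p) X' - Y <= tev (tD (tD p)) X * (X' - X) + tau * (tau * (al ^+ 2 * be)).
  have : `|tev (tD p) X' - tev (tD p) X - tev (tD (tD p)) X * (X' - X)| <=
      be * (tau * al) ^+ 2.
    apply: le_trans tay _; apply: ler_pM => //; first exact: wn_ge0.
    by rewrite ler_sqr ?nnegrE ?mulr_ge0.
  rewrite ler_norml exprMn /Y => /andP[_].
  have -> : be * (tau ^+ 2 * al ^+ 2) = tau * (tau * (al ^+ 2 * be)) by ring.
  lra.
have sum : \sum_i w i * (tev (tD (tD p)) X * tev (q i) (Xs i) + tev (tD (tdrift N (q i))) X')
   <= - 2^-1 * Y ^+ 2 + \sum_i w i * tev (q i) X' ^+ 2 + eps.
  apply: (@le_trans _ _ (\sum_i w i * (- 2^-1 * Y ^+ 2 + tev (q i) X' ^+ 2 + eps))).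
    by apply: ler_sum => i _; rewrite ler_wpM2l.
  rewrite (eq_bigr (fun i => w i * (- 2^-1 * Y ^+ 2) + w i * tev (q i) X' ^+ 2 + w i * eps)).
    by rewrite !big_split /= -!mulr_suml w1 !mul1r.
  by move=> i _; ring.
have E : D - Y = tev (tD p) X' - Y + tau * \sum_i w i * tev (tD (tdrift N (q i))) X'.
  by rewrite /D addrAC.
rewrite E; apply: le_trans (lerD tay (lexx _)) _.
have -> : tev (tD (tD p)) X * (X' - X) =
   tau * \sum_i w i * (tev (tD (tD p)) X * tev (q i) (Xs i)).
  rewrite charstep addrAC subrr add0r mulrCA; congr (_ * _).
  by rewrite mulr_sumr; apply: eq_bigr => i _; ring.
rewrite addrAC -mulrDr -mulrDr ler_wpM2l// -big_split /=.
under eq_bigr do rewrite -mulrDr.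
apply: le_trans (lerD sum (lexx _)) _; rewrite /eps.
by rewrite le_eqVlt; apply/orP; left; apply/eqP; ring.
Qed.

End OneStep.

(** * Gaussian increments and the noise *)

Section NormalMoments.
Context {R : realType}.
Local Notation leb := (@lebesgue_measure R).

Lemma normal_pdf0N (s x : R) : s != 0 -> normal_pdf 0 s (- x) = normal_pdf 0 s x.
Proof. by move=> s0; rewrite !normal_pdfE// /normal_fun !subr0 sqrrN. Qed.

Lemma normal_probN (s : R) (B : set R) : s != 0 -> measurable B ->
  normal_prob 0 s (-%R @^-1` B) = normal_prob 0 s B.
Proof.
move=> s0 mB; rewrite /normal_prob.
have mN : measurable_fun [set: R] (-%R : R -> measurableTypeR R).
  exact: oppr_measurable.
transitivity (\int[pushforward leb (-%R : R -> measurableTypeR R)]_(x in B)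
   (normal_pdf 0 s x)%:E)%E.
  rewrite ge0_integral_pushforward//.
  - by apply: eq_integral => x _ /=; rewrite normal_pdf0N.
  - apply/measurable_EFinP/measurable_funTS; exact: measurable_normal_pdf.
  - by move=> x _; rewrite lee_fin normal_pdf_ge0.
apply: eq_measure_integral => A mA _; exact: lebesgue_measureN.
Qed.

(** The Gaussian density and the Radon-Nikodym derivative have equal integrals over every measurable
    set, hence agree almost everywhere. *)
Lemma ge0_integral_normal_prob (m s : R) (f : R -> \bar R) :
  (forall x, (0 <= f x)%E) -> measurable_fun [set: R] f ->
  (\int[normal_prob m s]_x f x = \int[leb]_x (f x * (normal_pdf m s x)%:E))%E.
Proof.
move=> f0 mf; have dom := normal_prob_dominates m s.
rewrite -(Radon_Nikodym_SigmaFinite.change_of_variables dom)//.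
have fi := Radon_Nikodym_SigmaFinite.f_integrable dom.
apply: ae_eq_integral => //.
- by apply: emeasurable_funM => //; exact: measurable_int fi.
- apply: emeasurable_funM => //; apply/measurable_EFinP; exact: measurable_normal_pdf.
- apply: ae_eqe_mul2l; apply: integral_ae_eq => //.
  + by apply/measurable_EFinP; exact: measurable_normal_pdf.
  + by move=> E _ mE; rewrite -Radon_Nikodym_SigmaFinite.f_integral.
Qed.

Lemma mul_expRN_sqr_le1 (y : R) : `|y| * expR (- y ^+ 2) <= 1.
Proof.
rewrite expRN ler_pdivrMr ?expR_gt0// mul1r.
apply: le_trans (expR_ge1Dx _); rewrite -(real_normK (num_real y)).
have h1 := sqr_ge0 (`|y| - 1); have h2 : 0 <= `|y| by exact: normr_ge0.
move: h1 h2; set z := `|y| => h1 h2; nra.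
Qed.

(** Half of the exponent absorbs |x|, as |y| e^(-y^2) <= 1 at y = x / (2 s); the other half is
    dominated by the Gaussian of standard deviation 2 s. *)
Lemma normal_abs_integrable (s : R) : 0 < s ->
  (\int[normal_prob 0 s]_x (`|x|%R)%:E < +oo)%E.
Proof.
move=> s0; have sn0 : s != 0 by rewrite gt_eqF.
rewrite ge0_integral_normal_prob//; last first.
  by apply/measurable_EFinP; exact: normr_measurable.
pose t := 2 * s; have t0 : t != 0 by rewrite mulf_neq0.
pose C := (2 * s) * normal_peak s / normal_peak t.
have pk : 0 < normal_peak t by exact: normal_peak_gt0.
have C0 : 0 <= C.
  by rewrite /C !mulr_ge0 ?invr_ge0 ?normal_peak_ge0// ltW.
apply: (@le_lt_trans _ _ (\int[leb]_x (C%:E * (normal_pdf 0 t x)%:E))%E).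
  apply: ge0_le_integral => //.
  - by move=> x _; rewrite mule_ge0// lee_fin normal_pdf_ge0.
  - apply: emeasurable_funM; apply/measurable_EFinP; last exact: measurable_normal_pdf.
    exact: normr_measurable.
  - apply: emeasurable_funM => //; apply/measurable_EFinP; exact: measurable_normal_pdf.
  move=> x _; rewrite -!EFinM lee_fin !normal_pdfE// /normal_fun subr0.
  have -> : C * (normal_peak t * expR (- x ^+ 2 / (t ^+ 2 *+ 2))) =
     normal_peak s * (2 * s * expR (- x ^+ 2 / (t ^+ 2 *+ 2))).
    by rewrite /C; field; rewrite gt_eqF.
  rewrite mulrCA ler_wpM2l ?normal_peak_ge0//.
  have -> : - x ^+ 2 / (s ^+ 2 *+ 2) = - (x / (2 * s)) ^+ 2 + - (x ^+ 2 / (8 * s ^+ 2)) * 2.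
    by rewrite -mulr_natl; field.
  have -> : - x ^+ 2 / (t ^+ 2 *+ 2) = - (x ^+ 2 / (8 * s ^+ 2)).
    by rewrite /t -mulr_natl; field.
  rewrite expRD mulrA.
  apply: (@le_trans _ _ (2 * s * expR (- (x ^+ 2 / (8 * s ^+ 2)) * 2))).
    rewrite ler_wpM2r ?expR_ge0//.
    have := mul_expRN_sqr_le1 (x / (2 * s)).
    by rewrite normrM normfV (gtr0_norm (_ : 0 < 2 * s)) ?mulr_gt0// mulrAC
      ler_pdivrMr ?mulr_gt0// mul1r.
  rewrite ler_wpM2l ?mulr_ge0 ?(ltW s0)// ler_expR.
  have : 0 <= x ^+ 2 / (8 * s ^+ 2).
    by apply: divr_ge0; [exact: sqr_ge0|apply: mulr_ge0 => //; exact: sqr_ge0].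
  lra.
rewrite ge0_integralZl//=; last 2 first.
- by apply/measurable_EFinP; exact: measurable_normal_pdf.
- by move=> x _; rewrite lee_fin normal_pdf_ge0.
by rewrite integral_normal_pdf mule1 ltry.
Qed.

End NormalMoments.

Section BoundedFactor.
Context {R : realType} {d : measure_display} {Om : measurableType d}.
Context (P : probability Om R).
Implicit Types f g : Om -> R.

Lemma integrable_le f g : measurable_fun [set: Om] f ->
  P.-integrable [set: Om] (EFin \o g) -> (forall x, `|f x| <= g x) ->
  P.-integrable [set: Om] (EFin \o f).
Proof.
move=> mf ig h; apply: (le_integrable _ _ _ ig) => //; first exact/measurable_EFinP.
by move=> x _ /=; rewrite lee_fin (le_trans (h x))// ler_norm.
Qed.

Lemma integrable_mul_bounded f g K : P.-integrable [set: Om] (EFin \o f) ->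
  measurable_fun [set: Om] g -> (forall x, `|g x| <= K) ->
  P.-integrable [set: Om] (EFin \o (fun x => f x * g x)).
Proof.
move=> fi mg gK.
have mf : measurable_fun [set: Om] f by apply/measurable_EFinP; exact: measurable_int fi.
apply: (@integrable_le _ (fun x => K * `|f x|)).
- exact: measurable_funM.
- have := integrableZl measurableT K (integrable_norm fi).
  by apply: eq_integrable => // x _ /=; rewrite EFinM.
- by move=> x; rewrite normrM mulrC ler_wpM2r.
Qed.

Lemma integrable_bounded f K : measurable_fun [set: Om] f ->
  (forall x, `|f x| <= K) -> P.-integrable [set: Om] (EFin \o f).
Proof.
move=> mf fK; apply: (@integrable_le _ (cst K)) => //.
apply: finite_measure_integrable_cst => //.
Qed.

Lemma measurable_int_fin f : P.-integrable [set: Om] (EFin \o f) -> measurable_fun [set: Om] f.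
Proof. by move=> fi; apply/measurable_EFinP; exact: measurable_int fi. Qed.

Lemma integrable_addr f g : P.-integrable [set: Om] (EFin \o f) ->
  P.-integrable [set: Om] (EFin \o g) ->
  P.-integrable [set: Om] (EFin \o (fun x => f x + g x)).
Proof. by move=> fi gi; have := integrableD measurableT fi gi; apply: eq_integrable. Qed.

Lemma integrable_subr f g : P.-integrable [set: Om] (EFin \o f) ->
  P.-integrable [set: Om] (EFin \o g) ->
  P.-integrable [set: Om] (EFin \o (fun x => f x - g x)).
Proof. by move=> fi gi; have := integrableB measurableT fi gi; apply: eq_integrable. Qed.

Lemma integrable_scale f c : P.-integrable [set: Om] (EFin \o f) ->
  P.-integrable [set: Om] (EFin \o (fun x => c * f x)).
Proof.
move=> fi; have := integrableZl measurableT c fi.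
by apply: eq_integrable => // x _; rewrite EFinM.
Qed.

Lemma integrable_sumr I (r : seq I) (f : I -> Om -> R) :
  (forall i, P.-integrable [set: Om] (EFin \o f i)) ->
  P.-integrable [set: Om] (EFin \o (fun x => \sum_(i <- r) f i x)).
Proof.
move=> fi; elim: r => [|i r IH].
  apply: (@integrable_bounded _ 0) => [|x]; last by rewrite big_nil normr0.
  by under eq_fun do rewrite big_nil; exact: measurable_cst.
by under [X in EFin \o X]eq_fun do rewrite big_cons; exact: integrable_addr.
Qed.

Lemma Rintegral_sumr I (r : seq I) (f : I -> Om -> R) :
  (forall i, P.-integrable [set: Om] (EFin \o f i)) ->
  (\int[P]_x (\sum_(i <- r) f i x))%R = \sum_(i <- r) (\int[P]_x f i x)%R.
Proof.
move=> fi; elim: r => [|i r IH].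
  under eq_Rintegral do rewrite big_nil; rewrite big_nil.
  by rewrite Rintegral_cst// mul0r.
under eq_Rintegral do rewrite big_cons.
by rewrite big_cons RintegralD//; [rewrite IH|exact: integrable_sumr].
Qed.

End BoundedFactor.

(** There are n + 1 cells because z = 1 lies in the cell that starts at n/n. *)
Lemma truncn_step_approx {R : realType} (n : nat) (z : R) : (0 < n)%N -> 0 <= z <= 1 ->
  `|z - \sum_(m < n.+1) m%:R / n%:R * \1_(`[m%:R / n%:R, m.+1%:R / n%:R[%classic) z|
   <= n%:R^-1.
Proof.
move=> n0 /andP[z0 z1].
have nR : 0 < n%:R :> R by rewrite ltr0n.
have nz0 : 0 <= n%:R * z by rewrite mulr_ge0 ?ler0n.
pose m0 := Num.truncn (n%:R * z).
have /andP[t1 t2] := truncn_itv nz0.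
have m0n : (m0 < n.+1)%N.
  by rewrite ltnS -(ler_nat R) (le_trans t1)// ler_piMr// ltW.
have E (m : nat) : \1_(`[m%:R / n%:R, m.+1%:R / n%:R[%classic) z = (m == m0)%:R :> R.
  rewrite indicE; congr (nat_of_bool _)%:R; apply/idP/eqP.
    rewrite inE /= in_itv /= ler_pdivrMr// ltr_pdivlMr// mulrC => /andP[h1 h2].
    by apply/esym/truncn_def; rewrite h1 h2.
  move=> ->; rewrite inE /= in_itv /= ler_pdivrMr// ltr_pdivlMr// mulrC.
  by rewrite t1 t2.
under eq_bigr do rewrite E.
rewrite (bigD1 (Ordinal m0n))//= eqxx mulr1 big1 ?addr0; last first.
  by move=> i /negPf; rewrite -val_eqE /= => ->; rewrite mulr0.
have -> : z - m0%:R / n%:R = (n%:R * z - m0%:R) / n%:R by field; rewrite gt_eqF.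
move: t1 t2; rewrite -/m0 -[m0.+1]addn1 natrD; set y := n%:R * z => t1 t2.
by rewrite ger0_norm ?divr_ge0 ?subr_ge0// -[leRHS]mul1r ler_wpM2r ?invr_ge0 ?ltW//; lra.
Qed.

Section Increment.
Context {R : realType} {d : measure_display} {Om : measurableType d}.
Context (P : probability Om R) (G : set (set Om)).
Hypothesis GT : G [set: Om].
Hypothesis GM : G `<=` measurable.
Context (dB : Om -> R) (s : R).
Hypothesis s0 : 0 < s.
Hypothesis mdB : measurable_fun [set: Om] dB.
Hypothesis law : forall E B, G E -> measurable B ->
  P (E `&` dB @^-1` B) = (P E * normal_prob 0 s B)%E.

(** [law] encodes independence and distribution together; taking the whole space for E isolates the
    distribution. *)
Lemma increment_integrable : P.-integrable [set: Om] (EFin \o dB).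
Proof.
apply/integrableP; split; first exact/measurable_EFinP.
apply: le_lt_trans (normal_abs_integrable s0).
have -> : (\int[P]_x `|(EFin \o dB) x| =
    \int[pushforward P (dB : Om -> measurableTypeR R)]_x (`|x|%R)%:E)%E.
  rewrite ge0_integral_pushforward//.
  by apply/measurable_EFinP; exact: normr_measurable.
rewrite le_eqVlt; apply/orP; left; apply/eqP; apply: eq_measure_integral => B mB _.
by have := law GT mB; rewrite setTI probability_setT mul1e.
Qed.

(* [dB * 1_E] has a symmetric law, because [dB] is a centred Gaussian
   independent of [E]. *)
Lemma increment_indic E : G E -> (\int[P]_x (dB x * \1_E x))%R = 0.
Proof.
move=> GE; have mE := GM GE.
pose V x := dB x * \1_E x; pose W x := - V x.
have mV : measurable_fun [set: Om] V by apply: measurable_funM => //; exact: measurable_indic.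
have mW : measurable_fun [set: Om] W by exact: measurableT_comp.
have iV : P.-integrable [set: Om] (EFin \o V).
  apply: (@integrable_mul_bounded _ _ _ _ _ _ 1) => //; first exact: increment_integrable.
  by move=> x; rewrite indicE; case: (_ \in _); rewrite ?normr1 ?normr0.
have iW : P.-integrable [set: Om] (EFin \o W).
  by have := integrable_scale (-1) iV; apply: eq_integrable => // x _ /=; rewrite mulN1r.
(* Off E the variable [V] vanishes, which adds an atom at 0 of mass P(~E). Both this atom and the
   centred Gaussian part are invariant under reflection. *)
have PV B : measurable B -> P (V @^-1` B) =
    (P E * normal_prob 0 s B + (if 0%R \in B then P (~` E) else 0))%E.
  move=> mB.
  have -> : V @^-1` B = (E `&` dB @^-1` B) `|` (~` E `&` [set x | 0%R \in B]).
    apply/seteqP; split => x /=; rewrite /V indicE /=.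
      have [xE|xE] := pselect (E x).
        by rewrite mem_set// mulr1; left.
      by rewrite memNset// mulr0 => B0; right; split => //; rewrite inE.
    case => [[xE]|[xE]]; first by rewrite mem_set// mulr1.
    by rewrite inE memNset// mulr0.
  rewrite measureU; last 3 first.
  - apply: measurableI => //; rewrite -[_ @^-1` _]setTI; exact: mdB.
  - apply: measurableI; first exact: measurableC.
    case: (0%R \in B); first by rewrite (_ : [set _ | _] = setT)//; apply/seteqP; split.
    by rewrite (_ : [set _ | _] = set0)//; apply/seteqP; split.
  - by apply/seteqP; split => x //= [[xE _] [nE _]].
  rewrite [X in (X + _ = _)%E](law GE mB); congr (_ + _)%E; case: (0%R \in B).
    by rewrite (_ : [set _ | _] = setT) ?setIT//; apply/seteqP; split.
  by rewrite (_ : [set _ | _] = set0) ?setI0 ?measure0//; apply/seteqP; split.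
have sym B : measurable B -> pushforward P V B = pushforward P W B.
  move=> mB; rewrite /pushforward.
  have mNB : measurable (-%R @^-1` B : set R).
    by rewrite -[_ @^-1` _]setTI; exact: oppr_measurable.
  rewrite (_ : W @^-1` B = V @^-1` (-%R @^-1` B))// !PV// normal_probN ?gt_eqF//.
  congr (_ + _)%E; have -> : (0 \in -%R @^-1` B) = (0%R \in B) => //.
  by apply/idP/idP; rewrite !inE /= oppr0.
have EVW : (\int[P]_x (EFin \o V) x = \int[P]_x (EFin \o W) x)%E.
  have iid (U : Om -> R) (mU : measurable_fun [set: Om] U) :
      P.-integrable [set: Om] (EFin \o U) ->
      (\int[P]_x (EFin \o U) x = \int[pushforward P (U : Om -> measurableTypeR R)]_x x%:E)%E.
    by move=> iU; rewrite integral_pushforward.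
  rewrite !iid//; apply: eq_measure_integral => B mB _; exact: sym.
have : (\int[P]_x V x)%R = (\int[P]_x W x)%R by rewrite /Rintegral EVW.
have -> : (\int[P]_x W x)%R = - (\int[P]_x V x)%R.
  by rewrite -mulN1r -RintegralZl//; apply: eq_Rintegral => x _; rewrite mulN1r.
by rewrite -/V; lra.
Qed.

(** Step functions of Z with mesh 1/n reduce this to indicators of events of G; the error is at most
    E|dB| / n for every n. *)
Lemma increment_unit (Z : Om -> R) : (forall B, measurable B -> G (Z @^-1` B)) ->
  (forall x, 0 <= Z x <= 1) -> (\int[P]_x (dB x * Z x))%R = 0.
Proof.
move=> GZ Z01; have iB := increment_integrable.
have mZ : measurable_fun [set: Om] Z by move=> _ B mB; rewrite setTI; exact/GM/GZ.
pose K := (\int[P]_x `|dB x|)%R.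
have K0 : 0 <= K by exact: Rintegral_ge0.
have H n : (0 < n)%N -> `|(\int[P]_x (dB x * Z x))%R| <= K / n%:R.
  move=> n0.
  pose E m := Z @^-1` `[m%:R / n%:R, m.+1%:R / n%:R[%classic.
  have GE m : G (E m) by apply: GZ; exact: measurable_itv.
  pose Zn (x : Om) : R := \sum_(m < n.+1) m%:R / n%:R * \1_(E m) x.
  have mZn : measurable_fun [set: Om] Zn.
    apply: measurable_sum => m; apply: measurable_funM => //.
    by apply: measurable_indic; exact/GM.
  have ZZn x : `|Z x - Zn x| <= n%:R^-1.
    by have := truncn_step_approx n0 (Z01 x).
  have iZn m : P.-integrable [set: Om] (EFin \o (fun x => dB x * \1_(E m) x)).
    apply: (@integrable_mul_bounded _ _ _ _ _ _ 1) => //.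
      by apply: measurable_indic; exact/GM.
    by move=> x; rewrite indicE; case: (_ \in _); rewrite ?normr1 ?normr0.
  have IZn : (\int[P]_x (dB x * Zn x))%R = 0.
    under eq_Rintegral do rewrite mulr_sumr.
    rewrite Rintegral_sumr; last first.
      move=> m; have := integrable_scale (m%:R / n%:R) (iZn m).
      by apply: eq_integrable => // x _ /=; rewrite mulrCA.
    rewrite big1// => m _; under eq_Rintegral do rewrite mulrCA.
    by rewrite RintegralZl// increment_indic// mulr0.
  have iZ : P.-integrable [set: Om] (EFin \o (fun x => dB x * Z x)).
    apply: (@integrable_mul_bounded _ _ _ _ _ _ 1) => // x.
    by have /andP[? ?] := Z01 x; rewrite ger0_norm.
  have ib : P.-integrable [set: Om] (EFin \o (fun x => dB x * Zn x)).
    apply: (@integrable_mul_bounded _ _ _ _ _ _ (1 + n%:R^-1)) => // x.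
    have -> : Zn x = Z x - (Z x - Zn x) by ring.
    apply: le_trans (ler_normB _ _) _; apply: lerD => //.
    by have /andP[? ?] := Z01 x; rewrite ger0_norm.
  have -> : (\int[P]_x (dB x * Z x))%R = (\int[P]_x (dB x * Z x - dB x * Zn x))%R.
    by rewrite RintegralB// IZn subr0.
  apply: (le_trans (le_normr_Rintegral _ _)) => //; first exact: integrable_subr.
  have iN : P.-integrable [set: Om] (EFin \o (fun x => `|dB x|)).
    exact: integrable_norm iB.
  rewrite /K mulrC -RintegralZl//; apply: le_Rintegral => //.
  - by apply: integrable_norm; exact: integrable_subr.
  - exact: integrable_scale.
  - by move=> x _; rewrite -mulrBr normrM mulrC ler_wpM2r.
apply/eqP; rewrite -normr_le0 leNgt; apply/negP; set y := `|_| => y0.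
pose n := (Num.truncn (K / y)).+1.
have := H n isT; rewrite -/y leNgt => /negP; apply.
by rewrite ltr_pdivrMr ?ltr0n// mulrC -ltr_pdivrMr// truncnS_gt.
Qed.

End Increment.

(** * Linear structure of S_N and its Fourier coefficients *)

Section TrigSpaceClosure.
Context {R : realType}.
Context (a b : R) (ab : a < b).
Local Open Scope complex_scope.
Local Notation tev := (trig_eval a b).
Local Notation tD := (trig_deriv a b).
Local Notation angle := (mode_angle a b).
Local Notation twaves := (trig_coefs a b).

Lemma sum_zrangeN (V : nmodType) (g : int -> V) n :
  \sum_(k <- zrange n | k != 0) g (- k) = \sum_(k <- zrange n | k != 0) g k.
Proof.
transitivity (\sum_(k <- [seq - k | k <- zrange n] | k != 0) g k).
  by rewrite [RHS]big_map; apply: eq_bigl => k; rewrite oppr_eq0.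
apply: perm_big; apply: uniq_perm; rewrite ?zrange_uniq//.
  by rewrite map_inj_uniq ?zrange_uniq//; exact: oppr_inj.
move=> k; rewrite -[k in LHS]opprK mem_map; last exact: oppr_inj.
by rewrite !mem_zrange abszN.
Qed.

(** Taking real parts symmetrises the coefficients: k receives half of c_k plus the conjugate of
    c_(-k). *)
Lemma trig_space_waves N c : trig_space a b N (tev (waves N c)).
Proof.
exists (fun k => 2^-1%:C * (c k + (complex.Re (c (- k)) -i* complex.Im (c (- k))))) => x.
pose h k := 2^-1%:C * c k * mode a b k x.
pose h' k := 2^-1%:C * (complex.Re (c k) -i* complex.Im (c k)) * mode a b (- k) x.
transitivity (\sum_(k <- zrange N | k != 0) (h k + h' k)).
  have E k : h k + h' k = (complex.Re (c k * mode a b k x))%:C.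
    rewrite /h /h' /mode /expi -!/(angle _ _) angleN cosN sinN.
    by case: (c k) => u v; simpc; congr (_ +i* _); rewrite /=; field.
  by rewrite tev_waves rmorph_sum /=; apply: eq_bigr => k _; rewrite E.
rewrite big_split /= -(sum_zrangeN h') -big_split /=; apply: eq_bigr => k _.
by rewrite /h /h' opprK -mulrDl -mulrDr.
Qed.

Lemma proj_waves N f : Defs.proj a b N f = tev (waves N (fourier a b f)).
Proof. by apply/funext => x; rewrite /Defs.proj Re_sum tev_waves. Qed.

Lemma trig_space_proj N f : trig_space a b N (Defs.proj a b N f).
Proof. by rewrite proj_waves; exact: trig_space_waves. Qed.

Lemma trig_spaceD N u v : trig_space a b N u -> trig_space a b N v ->
  trig_space a b N (fun x => u x + v x).
Proof.
move=> [c hc] [e he]; exists (fun k => c k + e k) => x.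
by rewrite rmorphD /= hc he -big_split; apply: eq_bigr => k _; rewrite mulrDl.
Qed.

Lemma trig_space0 N : trig_space a b N (fun=> 0).
Proof. by exists (fun=> 0) => x; rewrite big1// => k _; rewrite mul0r. Qed.

Lemma trig_space_sum N n (c : nat -> R) (v : nat -> R -> R) :
  (forall j, trig_space a b N (v j)) ->
  trig_space a b N (fun x => \sum_(j < n) c j * v j x).
Proof.
move=> hv; elim: n => [|n IH].
  by under eq_fun do rewrite big_ord0; exact: trig_space0.
under eq_fun do rewrite big_ord_recr /=.
by apply: trig_spaceD => //; exact: trig_spaceZ.
Qed.

Lemma fourier_add p q k : fourier a b (fun x => tev p x + tev q x) k =
  fourier a b (tev p) k + fourier a b (tev q) k.
Proof.
have -> : (fun x => tev p x + tev q x) = tev (p ++ q) by apply/funext => x; rewrite tev_cat.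
by rewrite !fourier_tev// !big_cat /=; simpc.
Qed.

Lemma fourierD_trig N u v k : trig_space a b N u -> trig_space a b N v ->
  fourier a b (fun x => u x + v x) k = fourier a b u k + fourier a b v k.
Proof.
by move=> /(trig_space_tev ab) -> /(trig_space_tev ab) ->; exact: fourier_add.
Qed.

Lemma fourierZ_trig N c v k : trig_space a b N v ->
  fourier a b (fun x => c * v x) k = c%:C * fourier a b v k.
Proof. by move=> /(trig_space_tev ab) ->; exact: fourierZ. Qed.

Lemma fourier_sum_trig N n (c : nat -> R) (v : nat -> R -> R) k :
  (forall j, trig_space a b N (v j)) ->
  fourier a b (fun x => \sum_(j < n) c j * v j x) k =
  \sum_(j < n) (c j)%:C * fourier a b (v j) k.
Proof.
move=> hv; elim: n => [|n IH].
  under eq_fun do rewrite big_ord0; rewrite big_ord0.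
  have -> : (fun=> 0) = tev [::] by apply/funext => x; rewrite tev_nil.
  by rewrite fourier_tev// !big_nil.
under eq_fun do rewrite big_ord_recr /=.
rewrite (@fourierD_trig N); last 2 first.
- exact: trig_space_sum.
- exact: trig_spaceZ.
by rewrite (fourierZ_trig _ _ (hv n)) IH big_ord_recr.
Qed.

Lemma derive1_trig N v x : trig_space a b N v -> derive1 v x =
  \sum_(k <- zrange N | k != 0)
    (k%:~R * wavenumber a b) * (complex.Re (fourier a b v k) * - sin (angle k x)
       + complex.Im (fourier a b v k) * - cos (angle k x)).
Proof.
move=> hv; rewrite {1}(trig_space_tev ab hv) derive1_tev.
rewrite /tD /twaves /waves /trig_eval big_map big_flatten big_map big_filter.
apply: eq_bigr => k _; rewrite 2!big_cons big_nil Monoid.mulm1 /= /wave_eval /hD /= add0r.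
by rewrite addrA !cosDpihalf sinDpihalf; ring.
Qed.

End TrigSpaceClosure.

Section MeanSquareLimit.
Context {R : realType} {d : measure_display} {Om : measurableType d}.
Context (P : probability Om R).

(** By |x| <= eps/2 + x^2 / (2 eps), a mean-square error below eps^2 gives an L^1 error of at most
    eps. This yields both the integrability of [D], which is only assumed measurable, and the
    vanishing of the limit integral. *)
Lemma mean_square_limit (D Z : Om -> R) (xi err : nat -> Om -> R) :
  measurable_fun [set: Om] D -> measurable_fun [set: Om] Z -> (forall om, `|Z om| <= 1) ->
  (forall n, P.-integrable [set: Om] (EFin \o xi n)) ->
  (forall n, (\int[P]_om (xi n om * Z om))%R = 0) ->
  (forall n om, (xi n om - D om) ^+ 2 <= err n om) ->
  (forall n, measurable_fun [set: Om] (err n)) ->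
  (fun n => 'E_P[err n]%E) @ \oo --> 0%E ->
  P.-integrable [set: Om] (EFin \o D) /\ (\int[P]_om (D om * Z om))%R = 0.
Proof.
move=> mD mZ Z1 ixi xiZ herr merr cerr.
have err0 n om : 0 <= err n om by exact: le_trans (sqr_ge0 _) (herr n om).
have H (eps : R) : 0 < eps -> P.-integrable [set: Om] (EFin \o D) /\
    `|(\int[P]_om (D om * Z om))%R| <= eps.
  move=> e0.
  have [n hn] : exists n, ('E_P[err n] < (eps ^+ 2)%:E)%E.
    have e2 : (0 < (eps ^+ 2)%:E :> \bar R)%E by rewrite lte_fin exprn_gt0.
    have : \forall n \near \oo, ('E_P[err n] < (eps ^+ 2)%:E)%E.
      exact: (cerr _ (open_ereal_lt' e2)).
    by move=> [n _ /(_ n (leqnn n))]; exists n.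
  have ie : P.-integrable [set: Om] (EFin \o err n).
    apply/integrableP; split; first exact/measurable_EFinP.
    move: hn; rewrite unlock => hn; under eq_integral do rewrite /= ger0_norm//.
    exact: lt_trans hn (ltry _).
  have bound om : `|xi n om - D om| <= 2^-1 * eps + (2 * eps)^-1 * err n om.
    have := herr n om; set y := xi n om - D om => hy.
    have h1 : (2 * eps)^-1 * y ^+ 2 <= (2 * eps)^-1 * err n om.
      by rewrite ler_wpM2l// invr_ge0 mulr_ge0// ltW.
    have h2 : `|y| <= 2^-1 * eps + (2 * eps)^-1 * y ^+ 2.
      rewrite -subr_ge0 -real_normK ?num_real//.
      have -> : 2^-1 * eps + (2 * eps)^-1 * `|y| ^+ 2 - `|y| = (`|y| - eps) ^+ 2 / (2 * eps).
        by field; rewrite gt_eqF.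
      by rewrite divr_ge0 ?sqr_ge0// mulr_ge0// ltW.
    lra.
  have mxi : measurable_fun [set: Om] (xi n) by apply: measurable_int_fin; exact: ixi.
  have ib : P.-integrable [set: Om] (EFin \o (fun om => 2^-1 * eps + (2 * eps)^-1 * err n om)).
    apply: (@integrable_addr _ _ _ _ (cst (2^-1 * eps))); last exact: integrable_scale.
    exact: finite_measure_integrable_cst.
  have idif : P.-integrable [set: Om] (EFin \o (fun om => xi n om - D om)).
    by apply: integrable_le ib _ => //; exact: measurable_funB.
  have iD : P.-integrable [set: Om] (EFin \o D).
    have := integrable_subr (ixi n) idif; apply: eq_integrable => // om _ /=.
    by rewrite opprB addrC subrK.
  split=> //.
  have ixZ : P.-integrable [set: Om] (EFin \o (fun om => xi n om * Z om)).
    exact: integrable_mul_bounded Z1.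
  have iDZ : P.-integrable [set: Om] (EFin \o (fun om => D om * Z om)).
    exact: integrable_mul_bounded Z1.
  have -> : (\int[P]_om (D om * Z om))%R =
      - (\int[P]_om (xi n om * Z om - D om * Z om))%R.
    by rewrite RintegralB// xiZ sub0r opprK.
  rewrite normrN; apply: (le_trans (le_normr_Rintegral _ _)) => //.
    exact: integrable_subr.
  apply: (@le_trans _ _ (\int[P]_om (2^-1 * eps + (2 * eps)^-1 * err n om))%R).
    apply: le_Rintegral => //; first by apply: integrable_norm; exact: integrable_subr.
    move=> om _; rewrite -mulrBl normrM; apply: le_trans (bound om).
    by rewrite ler_piMr.
  rewrite RintegralD//; last 2 first.
  - exact: finite_measure_integrable_cst.
  - exact: integrable_scale.
  rewrite Rintegral_cst// RintegralZl//.
  have -> : fine (P [set: Om]) = 1 by rewrite probability_setT.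
  have h : (\int[P]_om err n om)%R <= eps ^+ 2.
    move: hn; rewrite unlock /Rintegral => hn; rewrite -lee_fin fineK ?ltW//.
    exact: integrable_fin_num ie.
  have : (2 * eps)^-1 * (\int[P]_om err n om)%R <= (2 * eps)^-1 * eps ^+ 2.
    by rewrite ler_wpM2l// invr_ge0 mulr_ge0// ltW.
  have -> : (2 * eps)^-1 * eps ^+ 2 = 2^-1 * eps by field; rewrite gt_eqF.
  lra.
split; first by have [] := H 1 ltr01.
apply/eqP; rewrite -normr_le0; apply/ler_addgt0Pl => eps e0.
by rewrite addr0; have [] := H eps e0.
Qed.

End MeanSquareLimit.

(** * The noise contribution to the slope has mean zero *)

Section NoiseMean.
Context {R : realType} {d : measure_display} {Om : measurableType d}.
Context (P : probability Om R) (T : R) (F : R -> set (set Om)).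
Context (a b : R) (ab : a < b) (N : nat).
Context (e : nat -> R -> R) (beta : nat -> R -> Om -> R) (G : (R -> R) -> R -> R).
Context (t t' : R) (Z : Om -> R -> R).
Hypothesis hF : filtration T F.
Hypothesis hW : cylindrical_wiener P T F a b e beta.
Hypothesis hG : forall h, trig_space a b N (G h).
Hypotheses (t0 : 0 <= t) (tt' : t < t') (t'T : t' <= T).
Hypothesis hZ : noise_increment P F a b N e beta G t t' Z.
Local Open Scope complex_scope.

Lemma F_measurable_mfun r (f : Om -> R) : 0 <= r <= T -> F_measurable F r f ->
  measurable_fun [set: Om] f.
Proof.
move=> rT hf _ B mB; rewrite setTI; have [_ FM _] := hF.
exact/(FM r rT)/hf.
Qed.

Let tT : 0 <= t <= T. Proof. by rewrite t0 (le_trans (ltW tt')). Qed.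
Let t'T' : 0 <= t' <= T. Proof. by rewrite t'T (le_trans t0) ?ltW. Qed.

Let dB j (om : Om) := beta j t' om - beta j t om.

Let mdB j : measurable_fun [set: Om] (dB j).
Proof.
have [_ _ _ mb _] := hW.
by apply: measurable_funB; [apply: (F_measurable_mfun t'T')|apply: (F_measurable_mfun tT)];
  apply: mb.
Qed.

Let law j E B : F t E -> measurable B ->
  P (E `&` dB j @^-1` B) = (P E * normal_prob 0 (Num.sqrt (t' - t)) B)%E.
Proof.
move=> FE mB; have [_ _ _ _ inc] := hW.
(* The joint law of the first j + 1 increments, with the whole line prescribed for all but the last,
   gives the law of the j-th increment. *)
have := inc t t' E j.+1 (fun i => if i == j then B else [set: R]) t0 tt' t'T FE.
rewrite big_ord_recr /= eqxx big1 ?mul1e; last first.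
  by move=> i _; rewrite ltn_eqF ?ltn_ord// probability_setT.
move=> <-; last by move=> i; case: ifP.
congr (P (_ `&` _)); apply/seteqP; split => om /= h.
  by move=> i; rewrite ltnS leq_eqVlt => /orP[/eqP->|ij]; rewrite ?eqxx ?ltn_eqF.
by have := h j (ltnSn j); rewrite eqxx.
Qed.

Let s0 : 0 < Num.sqrt (t' - t). Proof. by rewrite sqrtr_gt0 subr_gt0. Qed.

Let FtT : F t [set: Om].
Proof.
have [FS _ _] := hF; have [h0 hC _] := FS t tT.
by rewrite -(setD0 [set: Om]); apply: hC.
Qed.

Let FtM : F t `<=` measurable. Proof. by have [_ + _] := hF; apply. Qed.

Let idB j : P.-integrable [set: Om] (EFin \o dB j).
Proof. exact: (increment_integrable FtT s0 (mdB j) (@law j)). Qed.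

(** The affine map (1 + Q)/2 sends [-1, 1] to [0, 1]; the case of the constant 1 removes the
    shift. *)
Lemma increment_bounded j (Q : Om -> R) : F_measurable F t Q ->
  (forall om, `|Q om| <= 1) -> (\int[P]_om (dB j om * Q om))%R = 0.
Proof.
move=> FQ Q1; have mQ := F_measurable_mfun tT FQ.
pose Q' om := 2^-1 * (1 + Q om).
have comp (f : R -> R) : measurable_fun [set: R] f -> F_measurable F t (f \o Q).
  move=> mf B mB; rewrite comp_preimage; apply: FQ.
  by rewrite -[_ @^-1` _]setTI; exact: mf.
have E1 : (\int[P]_om (dB j om * Q' om))%R = 0.
  apply: (increment_unit FtT FtM s0 (mdB j) (@law j)).
    apply: (comp (fun x => 2^-1 * (1 + x))).
    by apply: measurable_funM => //; exact: measurable_funD.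
  by move=> om; have := Q1 om; rewrite ler_norml /Q' => /andP[? ?]; apply/andP; split; lra.
have E2 : (\int[P]_om (dB j om * 1))%R = 0.
  apply: (increment_unit FtT FtM s0 (mdB j) (@law j) (Z := fun=> 1));
    last by rewrite ler01 lexx.
  exact: (comp (fun=> 1)).
have iQ : P.-integrable [set: Om] (EFin \o (fun om => dB j om * Q om)).
  exact: integrable_mul_bounded Q1.
have i1 : P.-integrable [set: Om] (EFin \o (fun om => dB j om * 1)).
  by apply: (@integrable_mul_bounded _ _ _ _ _ _ 1) => // x; rewrite normr1.
have : (\int[P]_om (2^-1 * (dB j om * 1 + dB j om * Q om)))%R = 0.
  by rewrite -E1; apply: eq_Rintegral => om _; rewrite /Q'; ring.
rewrite RintegralZl//; last exact: integrable_addr.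
rewrite RintegralD// E2 add0r => /eqP; rewrite mulf_eq0 invr_eq0 pnatr_eq0 /=.
by move/eqP.
Qed.

Let spaceZ om : trig_space a b N (Z om). Proof. by have [+ _ _] := hZ; apply. Qed.

Let xi (pr : R[i] -> R) k n om := \sum_(j < n) dB j om * pr (fourier a b (G (e j)) k).

Let diff n om x := \sum_(j < n) dB j om * G (e j) x - Z om x.

Let space_diff n om : trig_space a b N (diff n om).
Proof.
rewrite /diff; under eq_fun do rewrite -mulN1r.
exact: (trig_spaceD (trig_space_sum n (dB ^~ om) (fun j => hG (e j)))
  (trig_spaceZ _ (spaceZ om))).
Qed.

Let fourier_diff n om k : fourier a b (diff n om) k =
  \sum_(j < n) (dB j om)%:C * fourier a b (G (e j)) k - fourier a b (Z om) k.
Proof.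
rewrite /diff; under eq_fun do rewrite -mulN1r.
rewrite (fourierD_trig ab k (trig_space_sum n (dB ^~ om) (fun j => hG (e j)))
  (trig_spaceZ _ (spaceZ om))).
have -> : fourier a b (fun x => \sum_(j < n) dB j om * G (e j) x) k =
    \sum_(j < n) (dB j om)%:C * fourier a b (G (e j)) k.
  exact: (fourier_sum_trig ab n (dB ^~ om) k (fun j => hG (e j))).
by rewrite (fourierZ_trig ab _ _ (spaceZ om)) rmorphN1 mulN1r.
Qed.

Let Re_diff n om k : complex.Re (fourier a b (diff n om) k) =
  xi (@complex.Re R) k n om - complex.Re (fourier a b (Z om) k).
Proof.
rewrite fourier_diff -[LHS]/(complex.Re (_ + - _)) raddfB /=.
rewrite Re_sum; congr (_ - _).
by apply: eq_bigr => j _; case: (fourier _ _ _ _) => u v /=; ring.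
Qed.

Let Im_diff n om k : complex.Im (fourier a b (diff n om) k) =
  xi (@complex.Im R) k n om - complex.Im (fourier a b (Z om) k).
Proof.
rewrite fourier_diff -[LHS]/(complex.Im (_ + - _)) raddfB /=.
rewrite Im_sum; congr (_ - _).
by apply: eq_bigr => j _; case: (fourier _ _ _ _) => u v /=; ring.
Qed.

Let mcoef k : measurable_fun [set: Om] (fun om => complex.Re (fourier a b (Z om) k)) /\
  measurable_fun [set: Om] (fun om => complex.Im (fourier a b (Z om) k)).
Proof.
have [_ mz _] := hZ; have [h1 h2] := mz k.
by split; [exact: (F_measurable_mfun t'T' h1)|exact: (F_measurable_mfun t'T' h2)].
Qed.

Let mxi pr k n : measurable_fun [set: Om] (xi pr k n).
Proof. by apply: measurable_sum => j; apply: measurable_funM. Qed.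

Let err n om := sobolev_norm a b 0 (diff n om) ^+ 2.

Let errE n om : err n om = \sum_(k <- zrange N | k != 0)
  ((xi (@complex.Re R) k n om - complex.Re (fourier a b (Z om) k)) ^+ 2 +
   (xi (@complex.Im R) k n om - complex.Im (fourier a b (Z om) k)) ^+ 2).
Proof.
rewrite /err (sobolev_norm_sq ab 0 (space_diff n om)); apply: eq_bigr => k _.
by rewrite /sobolev_weight expr0 mul1r normc_sq Re_diff Im_diff.
Qed.

Let merr n : measurable_fun [set: Om] (err n).
Proof.
have -> : err n = fun om => \sum_(k <- [seq k <- zrange N | k != 0])
  ((xi (@complex.Re R) k n om - complex.Re (fourier a b (Z om) k)) ^+ 2 +
   (xi (@complex.Im R) k n om - complex.Im (fourier a b (Z om) k)) ^+ 2).
  by apply/funext => om; rewrite errE big_filter.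
apply: measurable_sum => k; have [m1 m2] := mcoef k.
by apply: measurable_funD; apply: measurable_funX; apply: measurable_funB => //; exact: mxi.
Qed.

(** A single coefficient of the noise is a mean-square limit of combinations of increments, since
    its squared error is one summand of the squared H^0 error. *)
Lemma noise_coef_mean k (Q : Om -> R) : k != 0 -> (`|k| <= N)%N ->
  F_measurable F t Q -> (forall om, `|Q om| <= 1) ->
  [/\ P.-integrable [set: Om] (EFin \o (fun om => complex.Re (fourier a b (Z om) k))),
      P.-integrable [set: Om] (EFin \o (fun om => complex.Im (fourier a b (Z om) k))),
      (\int[P]_om (complex.Re (fourier a b (Z om) k) * Q om))%R = 0 &
      (\int[P]_om (complex.Im (fourier a b (Z om) k) * Q om))%R = 0].
Proof.
move=> k0 kN FQ Q1; have mQ := F_measurable_mfun tT FQ.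
have [m1 m2] := mcoef k.
have [_ _ cerr] := hZ.
have ixi pr n : P.-integrable [set: Om] (EFin \o xi pr k n).
  apply: integrable_sumr => j; have := integrable_scale (pr (fourier a b (G (e j)) k)) (idB j).
  by apply: eq_integrable => // om _ /=; rewrite mulrC.
have xi0 pr n : (\int[P]_om (xi pr k n om * Q om))%R = 0.
  have ij (j : 'I_n) : P.-integrable [set: Om] (EFin \o (fun om => dB j om * Q om)).
    exact: integrable_mul_bounded Q1.
  transitivity (\int[P]_om (\sum_(j < n) pr (fourier a b (G (e j)) k) * (dB j om * Q om)))%R.
    by apply: eq_Rintegral => om _; rewrite mulr_suml; apply: eq_bigr => j _; ring.
  rewrite Rintegral_sumr; last by move=> j; exact: integrable_scale.
  by rewrite big1// => j _; rewrite RintegralZl// increment_bounded// mulr0.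
have le n om : (xi (@complex.Re R) k n om - complex.Re (fourier a b (Z om) k)) ^+ 2 +
   (xi (@complex.Im R) k n om - complex.Im (fourier a b (Z om) k)) ^+ 2 <= err n om.
  have kf : k \in [seq k <- zrange N | k != 0] by rewrite mem_filter k0 mem_zrange.
  rewrite errE -big_filter (bigD1_seq k kf) ?filter_uniq ?zrange_uniq//= lerDl.
  by apply: sumr_ge0 => l _; rewrite addr_ge0 ?sqr_ge0.
have [|iRe Re0] := @mean_square_limit _ _ _ P _ Q (xi (@complex.Re R) k) err m1 mQ Q1
  (ixi _) (xi0 _) _ merr cerr.
  by move=> n om; apply: le_trans (le n om); rewrite lerDl sqr_ge0.
have [|iIm Im0] := @mean_square_limit _ _ _ P _ Q (xi (@complex.Im R) k) err m2 mQ Q1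
  (ixi _) (xi0 _) _ merr cerr.
  by move=> n om; apply: le_trans (le n om); rewrite lerDr sqr_ge0.
by split.
Qed.

Lemma F_measurable_comp r (f : R -> R) (Q : Om -> R) : measurable_fun [set: R] f ->
  F_measurable F r Q -> F_measurable F r (f \o Q).
Proof.
move=> mf FQ B mB; rewrite comp_preimage; apply: FQ.
by rewrite -[_ @^-1` _]setTI; exact: mf.
Qed.

(** Evaluation at a random point separates: each coefficient of [Z] is multiplied by a sine or
    cosine of [X], a bounded factor known at time t. Hence it suffices to treat coefficients one at
    a time. *)
Lemma noise_slope_mean (X : Om -> R) : F_measurable F t X ->
  P.-integrable [set: Om] (EFin \o (fun om => derive1 (Z om) (X om))) /\
  (\int[P]_om derive1 (Z om) (X om))%R = 0.
Proof.
move=> FX.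
pose S k (x : R) := - sin (mode_angle a b k x); pose C k (x : R) := - cos (mode_angle a b k x).
have mS k : measurable_fun [set: R] (S k).
  apply: measurableT_comp => //; apply: continuous_measurable_fun => x.
  apply: (continuous_comp (f := mode_angle a b k)); last exact: continuous_sin.
  by apply: cvgM; [exact: cvg_cst|apply: cvgB; [exact: cvg_id|exact: cvg_cst]].
have mC k : measurable_fun [set: R] (C k).
  apply: measurableT_comp => //; apply: continuous_measurable_fun => x.
  apply: (continuous_comp (f := mode_angle a b k)); last exact: continuous_cos.
  by apply: cvgM; [exact: cvg_cst|apply: cvgB; [exact: cvg_id|exact: cvg_cst]].
have S1 k x : `|S k x| <= 1 by rewrite normrN ler_norml sin_geN1 sin_le1.
have C1 k x : `|C k x| <= 1 by rewrite normrN ler_norml cos_geN1 cos_le1.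
pose g k om := k%:~R * wavenumber a b *
  (complex.Re (fourier a b (Z om) k) * (S k \o X) om +
   complex.Im (fourier a b (Z om) k) * (C k \o X) om).
have E om : derive1 (Z om) (X om) = \sum_(k <- [seq k <- zrange N | k != 0]) g k om.
  by rewrite (derive1_trig ab (X om) (spaceZ om)) big_filter.
have H k : k \in [seq k <- zrange N | k != 0] ->
    P.-integrable [set: Om] (EFin \o g k) /\ (\int[P]_om g k om)%R = 0.
  rewrite mem_filter mem_zrange => /andP[k0 kN].
  have FS := F_measurable_comp (mS k) FX; have FC := F_measurable_comp (mC k) FX.
  have [iRe iIm ReS _] := noise_coef_mean k0 kN FS (fun om => S1 k (X om)).
  have [_ _ _ ImC] := noise_coef_mean k0 kN FC (fun om => C1 k (X om)).
  have i1 : P.-integrable [set: Om] (EFin \o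
      (fun om => complex.Re (fourier a b (Z om) k) * (S k \o X) om)).
    apply: (integrable_mul_bounded iRe); first exact: F_measurable_mfun FS.
    by move=> om; exact: S1.
  have i2 : P.-integrable [set: Om] (EFin \o
      (fun om => complex.Im (fourier a b (Z om) k) * (C k \o X) om)).
    apply: (integrable_mul_bounded iIm); first exact: F_measurable_mfun FC.
    by move=> om; exact: C1.
  split; first by apply: integrable_scale; exact: integrable_addr.
  by rewrite RintegralZl ?RintegralD ?ReS ?ImC ?addr0 ?mulr0//; exact: integrable_addr.
move: E H; move: [seq k <- zrange N | k != 0] => r E H.
have {E} -> : (fun om => derive1 (Z om) (X om)) = fun om => \sum_(k <- r) g k om.
  by apply/funext => om; rewrite E.
elim: r H => [|k r IH] H.
  split.
    apply: (@integrable_bounded _ _ _ _ _ 0) => [|x]; last by rewrite big_nil normr0.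
    by under eq_fun do rewrite big_nil; exact: measurable_cst.
  by under eq_Rintegral do rewrite big_nil; rewrite Rintegral_cst// mul0r.
have [ik k0] := H k (mem_head _ _).
have [ir r0] := IH (fun l lr => H l (mem_behead (s := k :: r) lr)).
split.
  by under [X in EFin \o X]eq_fun do rewrite big_cons; exact: integrable_addr.
under eq_Rintegral do rewrite big_cons.
by rewrite RintegralD// k0 r0 addr0.
Qed.

End NoiseMean.

(** * Expectations *)

Section AlmostEverywhere.
Context {R : realType} {d : measure_display} {Om : measurableType d}.
Context (P : probability Om R).
Import HBNNSimple.

(* The integral of a nonnegative function is a supremum over simple functions,
   so no measurability is needed here: restrict each simple function to the
   measurable set where the two functions agree. *)
Lemma ge0_ae_le_integral (f g : Om -> \bar R) :
  (forall x, (0 <= f x)%E) -> (forall x, (0 <= g x)%E) ->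
  {ae P, forall x, f x = g x} -> (\int[P]_x f x <= \int[P]_x g x)%E.
Proof.
move=> f0 g0 [N [mN N0 sN]].
have mA : measurable (~` N) by exact: measurableC.
rewrite ge0_integralTE// [leRHS]ge0_integralTE//.
apply: ge_ereal_sup => _ [phi /= phif <-].
have E : sintegral P phi = sintegral P (proj_nnsfun phi mA).
  rewrite -2!integralT_nnsfun; apply: ge0_ae_eq_integral => //.
  - exact/measurable_EFinP.
  - exact/measurable_EFinP.
  - by move=> x _; rewrite lee_fin.
  - by move=> x _; rewrite lee_fin.
  exists N; split => // x /= /not_implyP[_]; apply: contra_notP => xN.
  by rewrite /= mindicE mem_set// mulr1.
rewrite E; apply: ereal_sup_ubound; exists (proj_nnsfun phi mA) => //= x.
rewrite mindicE; case: (boolP (x \in _)) => xA; last by rewrite mulr0.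
rewrite mulr1; apply: le_trans (phif x) _.
suff -> : f x = g x by [].
apply: contrapT => fg; move: xA; rewrite inE => /=; apply; exact: sN.
Qed.

Lemma ge0_ae_integral_eq (f g : Om -> \bar R) :
  (forall x, (0 <= f x)%E) -> (forall x, (0 <= g x)%E) ->
  {ae P, forall x, f x = g x} -> (\int[P]_x f x = \int[P]_x g x)%E.
Proof.
move=> f0 g0 fg; apply/eqP; rewrite eq_le !ge0_ae_le_integral//.
by apply: filterS fg => x ->.
Qed.

Lemma ae_le_Rintegral (f g : Om -> R) :
  P.-integrable [set: Om] (EFin \o f) -> P.-integrable [set: Om] (EFin \o g) ->
  {ae P, forall x, f x <= g x} -> (\int[P]_x f x <= \int[P]_x g x)%R.
Proof.
move=> fi gi fg; rewrite -subr_ge0 -RintegralB//.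
have mh : measurable_fun [set: Om] (fun x => g x - f x).
  exact: (measurable_int_fin (integrable_subr gi fi)).
have -> : (\int[P]_x (g x - f x))%R = (\int[P]_x (Num.max (g x - f x) 0))%R.
  rewrite /Rintegral; congr fine; apply: ae_eq_integral => //.
  - exact/measurable_EFinP.
  - by apply/measurable_EFinP; apply: measurable_maxr => //; exact: measurable_cst.
  apply: filterS fg => x h _; rewrite max_l// subr_ge0//.
by apply: Rintegral_ge0 => x _; rewrite le_max lexx orbT.
Qed.

Lemma sqr_Rintegral_le (f : Om -> R) :
  P.-integrable [set: Om] (EFin \o f) ->
  P.-integrable [set: Om] (EFin \o (fun x => f x ^+ 2)) ->
  (\int[P]_x f x)%R ^+ 2 <= (\int[P]_x (f x ^+ 2))%R.
Proof.
move=> fi f2i; set m := (\int[P]_x f x)%R.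
have ic (c : R) : P.-integrable [set: Om] (EFin \o cst c).
  exact: finite_measure_integrable_cst.
have : 0 <= (\int[P]_x (f x ^+ 2 - ((2 * m) * f x - m ^+ 2)))%R.
  apply: Rintegral_ge0 => x _.
  by rewrite [leRHS](_ : _ = (f x - m) ^+ 2) ?sqr_ge0//; ring.
rewrite RintegralB//; last first.
  exact: (integrable_subr (integrable_scale (2 * m) fi) (ic (m ^+ 2))).
rewrite RintegralB//; [|exact: integrable_scale|exact: (ic (m ^+ 2))].
rewrite RintegralZl// Rintegral_cst// -/m.
have -> : fine (P [set: Om]) = 1 by rewrite probability_setT.
by lra.
Qed.

End AlmostEverywhere.

(** * The one-step bound along a path of the scheme *)

Section PathwiseStep.
Context {R : realType}.
Context (a b : R) (ab : a < b) (C0 : R) (hC0 : is_embedding_norm a b C0).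
Context (N s : nat) (N0 : (0 < N)%N) (A : 'M[R]_s) (w : 'I_s -> R) (tau : R).
Hypotheses (tau0 : 0 <= tau) (w0 : forall i, 0 <= w i) (w1 : \sum_i w i = 1).
Local Notation tev := (trig_eval a b).
Local Notation tD := (trig_deriv a b).
Local Notation twaves := (trig_coefs a b).
Local Notation c := (cbound a b).
Local Notation Hn r := (sobolev_norm a b r).

(** The remainder of [one_step_bound] with al = c S, be = c N^(1/2) S and de = c N^(-1/2) S, where S
    bounds all H^3 norms of the step. *)
Definition step_error (S : R) : R :=
  tau * ((c * S) ^+ 2 * (c * Num.sqrt N%:R * S)) * (4 + 11 * mxabs A)
  + 7 * ((c * S) * (c / Num.sqrt N%:R * S)).

(** Subtracting the slope of [z] leaves the noise-free update, to which the deterministic expansion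
    applies; the embedding constant then bounds the squares of the stages at x'. *)
Lemma pathwise_step (u u' z : R -> R) (v : 'I_s -> R -> R) (x x' S : R)
    (xs : 'I_s -> R) :
  trig_space a b N u -> trig_space a b N z ->
  velocity_step a b N A w tau u v z u' -> char_step A w tau v x xs x' ->
  Hn 3 u <= S -> (forall i, Hn 3 (v i) <= S) ->
  let Y := derive1 u x in let D := derive1 u' x' - derive1 z x' in
  `|D - Y| <= 6 * tau * (c * S) ^+ 2 /\
  D - Y <= tau * (- 2^-1 * Y ^+ 2
    + C0 ^+ 2 * (\sum_i w i * Hn 1 (v i) ^+ 2) + step_error S).
Proof.
move=> hu hz [[[hv vst] _] u'E] [[xst _] x'E] uS vS Y D.
have c0 : 0 <= c by exact: le_trans (cbound_ge1 ab).
have S0 : 0 <= S by exact: le_trans (sobolev_norm_ge0 _ _ _ _) uS.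
have sN1 : 1 <= Num.sqrt N%:R :> R by rewrite -[leLHS]sqrtr1 ler_wsqrtr ?ler1n.
pose p := twaves N u; pose q i := twaves N (v i).
have uE : u = tev p by exact: trig_space_tev.
have vE i : v i = tev (q i) by exact: trig_space_tev.
have zE : z = tev (twaves N z) by exact: trig_space_tev.
have dE i : drift a b N (v i) = tev (trig_drift a b N (q i)) by rewrite {1}vE drift_tev.
have DE : D = tev (tD p) x' + tau * \sum_i w i * tev (tD (trig_drift a b N (q i))) x'.
  pose r := p ++ \big[cat/[::]]_(i < s) tmult (fun=> tau * w i) (trig_drift a b N (q i)).
  have u'r : u' = tev (r ++ twaves N z).
    apply/funext => y; rewrite u'E !tev_cat tev_big -zE; congr (_ + _).
    rewrite {1}uE mulr_sumr; congr (_ + _); apply: eq_bigr => i _.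
    by rewrite tev_mult_cst dE mulrA.
  rewrite /D u'r {2}zE !derive1_tev tD_cat tev_cat addrK /r tD_cat tev_cat tD_big tev_big.
  congr (_ + _); rewrite mulr_sumr; apply: eq_bigr => i _.
  by rewrite -tmult_tD tev_mult_cst mulrA.
have YE : Y = tev (tD p) x by rewrite /Y {1}uE derive1_tev.
have le_al f : trig_space a b N f -> Hn 3 f <= S ->
    wn (freq_weight a b 2) (twaves N f) <= c * S.
  by move=> hf fS; apply: le_trans (wn_wgt2 ab hf) _; rewrite ler_wpM2l.
have le_be f : trig_space a b N f -> Hn 3 f <= S ->
    wn (freq_weight a b 3) (twaves N f) <= c * Num.sqrt N%:R * S.
  move=> hf fS; apply: le_trans (wn_wgt3 ab hf) _; apply: ler_wpM2l => //.
  by apply: mulr_ge0 => //; exact: sqrtr_ge0.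
have le_de f : trig_space a b N f -> Hn 3 f <= S ->
    wn (tail_weight a b 2 N 2) (twaves N f) <= c / Num.sqrt N%:R * S.
  move=> hf fS; apply: le_trans (wn_wcut ab N0 hf) _; apply: ler_wpM2l => //.
  by apply: divr_ge0 => //; exact: sqrtr_ge0.
have albe : c * S <= c * Num.sqrt N%:R * S by rewrite mulrAC ler_peMr// mulr_ge0.
have stages i y : tev (q i) y =
    tev p y + tau * \sum_(j < s) A i j * tev (trig_drift a b N (q j)) y.
  by rewrite -vE vst -uE; congr (_ + _ * _); apply: eq_bigr => j _; rewrite dE.
have charst i : xs i = x + tau * \sum_(j < s) A i j * tev (q j) (xs j).
  by rewrite xst; congr (_ + _ * _); apply: eq_bigr => j _; rewrite {1}vE.
have charstep : x' = x + tau * \sum_(i < s) w i * tev (q i) (xs i).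
  by rewrite x'E; congr (_ + _ * _); apply: eq_bigr => j _; rewrite {1}vE.
have pal := le_al _ hu uS; have pbe := le_be _ hu uS.
have qal i := le_al _ (hv i) (vS i); have qbe i := le_be _ (hv i) (vS i).
have qde i := le_de _ (hv i) (vS i).
rewrite DE YE; split; first exact: (one_step_abs _ tau0 w0 w1 pal qal charstep).
have := one_step_bound ab tau0 w0 w1 pal pbe albe qal qbe qde stages charst charstep.
move=> /le_trans; apply.
rewrite ler_wpM2l// lerD2r lerD2l mulr_sumr; apply: ler_sum => i _.
rewrite [leRHS]mulrCA ler_wpM2l// -exprMn -vE -real_normK ?num_real//.
have := trig_le_H1 ab x' hC0 (hv i).
move=> h; rewrite ler_sqr ?nnegrE//; exact: le_trans h.
Qed.

End PathwiseStep.

(** Brings all lower powers to the fourth moment without Hoelder's inequality, at the price of the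
    summand 1. *)
Lemma le1_exp4 {R : realDomainType} (x : R) n : (n <= 4)%N -> 0 <= x -> x ^+ n <= 1 + x ^+ 4.
Proof.
move=> n4 x0; have [x1|x1] := leP x 1.
  by apply: (@le_trans _ _ 1); rewrite ?exprn_ile1// lerDl exprn_ge0.
apply: (@le_trans _ _ (x ^+ 4)); last by rewrite lerDr.
by rewrite ler_weXn2l// ltW.
Qed.

Lemma sum1_ord_gt0 {R : nzRingType} s (w : 'I_s -> R) : \sum_i w i = 1 -> (0 < s)%N.
Proof. by case: s w => // w; rewrite big_ord0 => /esym/eqP; rewrite oner_eq0. Qed.

Lemma measurable_sob_sum {R : realType} {d : measure_display} {Om : measurableType d}
    (a b : R) r N (V : Om -> R -> R) :
  (forall k, measurable_fun [set: Om] (fun om => complex.Re (fourier a b (V om) k)) /\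
             measurable_fun [set: Om] (fun om => complex.Im (fourier a b (V om) k))) ->
  measurable_fun [set: Om] (fun om => sob_sum a b r N (V om)).
Proof.
move=> mV.
have -> : (fun om => sob_sum a b r N (V om)) = fun om =>
    \sum_(k <- [seq k <- zrange N | k != 0]) sobolev_weight a b r k *
      (complex.Re (fourier a b (V om) k) ^+ 2 + complex.Im (fourier a b (V om) k) ^+ 2).
  by apply/funext => om; rewrite big_filter; apply: eq_bigr => k _; rewrite normc_sq.
apply: measurable_sum => k; have [m1 m2] := mV k.
by apply: measurable_funM => //; apply: measurable_funD; apply: measurable_funX.
Qed.

Section Moments.
Context {R : realType} {d : measure_display} {Om : measurableType d}.
Context (P : probability Om R).

Lemma measurable_derive1_trig (a b : R) (ab : a < b) N (V : Om -> R -> R) (X : Om -> R) :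
  (forall om, trig_space a b N (V om)) ->
  (forall k, measurable_fun [set: Om] (fun om => complex.Re (fourier a b (V om) k)) /\
             measurable_fun [set: Om] (fun om => complex.Im (fourier a b (V om) k))) ->
  measurable_fun [set: Om] X ->
  measurable_fun [set: Om] (fun om => derive1 (V om) (X om)).
Proof.
move=> hV mV mX.
have -> : (fun om => derive1 (V om) (X om)) = fun om =>
  \sum_(k <- [seq k <- zrange N | k != 0])
    (k%:~R * wavenumber a b) *
      (complex.Re (fourier a b (V om) k) * - sin (mode_angle a b k (X om))
       + complex.Im (fourier a b (V om) k) * - cos (mode_angle a b k (X om))).
  by apply/funext => om; rewrite (derive1_trig ab (X om) (hV om)) big_filter.
apply: measurable_sum => k; have [m1 m2] := mV k.
have mang : measurable_fun [set: Om] (fun om => mode_angle a b k (X om)).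
  by apply: measurable_funM => //; exact: measurable_funB.
apply: measurable_funM => //; apply: measurable_funD; apply: measurable_funM => //;
  apply: measurableT_comp => //; apply: measurableT_comp => //; apply: continuous_measurable_fun.
  exact: continuous_sin.
exact: continuous_cos.
Qed.

Lemma moment_le (f : Om -> R) (M : R) : measurable_fun [set: Om] f -> (forall x, 0 <= f x) ->
  (\int[P]_x (f x)%:E <= M%:E)%E ->
  P.-integrable [set: Om] (EFin \o f) /\ (\int[P]_x f x)%R <= M.
Proof.
move=> mf f0 fM.
have fi : P.-integrable [set: Om] (EFin \o f).
  apply/integrableP; split; first exact/measurable_EFinP.
  under eq_integral do rewrite /= ger0_norm//.
  exact: le_lt_trans fM (ltry _).
by split=> //; rewrite /Rintegral -lee_fin fineK//; exact: integrable_fin_num fi.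
Qed.

End Moments.

(** * Taking expectations of the one-step bound *)

Section StepExpectation.
Context {R : realType} (a b T M C0 : R) (s : nat) (A : 'M[R]_s) (w : 'I_s -> R).
Hypotheses (ab : a < b) (hT : 0 < T) (w1 : \sum_(i < s) w i = 1) (w0 : forall i, 0 <= w i)
  (hC0 : is_embedding_norm a b C0).
Context {d : measure_display} {Om : measurableType d} (P : probability Om R)
  (F : R -> set (set Om)) (e : nat -> R -> R) (beta : nat -> R -> Om -> R)
  (Phi : (R -> R) -> R -> R) (u0 : R -> R) (x0 : R) (N Nt : nat)
  (U : nat -> Om -> R -> R) (Ust : nat -> 'I_s -> Om -> R -> R)
  (dM : nat -> Om -> R -> R) (X : nat -> Om -> R) (Xst : nat -> 'I_s -> Om -> R).
Hypotheses (N0 : (0 < N)%N) (Nt0 : (0 < Nt)%N) (hF : filtration T F)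
  (hW : cylindrical_wiener P T F a b e beta)
  (hdm : discrete_method P T F a b N Nt A w e beta Phi u0 x0 U Ust dM X Xst)
  (hreg : uniform_regularity P a b Nt U Ust M).

Local Notation tau := (T / Nt%:R).
Local Notation y := (mean_slope P U X).
Local Notation c := (cbound a b).
Local Notation Hn r := (sobolev_norm a b r).

Lemma step_time k : (k <= Nt)%N -> 0 <= k%:R * tau <= T.
Proof.
have NtR : 0 < Nt%:R :> R by rewrite ltr0n.
move=> kN; rewrite mulr_ge0 ?divr_ge0 ?ler0n ?(ltW hT)//= mulrA ler_pdivrMr//.
by rewrite mulrC ler_pM2l// ler_nat.
Qed.

Let tau_gt0 : 0 < tau. Proof. by rewrite divr_gt0// ltr0n. Qed.

Let s_gt0 : (0 < s)%N. Proof. exact: sum1_ord_gt0 w1. Qed.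

Lemma regularity_moments :
  (forall k, (k <= Nt)%N -> ('E_P[fun om => (Hn 3 (U k om) ^+ 4)%R] <= M%:E)%E) /\
  (forall k i, (k < Nt)%N -> ('E_P[fun om => (Hn 3 (Ust k i om) ^+ 4)%R] <= M%:E)%E).
Proof.
move: hreg; rewrite /uniform_regularity.
set S1 := ereal_sup _; set S2 := ereal_sup _ => S12.
have E0 (f : Om -> R) : (forall om, 0 <= f om) -> (0 <= 'E_P[f])%E.
  exact: expectation_ge0.
have P1 k : (k <= Nt)%N -> ('E_P[fun om => (Hn 3 (U k om) ^+ 4)%R] <= S1)%E.
  by move=> kN; apply: ereal_sup_ubound; exists k.
have P2 k i : (k < Nt)%N -> ('E_P[fun om => (Hn 3 (Ust k i om) ^+ 4)%R] <= S2)%E.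
  move=> kN; pose Sk := ereal_sup [set
    'E_P[fun om => (Hn 3 (Ust k i om) ^+ 4)%R]%E | i in [set: 'I_s]].
  apply: (@le_trans _ _ Sk); first by apply: ereal_sup_ubound; exists i.
  by apply: ereal_sup_ubound; exists k.
(* Each supremum in (R) is bounded by M because the other is nonnegative. An empty supremum would be
   -oo; the time index 0 and a first stage, which exists as the weights sum to 1, exclude this. *)
have S10 : (0 <= S1)%E.
  by apply: le_trans (P1 0%N isT); apply: E0 => om; rewrite exprn_ge0// sobolev_norm_ge0.
have S20 : (0 <= S2)%E.
  apply: le_trans (P2 0%N (Ordinal s_gt0) Nt0).
  by apply: E0 => om; rewrite exprn_ge0// sobolev_norm_ge0.
split => [k kN|k i kN].
  by apply: le_trans (P1 k kN) _; apply: le_trans S12; rewrite leeDl.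
by apply: le_trans (P2 k i kN) _; apply: le_trans S12; rewrite leeDr.
Qed.

Let mcoefU k : (k <= Nt)%N -> forall l,
  measurable_fun [set: Om] (fun om => complex.Re (fourier a b (U k om) l)) /\
  measurable_fun [set: Om] (fun om => complex.Im (fourier a b (U k om) l)).
Proof.
move=> kN l; have [h1 h2] := dm_meas_U hdm kN l; have kT := step_time kN.
by split; [exact: (F_measurable_mfun hF kT h1)|exact: (F_measurable_mfun hF kT h2)].
Qed.

Let mcoefUst k i : (k < Nt)%N -> forall l,
  measurable_fun [set: Om] (fun om => complex.Re (fourier a b (Ust k i om) l)) /\
  measurable_fun [set: Om] (fun om => complex.Im (fourier a b (Ust k i om) l)).
Proof.
move=> kN l; have [h1 h2] := dm_meas_Ust hdm i kN l; have kT := step_time (ltnW kN).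
by split; [exact: (F_measurable_mfun hF kT h1)|exact: (F_measurable_mfun hF kT h2)].
Qed.

Let FX k : (k < Nt)%N -> F_measurable F (k%:R * tau) (X k.+1).
Proof. exact: (dm_meas_X hdm). Qed.

Let mX k : (k <= Nt)%N -> measurable_fun [set: Om] (X k).
Proof.
case: k => [_|k kN].
  have -> : X 0%N = cst x0 by apply/funext => om; exact: (dm_init_X hdm).
  exact: measurable_cst.
exact: (F_measurable_mfun hF (step_time (ltnW kN)) (FX kN)).
Qed.

Let Y k om : R := derive1 (U k om) (X k om).

Let mY k : (k <= Nt)%N -> measurable_fun [set: Om] (Y k).
Proof.
move=> kN; apply: (measurable_derive1_trig ab (N := N)).
- by move=> om; exact: (dm_space hdm).
- exact: mcoefU.
- exact: mX.
Qed.

Let SU k om := Hn 3 (U k om).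

Let SU0 k om : 0 <= SU k om. Proof. exact: sobolev_norm_ge0. Qed.

Let mSU k : (k <= Nt)%N -> measurable_fun [set: Om] (SU k).
Proof.
move=> kN; have -> : SU k = Num.sqrt \o (fun om => sob_sum a b 3 N (U k om)).
  by apply/funext => om; rewrite /SU (sobolev_norm_trig ab 3 (dm_space hdm om kN)).
apply: measurableT_comp; last exact/measurable_sob_sum/mcoefU.
by apply: continuous_measurable_fun; exact: sqrt_continuous.
Qed.

Let SU4 k : (k <= Nt)%N ->
  P.-integrable [set: Om] (EFin \o (fun om => SU k om ^+ 4)) /\
  (\int[P]_om (SU k om ^+ 4))%R <= M.
Proof.
move=> kN; apply: moment_le; first by apply: measurable_funX; exact: mSU.
  by move=> om; rewrite exprn_ge0.
by have := regularity_moments.1 k kN; rewrite unlock.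
Qed.

Let Yle k om : (k <= Nt)%N -> `|Y k om| <= c * SU k om.
Proof.
move=> kN; have hU := dm_space hdm om kN.
rewrite /Y {1}(trig_space_tev ab hU) derive1_tev.
apply: le_trans (tev_le_wgt _ _ 1 _ _) _; apply: le_trans (wn_wgt_D _ _ _ _) _.
exact: wn_wgt2.
Qed.

Let c_ge1 : 1 <= c. Proof. exact: cbound_ge1. Qed.
Let c0 : 0 <= c. Proof. exact: le_trans c_ge1. Qed.

Let iY k : (k <= Nt)%N -> P.-integrable [set: Om] (EFin \o Y k).
Proof.
move=> kN; have [i4 _] := SU4 kN.
apply: (@integrable_le _ _ _ P _ (fun om => c * (1 + SU k om ^+ 4))).
- exact: mY.
- apply: integrable_scale; apply: (@integrable_addr _ _ _ _ (cst 1)) => //.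
  exact: finite_measure_integrable_cst.
- move=> om; apply: le_trans (Yle om kN) _; rewrite ler_wpM2l//.
  by have := @le1_exp4 _ (SU k om) 1 isT (SU0 k om); rewrite expr1.
Qed.

(** Bounds the mean of 1 plus the fourth powers of the H^3 norms of U^k and of its s stages. *)
Definition moment_bound : R := 1 + (1 + s%:R) * M.

Lemma mean_slope_bound k : (k <= Nt)%N -> `|y k| <= c * moment_bound.
Proof.
move=> kN; have [i4 h4] := SU4 kN.
have M0 : 0 <= M by apply: le_trans h4; apply: Rintegral_ge0 => om _; rewrite exprn_ge0.
have i1 : P.-integrable [set: Om] (EFin \o (fun om => 1 + SU k om ^+ 4)).
  by apply: (@integrable_addr _ _ _ _ (cst 1)) => //; exact: finite_measure_integrable_cst.
rewrite /mean_slope unlock -/(Rintegral P [set: Om] (Y k)).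
apply: (le_trans (le_normr_Rintegral _ _)) => //; first exact: iY.
apply: (@le_trans _ _ (\int[P]_om (c * (1 + SU k om ^+ 4)))%R).
  apply: le_Rintegral => //; first by apply: integrable_norm; exact: iY.
    exact: integrable_scale.
  move=> om _; apply: le_trans (Yle om kN) _; rewrite ler_wpM2l//.
  by have := @le1_exp4 _ (SU k om) 1 isT (SU0 k om); rewrite expr1.
rewrite RintegralZl// ler_wpM2l// RintegralD//; last exact: finite_measure_integrable_cst.
rewrite Rintegral_cst//; have -> : fine (P [set: Om]) = 1 by rewrite probability_setT.
rewrite mul1r /moment_bound mulrDl mul1r lerD2l; apply: le_trans h4 _.
by rewrite lerDl mulr_ge0.
Qed.


(** The stages lie in S_N only almost surely. This finite sum is measurable for every outcome and
    agrees with the Sobolev norm almost surely. *)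
Definition stage_norm r k i om : R := Num.sqrt (sob_sum a b r N (Ust k i om)).

Let stage_norm_ge0 r k i om : 0 <= stage_norm r k i om. Proof. exact: sqrtr_ge0. Qed.

Let mstage_norm r k i : (k < Nt)%N -> measurable_fun [set: Om] (stage_norm r k i).
Proof.
move=> kN.
have -> : stage_norm r k i = Num.sqrt \o (fun om => sob_sum a b r N (Ust k i om)) by [].
apply: measurableT_comp; last exact/measurable_sob_sum/mcoefUst.
by apply: continuous_measurable_fun; exact: sqrt_continuous.
Qed.

Let ae_stages k : (k < Nt)%N -> {ae P, forall om, forall i, trig_space a b N (Ust k i om)}.
Proof.
move=> kN; apply: filterS (dm_velocity hdm kN) => om [[[+ _] _] _] i.
exact.
Qed.

Let stage_normE r k i om : trig_space a b N (Ust k i om) ->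
  Hn r (Ust k i om) = stage_norm r k i om.
Proof. by move=> h; rewrite /stage_norm (sobolev_norm_trig ab r h). Qed.

Let stage_expectation r n k i : (k < Nt)%N ->
  'E_P[fun om => (Hn r (Ust k i om) ^+ n)%R]%E = (\int[P]_om (stage_norm r k i om ^+ n)%:E)%E.
Proof.
move=> kN; rewrite unlock; apply: ge0_ae_integral_eq.
- by move=> om; rewrite lee_fin exprn_ge0// sobolev_norm_ge0.
- by move=> om; rewrite lee_fin exprn_ge0.
- by apply: filterS (ae_stages kN) => om h; rewrite (stage_normE r (h i)).
Qed.

Let stage4 k i : (k < Nt)%N ->
  P.-integrable [set: Om] (EFin \o (fun om => stage_norm 3 k i om ^+ 4)) /\
  (\int[P]_om (stage_norm 3 k i om ^+ 4))%R <= M.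
Proof.
move=> kN; apply: moment_le; first by apply: measurable_funX; exact: mstage_norm.
  by move=> om; rewrite exprn_ge0.
by have := regularity_moments.2 k i kN; rewrite stage_expectation.
Qed.

Let int_cst (z : R) : P.-integrable [set: Om] (EFin \o cst z).
Proof. exact: finite_measure_integrable_cst. Qed.

Let Rint_1D f : P.-integrable [set: Om] (EFin \o f) ->
  P.-integrable [set: Om] (EFin \o (fun om => 1 + f om)) /\
  (\int[P]_om (1 + f om))%R = 1 + (\int[P]_om f om)%R.
Proof.
move=> fi; split; first exact: (integrable_addr (int_cst 1) fi).
rewrite RintegralD//; last exact: int_cst.
by rewrite Rintegral_cst// (_ : fine (P [set: Om]) = 1) ?mul1r// probability_setT.
Qed.

Let stage_norm_mono k i om : stage_norm 1 k i om <= stage_norm 3 k i om.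
Proof.
rewrite ler_wsqrtr// /sob_sum; apply: ler_sum => l _; rewrite ler_wpM2r ?sqr_ge0//.
by rewrite /sobolev_weight ler_weXn2l// lerDl exprn_ge0.
Qed.

Let stage2 k i : (k < Nt)%N ->
  P.-integrable [set: Om] (EFin \o (fun om => stage_norm 1 k i om ^+ 2)) /\
  (\int[P]_om (stage_norm 1 k i om ^+ 2))%R <= 1 + M.
Proof.
move=> kN; have [i4 h4] := stage4 i kN; have [i14 E14] := Rint_1D i4.
have le om : stage_norm 1 k i om ^+ 2 <= 1 + stage_norm 3 k i om ^+ 4.
  apply: le_trans (le1_exp4 (isT : (2 <= 4)%N) (stage_norm_ge0 3 k i om)).
  by rewrite ler_sqr ?nnegrE.
have i2 : P.-integrable [set: Om] (EFin \o (fun om => stage_norm 1 k i om ^+ 2)).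
  apply: integrable_le i14 _; first by apply: measurable_funX; exact: mstage_norm.
  by move=> om; rewrite ger0_norm ?sqr_ge0.
split=> //; apply: (@le_trans _ _ (1 + (\int[P]_om (stage_norm 3 k i om ^+ 4))%R)).
  by rewrite -E14; apply: le_Rintegral.
by rewrite lerD2l.
Qed.

Lemma stage_constant_ge k : (k < Nt)%N ->
  C0 ^+ 2 * \sum_(i < s) w i * (\int[P]_om (stage_norm 1 k i om ^+ 2))%R <=
  2^-1 * stage_constant P a b C0 Nt w Ust.
Proof.
move=> kN; rewrite /stage_constant mulrA mulrA mulVf// mul1r ler_wpM2l ?sqr_ge0//.
have E l : (l < Nt)%N -> \sum_(i < s) w i *
    fine 'E_P[fun om => (Hn 1 (Ust l i om) ^+ 2)%R]%E =
    \sum_(i < s) w i * (\int[P]_om (stage_norm 1 l i om ^+ 2))%R.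
  by move=> lN; apply: eq_bigr => i _; rewrite stage_expectation.
apply: ub_le_sup; last by exists k => //; rewrite E.
(* A real [sup] dominates its set only if the set is bounded; here x^2 <= 1 + x^4 and averaging with
   the weights give the bound. *)
exists (1 + M) => _ [l lN <-]; rewrite E//.
apply: (@le_trans _ _ (\sum_i w i * (1 + M))).
  by apply: ler_sum => i _; rewrite ler_wpM2l//; have [] := stage2 i lN.
by rewrite -mulr_suml w1 mul1r.
Qed.

Lemma stage_constant_ge0 : 0 <= stage_constant P a b C0 Nt w Ust.
Proof.
rewrite -(pmulr_rge0 _ (_ : 0 < 2^-1 :> R))//; apply: le_trans (stage_constant_ge Nt0).
rewrite mulr_ge0 ?sqr_ge0//; apply: sumr_ge0 => i _; rewrite mulr_ge0//.
by apply: Rintegral_ge0 => om _; rewrite sqr_ge0.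
Qed.

Section OneTimeStep.
Context (k : nat) (kN : (k < Nt)%N).

(** Its fourth root [S] dominates the H^3 norms of U^k and of all stages, while the fourth power of
    [S] is a plain sum and thus integrable. *)
Let S4 om := SU k om ^+ 4 + \sum_(i < s) stage_norm 3 k i om ^+ 4.
Let S om := Num.sqrt (Num.sqrt (S4 om)).

Let S40 om : 0 <= S4 om.
Proof. by rewrite addr_ge0 ?exprn_ge0//; apply: sumr_ge0 => i _; rewrite exprn_ge0. Qed.

Let SE om : S om ^+ 4 = S4 om.
Proof. by rewrite (exprM _ 2 2) !sqr_sqrtr ?sqrtr_ge0. Qed.

Let S0 om : 0 <= S om. Proof. exact: sqrtr_ge0. Qed.

Let SUS om : SU k om <= S om.
Proof.
rewrite -(@ler_pXn2r _ 4)// ?nnegrE// SE /S4 lerDl.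
by apply: sumr_ge0 => i _; rewrite exprn_ge0.
Qed.

Let stS i om : stage_norm 3 k i om <= S om.
Proof.
rewrite -(@ler_pXn2r _ 4)// ?nnegrE// SE /S4 (bigD1 i)//= addrCA lerDl.
by rewrite addr_ge0 ?exprn_ge0//; apply: sumr_ge0 => j _; rewrite exprn_ge0.
Qed.

Let iS4 : P.-integrable [set: Om] (EFin \o S4).
Proof.
apply: integrable_addr; first by have [] := SU4 (ltnW kN).
by apply: integrable_sumr => i; have [] := stage4 i kN.
Qed.

Let Q_le : P.-integrable [set: Om] (EFin \o (fun om => 1 + S4 om)) /\
  (\int[P]_om (1 + S4 om))%R <= moment_bound.
Proof.
have [i1 E1] := Rint_1D iS4; split=> //; rewrite E1 /moment_bound lerD2l.
rewrite RintegralD//; last 2 first.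
- by have [] := SU4 (ltnW kN).
- by apply: integrable_sumr => i; have [] := stage4 i kN.
rewrite Rintegral_sumr; last by move=> i; have [] := stage4 i kN.
rewrite mulrDl mul1r; apply: lerD; first by have [] := SU4 (ltnW kN).
apply: (@le_trans _ _ (\sum_(i < s) M)).
  by apply: ler_sum => i _; have [] := stage4 i kN.
by rewrite sumr_const card_ord mulr_natl.
Qed.

Let noise om : R := derive1 (dM k om) (X k.+1 om).

Let noise_mean : P.-integrable [set: Om] (EFin \o noise) /\ (\int[P]_om noise om)%R = 0.
Proof.
have /andP[t0 _] := step_time (ltnW kN); have /andP[_ tT] := step_time kN.
have tt : k%:R * tau < k.+1%:R * tau by rewrite ltr_pM2r// ltr_nat.
exact: (noise_slope_mean ab hF hW
  (fun h => trig_space_proj a b N (Lambda a b (Phi h))) t0 tt tT (dm_noise hdm kN) (FX kN)).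
Qed.

Let D om : R := Y k.+1 om - noise om.

Let iD : P.-integrable [set: Om] (EFin \o D).
Proof. by apply: integrable_subr; [exact: iY|have [] := noise_mean]. Qed.

Let yE l : y l = (\int[P]_om Y l om)%R. Proof. by rewrite /mean_slope unlock. Qed.

Let diffE : y k.+1 - y k = (\int[P]_om (D om - Y k om))%R.
Proof.
have [in0 n0] := noise_mean.
rewrite RintegralB//; [|exact: iY (ltnW kN)].
by rewrite /D RintegralB// ?n0 ?subr0 ?yE//; exact: iY.
Qed.

Let ae_step : {ae P, forall om,
  `|D om - Y k om| <= 6 * tau * (c * S om) ^+ 2 /\
  D om - Y k om <= tau * (- 2^-1 * Y k om ^+ 2
    + C0 ^+ 2 * (\sum_i w i * stage_norm 1 k i om ^+ 2) + step_error a b N A tau (S om))}.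
Proof.
apply: filterS3 (dm_velocity hdm kN) (dm_char hdm kN) (ae_stages kN) => om hv hx hst.
have [hdMs _ _] := dm_noise hdm kN.
have := @pathwise_step _ a b ab C0 hC0 N s N0 A w tau (ltW tau_gt0) w0 w1
  (U k om) (U k.+1 om) (dM k om) (fun i => Ust k i om) (X k om) (X k.+1 om) (S om)
  (fun i => Xst k i om) (dm_space hdm om (ltnW kN)) (hdMs om) hv hx (SUS om).
case; first by move=> i; rewrite (stage_normE 3 (hst i)).
rewrite (eq_bigr (fun i => w i * stage_norm 1 k i om ^+ 2)) //.
by move=> i _; rewrite (stage_normE 1 (hst i)).
Qed.

Lemma mean_slope_increment : `|y k.+1 - y k| <= 6 * tau * c ^+ 2 * moment_bound.
Proof.
have [iQ hQ] := Q_le.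
have t6 : 0 <= 6 * tau by apply: mulr_ge0 => //; exact: ltW tau_gt0.
have iDY : P.-integrable [set: Om] (EFin \o (fun om => D om - Y k om)).
  by apply: integrable_subr => //; exact: iY (ltnW kN).
rewrite diffE; apply: (le_trans (le_normr_Rintegral _ _)) => //.
apply: (@le_trans _ _ (\int[P]_om (6 * tau * c ^+ 2 * (1 + S4 om)))%R).
  apply: ae_le_Rintegral; [exact: integrable_norm|exact: integrable_scale|].
  apply: filterS ae_step => om [h _]; apply: le_trans h _.
  rewrite exprMn -[leRHS]mulrA; apply: ler_wpM2l => //.
  by apply: ler_wpM2l; [exact: sqr_ge0|rewrite -SE; exact: le1_exp4].
rewrite RintegralZl//; apply: ler_wpM2l => //.
by apply: mulr_ge0 => //; exact: sqr_ge0.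
Qed.

(** The coefficients of the cubic and the quadratic part of [step_error], added so that one factor
    serves both scales. *)
Definition error_constant : R := c ^+ 3 * (4 + 11 * mxabs A) + 7 * c ^+ 2.

Lemma error_constant_ge0 : 0 <= error_constant.
Proof.
have B0 := mxabs_ge0 A.
apply: addr_ge0; first by apply: mulr_ge0; [exact: exprn_ge0|lra].
by apply: mulr_ge0 => //; exact: sqr_ge0.
Qed.

Let step_error_le om : step_error a b N A tau (S om) <=
  error_constant * (tau * Num.sqrt N%:R + (Num.sqrt N%:R)^-1) * (1 + S4 om).
Proof.
have S3 : S om ^+ 3 <= 1 + S4 om by rewrite -SE; apply: le1_exp4.
have S2 : S om ^+ 2 <= 1 + S4 om by rewrite -SE; apply: le1_exp4.
have sN0 : 0 <= Num.sqrt N%:R :> R by exact: sqrtr_ge0.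
have sV0 : 0 <= (Num.sqrt N%:R)^-1 :> R by rewrite invr_ge0.
have t0 := ltW tau_gt0; have B0 := mxabs_ge0 A.
rewrite /step_error /error_constant; move: S3 S2 sN0 sV0 t0 B0.
move: (Num.sqrt N%:R) (Num.sqrt N%:R)^-1 (S om) (1 + S4 om) (mxabs A) tau c0.
move: (cbound a b) => c' q r S' G B t c'0 S3 S2 q0 r0 t0 B0.
have k1 : 0 <= c' ^+ 3 * (4 + 11 * B).
  by rewrite mulr_ge0 ?exprn_ge0// addr_ge0// mulr_ge0.
have k2 : 0 <= 7 * c' ^+ 2 by rewrite mulr_ge0 ?sqr_ge0.
have G0 : 0 <= G by apply: le_trans S2; exact: sqr_ge0.
have h1 : t * q * (c' ^+ 3 * (4 + 11 * B)) * S' ^+ 3 <= t * q * (c' ^+ 3 * (4 + 11 * B)) * G.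
  by apply: ler_wpM2l => //; exact: mulr_ge0 (mulr_ge0 t0 q0) k1.
have h2 : r * (7 * c' ^+ 2) * S' ^+ 2 <= r * (7 * c' ^+ 2) * G.
  by apply: ler_wpM2l => //; exact: mulr_ge0 r0 k2.
have h3 : 0 <= r * (c' ^+ 3 * (4 + 11 * B)) * G by exact: mulr_ge0 (mulr_ge0 r0 k1) G0.
have h4 : 0 <= t * q * (7 * c' ^+ 2) * G by exact: mulr_ge0 (mulr_ge0 (mulr_ge0 t0 q0) k2) G0.
rewrite [leLHS](_ : _ = t * q * (c' ^+ 3 * (4 + 11 * B)) * S' ^+ 3 +
  r * (7 * c' ^+ 2) * S' ^+ 2);
  last by ring.
rewrite [leRHS](_ : _ = t * q * (c' ^+ 3 * (4 + 11 * B)) * G + r * (7 * c' ^+ 2) * G +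
  r * (c' ^+ 3 * (4 + 11 * B)) * G + t * q * (7 * c' ^+ 2) * G); last by ring.
lra.
Qed.

Lemma mean_slope_step : y k.+1 - y k <= tau * (- 2^-1 * y k ^+ 2 +
  2^-1 * stage_constant P a b C0 Nt w Ust +
  error_constant * moment_bound * (tau * Num.sqrt N%:R + (Num.sqrt N%:R)^-1)).
Proof.
have [iQ hQ] := Q_le.
have iDY : P.-integrable [set: Om] (EFin \o (fun om => D om - Y k om)).
  by apply: integrable_subr => //; exact: iY (ltnW kN).
have mYk := mY (ltnW kN).
have iY2 : P.-integrable [set: Om] (EFin \o (fun om => Y k om ^+ 2)).
  apply: (integrable_le _ (integrable_scale (c ^+ 2) iQ)); first exact: measurable_funX.
  move=> om; rewrite ger0_norm ?sqr_ge0// -(real_normK (num_real _)).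
  apply: (@le_trans _ _ ((c * S om) ^+ 2)).
    rewrite ler_sqr ?nnegrE ?mulr_ge0//; apply: le_trans (Yle om (ltnW kN)) _.
    by rewrite ler_wpM2l.
  by rewrite exprMn ler_wpM2l ?sqr_ge0// -SE; apply: le1_exp4.
pose W om := \sum_(i < s) w i * stage_norm 1 k i om ^+ 2.
have i2 i : P.-integrable [set: Om] (EFin \o (fun om => w i * stage_norm 1 k i om ^+ 2)).
  by apply: integrable_scale; have [] := stage2 i kN.
have iW : P.-integrable [set: Om] (EFin \o W) by apply: integrable_sumr.
have EW : C0 ^+ 2 * (\int[P]_om W om)%R <= 2^-1 * stage_constant P a b C0 Nt w Ust.
  apply: le_trans (stage_constant_ge kN); rewrite Rintegral_sumr//.
  rewrite le_eqVlt; apply/orP; left; apply/eqP; congr (_ * _); apply: eq_bigr => i _.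
  by rewrite RintegralZl//; have [] := stage2 i kN.
pose E := error_constant * (tau * Num.sqrt N%:R + (Num.sqrt N%:R)^-1).
have E0 : 0 <= E.
  have sN0 : 0 <= Num.sqrt N%:R :> R by exact: sqrtr_ge0.
  apply: mulr_ge0; first exact: error_constant_ge0.
  by apply: addr_ge0; [apply: mulr_ge0 => //; exact: ltW|rewrite invr_ge0].
have i1 := integrable_scale (- 2^-1) iY2.
have i3 := integrable_scale (C0 ^+ 2) iW.
have i4 := integrable_scale E iQ.
rewrite diffE.
apply: (@le_trans _ _ (\int[P]_om
  (tau * (- 2^-1 * Y k om ^+ 2 + C0 ^+ 2 * W om + E * (1 + S4 om))))%R).
  apply: ae_le_Rintegral => //.
    by apply: integrable_scale; apply: integrable_addr => //; exact: integrable_addr.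
  apply: filterS ae_step => om [_ h]; apply: le_trans h _.
  by rewrite ler_wpM2l ?(ltW tau_gt0)// lerD2l; exact: step_error_le.
rewrite RintegralZl//; last by apply: integrable_addr => //; exact: integrable_addr.
rewrite ler_wpM2l ?(ltW tau_gt0)//.
rewrite RintegralD//; last exact: integrable_addr.
rewrite RintegralD// !RintegralZl//; apply: lerD; first apply: lerD => //.
  rewrite !mulNr lerN2 ler_wpM2l ?invr_ge0// yE.
  exact: (sqr_Rintegral_le (iY (ltnW kN)) iY2).
by rewrite [leRHS](_ : _ = E * moment_bound); [exact: ler_wpM2l|rewrite /E; ring].
Qed.

End OneTimeStep.
End StepExpectation.

(** * Differential inequality and blow-up *)

Section Riccati.
Context {R : realType}.

(* With u = -y, v = -y', the claim reads 2c(v-u)/(v^2-c^2) <= ln r for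
   r = (u+c)(v-c)/((u-c)(v+c)), which follows from ln r >= 1 - 1/r. *)
Lemma blowup_time_step (c y y' tau : R) : 0 < c -> y < - c -> y' <= y ->
  y' - y <= - (tau / 2) * (y' ^+ 2 - c ^+ 2) ->
  c^-1 * ln ((c - y') / (- y' - c)) + tau <= c^-1 * ln ((c - y) / (- y - c)).
Proof.
move=> c0 yc y'y h.
pose u := - y; pose v := - y'.
have [uc uv] : c < u /\ u <= v by rewrite /u /v; split; lra.
have -> : c - y' = v + c by rewrite /v; lra.
have -> : c - y = u + c by rewrite /u; lra.
have -> : - y' - c = v - c by [].
have -> : - y - c = u - c by [].
have hv : tau / 2 * (v ^+ 2 - c ^+ 2) <= v - u by rewrite /u /v sqrrN; lra.
clearbody u v; clear h yc y'y.
have [p1 p2 p3 p4] : [/\ 0 < u + c, 0 < v - c, 0 < u - c & 0 < v + c].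
  by split; lra.
have nz : [/\ u + c != 0, v - c != 0, u - c != 0 & v + c != 0].
  by split; rewrite gt_eqF.
pose r := ((v + c) / (v - c)) / ((u + c) / (u - c)).
have r0 : 0 < r by rewrite !divr_gt0.
have hr : ln ((v + c) / (v - c)) - ln ((u + c) / (u - c)) <= r - 1.
  rewrite -ln_div ?posrE ?divr_gt0// -/r.
  by have := @le_ln1Dx _ (r - 1); rewrite [1 + _]addrC subrK; apply; lra.
have rE : r - 1 = - (2 * c * (v - u) / ((u + c) * (v - c))).
  by case: nz => *; rewrite /r; field; apply/and3P; split.
have le1 : c * tau <= 2 * c * (v - u) / ((u + c) * (v - c)).
  rewrite ler_pdivlMr ?mulr_gt0//.
  (* For tau <= 0 the left side is nonpositive. Otherwise u <= v enlarges the denominator to v^2 -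
     c^2, where [hv] is exactly the required bound. *)
  have [t0|t0] := leP tau 0.
    apply: (@le_trans _ _ 0); last by rewrite !mulr_ge0// ?subr_ge0// ltW.
    by rewrite pmulr_lle0 ?mulr_gt0// pmulr_rle0.
  apply: (@le_trans _ _ (c * tau * ((v + c) * (v - c)))).
    by rewrite ler_wpM2l ?mulr_ge0 ?(ltW c0) ?(ltW t0)// ler_wpM2r ?(ltW p2)// lerD2r.
  have -> : c * tau * ((v + c) * (v - c)) = 2 * c * (tau / 2 * (v ^+ 2 - c ^+ 2)) by field.
  by rewrite ler_wpM2l// mulr_ge0// ltW.
rewrite -(ler_pM2l c0) mulrDr !mulVKf ?gt_eqF//.
lra.
Qed.

Lemma interpolation_derive (tau t : R) (y : nat -> R) k : 0 < tau ->
  k%:R * tau < t < k.+1%:R * tau ->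
  [/\ is_derive t (1 : R) (interpolation tau y) ((y k.+1 - y k) / tau) &
      interpolation tau y t = y k + (t - k%:R * tau) / tau * (y k.+1 - y k)].
Proof.
move=> tau0 /andP[t1 t2].
pose f z := y k + (z - k%:R * tau) / tau * (y k.+1 - y k).
have fE z : k%:R * tau < z < k.+1%:R * tau -> interpolation tau y z = f z.
  move=> /andP[z1 z2]; rewrite /interpolation (@truncn_def _ (z / tau) k)//.
  by rewrite ler_pdivlMr// ltr_pdivrMr// (ltW z1).
split; last by rewrite fE// t1 t2.
apply: (@near_eq_is_derive _ _ _ f).
  near=> z; rewrite fE//; apply/andP; split; near: z.
    exact: lt_nbhsr.
  exact: lt_nbhsl.
rewrite /f; apply: is_derive_eq.
by rewrite /GRing.scale /=; field; rewrite gt_eqF.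
Unshelve. all: by end_near. Qed.

(** Moves the Riccati term from the left grid value to any interpolated value: difference of
    squares, with the sum of the two values at most 2 m. *)
Lemma sqr_convex_comb_dist (u v m th : R) : 0 <= th <= 1 -> `|u| <= m -> `|v| <= m ->
  `|u ^+ 2 - (u + th * (v - u)) ^+ 2| <= `|v - u| * (2 * m).
Proof.
move=> /andP[h0 h1] um vm.
have -> : u ^+ 2 - (u + th * (v - u)) ^+ 2 =
  - (th * (v - u)) * (u + ((1 - th) * u + th * v)) by ring.
have hc : `|(1 - th) * u + th * v| <= m.
  apply: le_trans (ler_normD _ _) _; rewrite !normrM (ger0_norm h0).
  rewrite (ger0_norm (_ : 0 <= 1 - th)) ?subr_ge0//.
  have -> : m = (1 - th) * m + th * m by ring.
  by apply: lerD; rewrite ler_wpM2l ?subr_ge0.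
rewrite normrM normrN normrM (ger0_norm h0); apply: ler_pM => //.
- by rewrite mulr_ge0.
- by rewrite ler_piMl.
- apply: le_trans (ler_normD _ _) _; lra.
Qed.

End Riccati.

Theorem theorem3p2 (R : realType) (a b T M C0 : R) (s : nat)
    (A : 'M[R]_s) (w : 'I_s -> R)
    (hab : a < b) (hT : 0 < T) (hM : 0 < M)
    (hA : A \in unitmx) (hsymp : symplectic A w)
    (hw1 : \sum_(i < s) w i = 1) (hw0 : forall i, 0 <= w i)
    (hC0 : is_embedding_norm a b C0) :
  exists2 CT : R, 0 < CT &
  forall (d : measure_display) (Om : measurableType d) (P : probability Om R)
    (F : R -> set (set Om)) (e : nat -> R -> R) (beta : nat -> R -> Om -> R)
    (Phi : (R -> R) -> R -> R) (u0 : R -> R) (x0 : R) (N Nt : nat)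
    (U : nat -> Om -> R -> R) (Ust : nat -> 'I_s -> Om -> R -> R)
    (dM : nat -> Om -> R -> R)
    (X : nat -> Om -> R) (Xst : nat -> 'I_s -> Om -> R),
  (0 < N)%N -> (0 < Nt)%N ->
  filtration T F ->
  cylindrical_wiener P T F a b e beta ->
  sobolev0 a b 3 u0 ->
  (forall h, L2_0 a b h -> L2_0 a b (Phi h)) ->
  hilbert_schmidt a b 3 (fun h => Lambda a b (Phi h)) ->
  T / Nt%:R * Num.sqrt N%:R <= 1 ->
  discrete_method P T F a b N Nt A w e beta Phi u0 x0 U Ust dM X Xst ->
  uniform_regularity P a b Nt U Ust M ->
  let tau := T / Nt%:R in
  let y := mean_slope P U X in
  let C := stage_constant P a b C0 Nt w Ust
           + CT * (2 * (Num.sqrt N%:R)^-1 + tau + 2 * tau * Num.sqrt N%:R) in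
  let Chat := C + CT * tau in
  let yt := interpolation tau y in
  [/\ forall k, (k < Nt)%N ->
        (y k.+1 - y k) / tau <= - 2^-1 * y k ^+ 2 + 2^-1 * C,
      {ae (@lebesgue_measure R), forall t, 0 < t < T ->
        derivable yt t 1 /\
        derive1 yt t <= - 2^-1 * yt t ^+ 2 + 2^-1 * Chat} &
      y 0%N < - Num.sqrt Chat -> T < blowup_time Chat (y 0%N)].
Proof.
pose c := cbound a b; pose Q := moment_bound M s; pose K := error_constant a b A.
have c1 : 1 <= c := cbound_ge1 hab.
have Q1 : 1 <= Q by rewrite /Q /moment_bound lerDl mulr_ge0 ?(ltW hM)// addr_ge0 ?ler0n.
have K0 : 0 <= K := error_constant_ge0 A hab.
have KQ0 : 0 <= K * Q by apply: mulr_ge0; lra.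
have cQ0 : 0 <= c ^+ 3 * Q ^+ 2 by apply: mulr_ge0; apply: exprn_ge0; lra.
(* K * Q pays for the one-step remainder. The middle term pays for interpolation: the increment
   bound 6 tau c^2 Q times 2 c Q, twice the bound on the mean slope. The summand 1 makes the
   constant positive. *)
exists (K * Q + 12 * (c ^+ 3 * Q ^+ 2) + 1); first lra.
set CT := K * Q + _ + 1.
move=> d Om P F e beta Phi u0 x0 N Nt U Ust dM X Xst N0 Nt0 hF hW _ _ _ _ hdm hreg.
move=> tau y C Chat yt.
have tau0 : 0 < tau by rewrite divr_gt0// ltr0n.
have tauNt : Nt%:R * tau = T by rewrite mulrC divfK// pnatr_eq0 -lt0n.
have sN0 : 0 <= Num.sqrt N%:R :> R by exact: sqrtr_ge0.
have sV0 : 0 <= (Num.sqrt N%:R)^-1 :> R by rewrite invr_ge0.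
have tsN0 : 0 <= tau * Num.sqrt N%:R by rewrite mulr_ge0// ltW.
have C2 : 0 <= stage_constant P a b C0 Nt w Ust.
  exact: (stage_constant_ge0 _ hab hT hw1 hw0 Nt0 hF hdm hreg).
have ybd k : (k <= Nt)%N -> `|y k| <= c * Q.
  exact: (mean_slope_bound hab hT hw1 Nt0 hF hdm hreg).
have yinc k : (k < Nt)%N -> `|y k.+1 - y k| <= 6 * tau * c ^+ 2 * Q.
  exact: (mean_slope_increment hab hT hw1 hw0 hC0 N0 Nt0 hF hW hdm hreg).
have H1 k : (k < Nt)%N -> (y k.+1 - y k) / tau <= - 2^-1 * y k ^+ 2 + 2^-1 * C.
  move=> kN; rewrite ler_pdivrMr// mulrC.
  have := mean_slope_step hab hT hw1 hw0 hC0 N0 Nt0 hF hW hdm hreg kN.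
  move=> /le_trans; apply; apply: ler_wpM2l; first exact: ltW.
  rewrite -addrA lerD2l /C [2^-1 * (_ + _)]mulrDr lerD2l -/K -/Q.
  set x := tau * Num.sqrt N%:R in tsN0 *; set z := (Num.sqrt N%:R)^-1 in sV0 *.
  have hx : K * Q * (x + z) <= CT * (x + z).
    by apply: ler_wpM2r; [rewrite addr_ge0|rewrite /CT; lra].
  have ht : 0 <= CT * tau by apply: mulr_ge0; [rewrite /CT; lra|exact: ltW].
  have -> : 2^-1 * (CT * (2 * z + tau + 2 * tau * Num.sqrt N%:R)) =
    CT * (x + z) + 2^-1 * (CT * tau) by rewrite /x; field.
  lra.
(* Used for three kinds of [th]: intermediate values give the differential inequality, 0 shows that
   y decreases once it is below - sqrt Chat, and 1 is the implicit inequality required by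
   [blowup_time_step]. *)
have H2 k th : (k < Nt)%N -> 0 <= th <= 1 -> (y k.+1 - y k) / tau <=
    - 2^-1 * (y k + th * (y k.+1 - y k)) ^+ 2 + 2^-1 * Chat.
  move=> kN th01; apply: le_trans (H1 k kN) _.
  have := sqr_convex_comb_dist th01 (ybd k (ltnW kN)) (ybd k.+1 kN).
  have := ler_wpM2r (_ : 0 <= 2 * (c * Q)) (yinc k kN).
  move=> /(_ ltac:(apply: mulr_ge0 => //; apply: mulr_ge0; lra)) h1 h2.
  have : `|y k ^+ 2 - (y k + th * (y k.+1 - y k)) ^+ 2| <= CT * tau.
    apply: le_trans h2 _; apply: le_trans h1 _.
    have -> : 6 * tau * c ^+ 2 * Q * (2 * (c * Q)) = 12 * (c ^+ 3 * Q ^+ 2) * tau by ring.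
    by apply: ler_wpM2r; [exact: ltW|rewrite /CT; lra].
  rewrite ler_norml /Chat => /andP[h3 h4].
  lra.
have Chat0 : 0 < Chat.
  have C0' : 0 <= C.
    rewrite /C addr_ge0// mulr_ge0//; first by rewrite /CT; lra.
    by rewrite -mulrA; lra.
  by rewrite /Chat ltr_wpDl// mulr_gt0// /CT; lra.
split => //.
  (* The exceptional null set is the countable set of all multiples of tau, off which the
     interpolation is locally affine. *)
  have cgrid : countable (range (fun k : nat => k%:R * tau)).
    exact: sub_countable (card_image_le _ _) (countableP _).
  exists (range (fun k : nat => k%:R * tau)); split.
  - by apply: countable_measurable => // x; exact: measurable_set1.
  - exact: countable_lebesgue_measure0.
  move=> t /= /not_implyP[/andP[t0 tT] nt]; apply: contrapT => hgrid; apply: nt.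
  have nz : 0 <= t / tau by rewrite divr_ge0// ltW.
  pose k := Num.truncn (t / tau).
  have /andP[k1 k2] := truncn_itv nz.
  rewrite ler_pdivlMr// -/k in k1; rewrite ltr_pdivrMr// -/k in k2.
  have k1' : k%:R * tau < t.
    rewrite lt_neqAle k1 andbT; apply/eqP => tE; apply: hgrid; by exists k.
  have kN : (k < Nt)%N.
    by rewrite -(ltr_nat R) -(ltr_pM2r tau0) tauNt; exact: lt_trans tT.
  have [dt yE] := @interpolation_derive _ tau t y k tau0 ltac:(by rewrite k1').
  have [ddt dtE] := dt.
  split=> //; rewrite derive1E /yt dtE yE; apply: H2 => //.
  apply/andP; split; first by rewrite divr_ge0 ?subr_ge0// ltW.
  rewrite ler_pdivrMr// mul1r lerBlDr; move: k2; rewrite -[k.+1]addn1 natrD; lra.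
set q := Num.sqrt Chat => y0q.
have q0 : 0 < q by rewrite sqrtr_gt0.
have q2 : q ^+ 2 = Chat by rewrite sqr_sqrtr// ltW.
have main k : (k <= Nt)%N -> y k < - q /\
    q^-1 * ln ((q - y k) / (- y k - q)) + k%:R * tau <= blowup_time Chat (y 0%N).
  elim: k => [_|k IH kN]; first by split=> //; rewrite mul0r addr0.
  have [yk hk] := IH (ltnW kN).
  have yq2 : q ^+ 2 < y k ^+ 2.
    have : 0 < (- y k - q) * (- y k + q) by rewrite mulr_gt0; lra.
    have -> : (- y k - q) * (- y k + q) = y k ^+ 2 - q ^+ 2 by ring.
    lra.
  have d0 := H2 k 0 kN ltac:(by rewrite lexx ler01).
  have d1 := H2 k 1 kN ltac:(by rewrite lexx ler01).
  rewrite mul0r addr0 -q2 ler_pdivrMr// in d0.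
  rewrite mul1r [y k + _]addrC subrK -q2 ler_pdivrMr// in d1.
  have yy : y k.+1 <= y k.
    rewrite -subr_le0; apply: le_trans d0 _; rewrite pmulr_lle0//; lra.
  split; first lra.
  have := @blowup_time_step _ q (y k) (y k.+1) tau q0 yk yy.
  have -> : - (tau / 2) * (y k.+1 ^+ 2 - q ^+ 2) =
    (- 2^-1 * y k.+1 ^+ 2 + 2^-1 * q ^+ 2) * tau by field.
  move=> /(_ d1) st.
  have -> : k.+1%:R * tau = k%:R * tau + tau by rewrite -natr1 mulrDl mul1r.
  lra.
(* After Nt steps the remaining blow-up time is still strictly positive, because y(Nt) < - q makes
   the argument of the logarithm exceed 1. Hence the inequality with T is strict. *)
have [yN hN] := main Nt (leqnn Nt); rewrite tauNt in hN.
apply: lt_le_trans hN; rewrite ltrDr mulr_gt0 ?invr_gt0// ln_gt0//.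
by rewrite ltr_pdivlMr ?mul1r; lra.
Qed.
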